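(* Let $\mathbf X_1,\mathbf X_2,\dots$ be i.i.d. random vectors in $\mathbb R^p$ with distribution $H_0$, and for each $n$ let $\mathbf U_i=\mathbf U_i(\mathbf t_n)\in\{0,1\}^p$, $1\le i\le n$, be the indicators of observed (unfiltered) entries of $\mathbf X_i$ defined in the context. Assume: (A1) $\rho$ is an even function that is non-decreasing in $|t|$, strictly increasing at $0$ (i.e. $\rho(t)>\rho(0)$ for $t>0$), continuous, with $\rho(0)=0$ and $\lim_{v\to\infty}\rho(v)=1$. (A2) $H_0$ is elliptical, with density $$f(\mathbf x)=|\mathbf\Sigma_0|^{-1/2}f_0\big(d(\mathbf x,\boldsymbol\mu_0,\mathbf\Sigma_0)\big),$$ where $\boldsymbol\mu_0\in\mathbb R^p$, $\mathbf\Sigma_0$ is a $p\times p$ positive definite matrix, and $f_0$ is non-increasing and strictly decreasing at $0$ (i.e. $f_0(t)<f_0(0)$ for $t>0$). (A3) Let $\sigma(\boldsymbol\mu,\mathbf\Sigma)$ denote the solution in $\sigma$ of $$E_{H_0}\left[\rho\left(\frac{d(\mathbf X,\boldsymbol\mu,\mathbf\Sigma)}{c_p\,\sigma}\right)\right]=b .$$ The problem of minimizing $\sigma(\boldsymbol\mu,\mathbf\Sigma)$ over $\boldsymbol\mu\in\mathbb R^p$ and positive definite $\mathbf\Sigma$ with $|\mathbf\Sigma|=1$ has a unique solution $(\boldsymbol\mu_0,\mathbf\Sigma_{00})$, with $\mathbf\Sigma_{00}$ positive definite. Put $\sigma_0=\sigma(\boldsymbol\mu_0,\mathbf\Sigma_{00})$.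 (A4) The proportion of fully observed cases, $q_n=\#\{i:1\le i\le n,\ p(\mathbf U_i(\mathbf t_n))=p\}/n$, tends to $1$ almost surely as $n\to\infty$. Let $(\widehat{\boldsymbol\mu}_{GS},\widehat{\mathbf\Sigma}_{GS})$ be the generalized S-estimator (defined in the context) computed from $\mathbb X=(\mathbf X_1,\dots,\mathbf X_n)'$ and $\mathbb U=\mathbb U(\mathbf t_n)=(\mathbf U_1(\mathbf t_n),\dots,\mathbf U_n(\mathbf t_n))'$. Then, as $n\to\infty$: (i) $\widehat{\boldsymbol\mu}_{GS}\to\boldsymbol\mu_0$ almost surely; (ii) $\widehat{\mathbf\Sigma}_{GS}\to\sigma_0\mathbf\Sigma_{00}$ almost surely; (iii) when $H_0=N_p(\boldsymbol\mu_0,\mathbf\Sigma_0)$, we have $\sigma_0\mathbf\Sigma_{00}=\mathbf\Sigma_0$.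
   Context: **Notation.** The dimension $p$ is fixed. $|A|$ is the determinant of a square matrix $A$. For positive definite $\mathbf C$ of size $k\times k$ and $\mathbf x,\mathbf m\in\mathbb R^k$, $d(\mathbf x,\mathbf m,\mathbf C)=(\mathbf x-\mathbf m)'\mathbf C^{-1}(\mathbf x-\mathbf m)$ and $d^*(\mathbf x,\mathbf m,\mathbf C)=d(\mathbf x,\mathbf m,\mathbf C^* )$, where $\mathbf C^*=\mathbf C/|\mathbf C|^{1/k}$ (so $|\mathbf C^*|=1$). For $\mathbf u\in\{0,1\}^p$, $p(\mathbf u)=\sum_{j=1}^p u_j$, and $\mathbf m^{(\mathbf u)}$, $\mathbf A^{(\mathbf u)}$ denote the sub-vector of $\mathbf m\in\mathbb R^p$ and the sub-matrix of the $p\times p$ matrix $\mathbf A$ with entries (rows and columns) corresponding to the positive entries of $\mathbf u$. **Tuning constants.** $b=0.5$, and $c_k$, $1\le k\le p$, is chosen so that $E[\rho(\|\mathbf Y\|^2/c_k)]=b$ for $\mathbf Y\sim N_k(\mathbf 0,\mathbf I)$. **Filter (Step I).** Let $\mathbf T_{0n}=(T_{0n,1},\dots,T_{0n,p})$ and $\mathbf S_{0n}=(S_{0n,1},\dots,S_{0n,p})$ be initial coordinatewise location and dispersion estimators (the paper uses coordinatewise median and median absolute deviation). Put $Z_{ij}=(X_{ij}-T_{0n,j})/S_{0n,j}$ and $\widehat F^+_{n,j}(t)=\frac1n\sum_{i=1}^n I(|Z_{ij}|\le t)$. For each $j$ let $F_j$ be a chosen reference distribution (the paper uses the standard normal), $F_j^+$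 the distribution function of $|Z|$ for $Z\sim F_j$, and $\eta_j=(F_j^+)^{-1}(\alpha)$ for a fixed $\alpha\in(0,1)$ (the paper uses $\alpha=0.95$). Define $$d_{n,j}=\sup_{t\ge\eta_j}\{F_j^+(t)-\widehat F^+_{n,j}(t)\}^+,\qquad t_{n,j}=\min\{t:\widehat F^+_{n,j}(t)\ge 1-d_{n,j}\},$$ where $\{a\}^+=\max(a,0)$. Let $\mathbf t_n=(t_{n,1},\dots,t_{n,p})$ and $\mathbf U_i(\mathbf t_n)=(U_{i1},\dots,U_{ip})'$ with $U_{ij}=I(|Z_{ij}|<t_{n,j})$; $U_{ij}=1$ means that the entry $X_{ij}$ is treated as observed, and $U_{ij}=0$ that it is treated as missing. **Generalized S-estimator (Step II).** Let $\widehat{\mathbf\Omega}$ be a $p\times p$ positive definite initial estimator of $\mathbf\Sigma_0$ (the paper uses the extended minimum volume ellipsoid estimator). For $\boldsymbol\mu\in\mathbb R^p$ and positive definite $p\times p$ matrices $\mathbf\Sigma$ and $\mathbf\Omega$, the generalized M-scale $s_{GS}(\boldsymbol\mu,\mathbf\Sigma,\mathbf\Omega,\mathbb X,\mathbb U)$ is the solution in $s$ of $$\sum_{i=1}^n c_{p(\mathbf U_i)}\,\rho\left(\frac{d^*\big(\mathbf X_i^{(\mathbf U_i)},\boldsymbol\mu^{(\mathbf U_i)},\mathbf\Sigma^{(\mathbf U_i)}\big)}{s\,c_{p(\mathbf U_i)}\,\big|\mathbf\Omega^{(\mathbf U_i)}\big|^{1/p(\mathbf U_i)}}\right)=b\sum_{i=1}^n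 c_{p(\mathbf U_i)},$$ where cases with $p(\mathbf U_i)=0$ contribute nothing to either sum. The generalized S-estimator is $$(\widehat{\boldsymbol\mu}_{GS},\widehat{\mathbf\Sigma}_{GS})=\arg\min_{\boldsymbol\mu,\mathbf\Sigma}s_{GS}(\boldsymbol\mu,\mathbf\Sigma,\widehat{\mathbf\Omega},\mathbb X,\mathbb U)$$ subject to the constraint $s_{GS}(\boldsymbol\mu,\mathbf\Sigma,\mathbf\Sigma,\mathbb X,\mathbb U)=1$. (The objective is invariant under $\mathbf\Sigma\mapsto\lambda\mathbf\Sigma$, $\lambda>0$; the constraint fixes the size of $\mathbf\Sigma$.) *)

(* Defs.v *)
From HB Require Import structures.
From mathcomp Require Import all_boot all_order all_algebra finmap.
From mathcomp Require Import all_classical all_reals all_analysis.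

Set Implicit Arguments.
Unset Strict Implicit.
Unset Printing Implicit Defensive.

Import Order.TTheory GRing.Theory Num.Theory.
Import numFieldNormedType.Exports.

Local Open Scope classical_set_scope.
Local Open Scope ring_scope.

(* Vectors of R^p are row vectors, so that they are the rows of a data matrix.
   R^p carries the sigma-algebra generated by its p coordinates. *)
Definition measure_rV_display : measure_display.
Proof. exact: default_measure_display. Qed.

Section measurable_rV.
Variables (R : realType) (n : nat).

Let coor (i : 'I_n) (x : 'rV[R]_n) : measurableTypeR R := x 0 i.

Let rV_set0 : g_sigma_preimage coor set0.
Proof. exact: sigma_algebra0. Qed.

Let rV_setC A : g_sigma_preimage coor A -> g_sigma_preimage coor (~` A).
Proof. exact: sigma_algebraC. Qed.

Let rV_bigcup (F : _^nat) : (forall i, g_sigma_preimage coor (F i)) ->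
  g_sigma_preimage coor (\bigcup_i (F i)).
Proof. exact: sigma_algebra_bigcup. Qed.

HB.instance Definition _ := @isMeasurable.Build
  measure_rV_display 'rV[R]_n
  (g_sigma_preimage coor) rV_set0 rV_setC rV_bigcup.

End measurable_rV.

Section measurability_rV.
Context (R : realType).

Lemma measurable_coor n (i : 'I_n) :
  measurable_fun [set: 'rV[R]_n] (fun x => x 0 i : measurableTypeR R).
Proof.
move=> _ Y mY; rewrite setTI; apply: sub_sigma_algebra => /=.
rewrite -bigcup_seq/=; exists i => /=; first by rewrite mem_index_enum.
by exists Y => //; rewrite setTI.
Qed.

Lemma measurable_fun_rV d (T : measurableType d) n (f : T -> 'rV[R]_n) :
  (forall i, measurable_fun [set: T] (fun t => f t 0 i : measurableTypeR R)) ->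
  measurable_fun [set: T] f.
Proof.
move=> mf _ A; move: A; apply: smallest_sub.
  split=> [|A|F] /=.
  - by rewrite preimage_set0 setI0; exact: measurable0.
  - rewrite !setTI setTD => mA; rewrite preimage_setC; exact: measurableC.
  - move=> mF; rewrite setTI preimage_bigcup; apply: bigcup_measurable => k _.
    by have := mF k; rewrite setTI.
rewrite -bigcup_seq/= => A [i _] [B mB <-].
by have := mf i measurableT B mB; rewrite !setTI.
Qed.

Definition cons_rV n (z : measurableTypeR R * 'rV[R]_n) : 'rV[R]_n.+1 :=
  row_mx (z.1 : R)%:M z.2.

Definition split_rV n (x : 'rV[R]_n.+1) : measurableTypeR R * 'rV[R]_n :=
  (x 0 0, \row_i x 0 (lift 0 i)).

Lemma cons_rVK n : cancel (@cons_rV n) (@split_rV n).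
Proof.
move=> [a v]; congr (_, _) => /=.
  by rewrite /cons_rV mxE; case: splitP => // j _; rewrite ord1 mxE.
apply/rowP => i; rewrite mxE /cons_rV mxE.
case: splitP => [j /= /eqP|k /= [ik]]; last by congr (v _ _); exact/val_inj.
by rewrite ord1.
Qed.

Lemma split_rVK n : cancel (@split_rV n) (@cons_rV n).
Proof.
move=> x; apply/rowP => i; rewrite /cons_rV mxE.
case: splitP => [j ij|k ik] /=.
  have -> : i = 0 by apply/val_inj; rewrite [LHS]ij ord1.
  by rewrite ord1 mxE/= mulr1n.
by rewrite mxE; congr (x _ _); apply/val_inj; rewrite /= ik.
Qed.

Lemma measurable_cons_rV n : measurable_fun setT (@cons_rV n).
Proof.
apply: measurable_fun_rV => i.
have [->|i0] := eqVneq i 0.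
  apply: (eq_measurable_fun fst) => [[a v] _|]; last exact: measurable_fst.
  by have /(congr1 fst) := cons_rVK (a, v).
have [k ->] : exists k, i = lift 0 k.
  by have [k ->|] := unliftP 0 i; [exists k|move/eqP; rewrite (negbTE i0)].
apply: (eq_measurable_fun
    ((fun v : 'rV[R]_n => v 0 k : measurableTypeR R) \o snd)) => [[a v] _ /=|].
  by have /(congr1 snd)/rowP/(_ k) := cons_rVK (a, v); rewrite mxE.
by apply: measurableT_comp; [exact: measurable_coor|exact: measurable_snd].
Qed.

Lemma measurable_split_rV n : measurable_fun setT (@split_rV n).
Proof.
apply: measurable_fun_pair; first exact: measurable_coor.
apply: measurable_fun_rV => i.
apply: (eq_measurable_fun
    (fun x : 'rV[R]_n.+1 => x 0 (lift 0 i) : measurableTypeR R)).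
  by move=> x _; rewrite mxE.
exact: measurable_coor.
Qed.

End measurability_rV.

Section cons_lebesgue.
Context (R : realType) (n : nat).
Variable mu : {sigma_finite_measure set 'rV[R]_n -> \bar R}.

Definition cons_lebesgue : set 'rV[R]_n.+1 -> \bar R :=
  pushforward (lebesgue_measure \x mu)%E (@cons_rV R n).

Let cons_lebesgue0 : cons_lebesgue set0 = 0%E.
Proof. by rewrite /cons_lebesgue /pushforward preimage_set0 measure0. Qed.

Let cons_lebesgue_ge0 A : (0 <= cons_lebesgue A)%E.
Proof. exact: (measure_ge0 (lebesgue_measure \x mu)%E). Qed.

Let cons_lebesgue_sigma_additive : semi_sigma_additive cons_lebesgue.
Proof.
exact: (@measure_semi_sigma_additive _ _ _
  (@measure_function_pushforward__canonical__measure_function_Measure _ _ _ _ _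
    (lebesgue_measure \x mu)%E _ (@measurable_cons_rV R n))).
Qed.

HB.instance Definition _ := isMeasure.Build _ _ _ cons_lebesgue
  cons_lebesgue0 cons_lebesgue_ge0 cons_lebesgue_sigma_additive.

Let cons_lebesgue_sigma_finite : sigma_finite setT cons_lebesgue.
Proof.
have /sigma_finiteP[F [FT Fnd Foo]] := sigma_finiteT (@lebesgue_measure R).
have /sigma_finiteP[G [GT Gnd Goo]] := sigma_finiteT mu.
exists (fun k => @split_rV R n @^-1` (F k `*` G k)).
  rewrite -preimage_bigcup (_ : \bigcup_k _ = setT) ?preimage_setT//.
  rewrite -setXTT FT GT predeqE => -[x y]; split.
    by move=> [k _ []/= ? ?]; split; exists k.
  move=> [/= [k _ Fkx] [l _ Gly]]; exists (maxn k l) => //; split.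
  - by move: x Fkx; exact/subsetPset/Fnd/leq_maxl.
  - by move: y Gly; exact/subsetPset/Gnd/leq_maxr.
move=> k; have [mF Fk] := Foo k; have [mG Gk] := Goo k; split.
  rewrite -[X in measurable X]setTI.
  by apply: measurable_split_rV => //; exact: measurableX.
rewrite /cons_lebesgue /pushforward -comp_preimage.
rewrite (_ : _ \o _ = id); last by apply/funext => z /=; rewrite cons_rVK.
by rewrite /= product_measure1E// lte_mul_pinfty// ge0_fin_numE.
Qed.

HB.instance Definition _ := Measure_isSigmaFinite.Build _ _ _ cons_lebesgue
  cons_lebesgue_sigma_finite.

End cons_lebesgue.

(* Lebesgue measure on R^n, by recursion: the point mass on the one-point space
   R^0, and the product of Lebesgue measures on R and R^n for R^n.+1. *)
Fixpoint lebesgue_rV (R : realType) (n : nat) :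
    {sigma_finite_measure set 'rV[R]_n -> \bar R} :=
  match n with
  | 0%N => \d_(0 : 'rV[R]_0)
  | n'.+1 => cons_lebesgue (lebesgue_rV R n')
  end.

Lemma lebesgue_rV_box (R : realType) n (A : 'I_n -> set R) :
  (forall i, measurable (A i)) ->
  lebesgue_rV R n [set x | forall i, A i (x 0 i)] =
  (\prod_(i < n) lebesgue_measure (A i))%E.
Proof.
elim: n A => [|n IH] A mA.
  by rewrite big_ord0 /= diracE mem_set// => -[].
rewrite big_ord_recl -IH//.
pose B : set 'rV[R]_n := [set v | forall i, A (lift 0 i) (v 0 i)].
have mB : measurable B.
  rewrite (_ : B = \bigcap_(i in [set: 'I_n])
      [set v : 'rV[R]_n | A (lift 0 i) (v 0 i)]); last first.
    by apply/seteqP; split => [v Bv i _|v Bv i]; [exact: Bv|exact: (Bv i I)].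
  apply: fin_bigcap_measurable => // i _.
  rewrite -[X in measurable X]setTI.
  exact: (@measurable_coor R n i measurableT _ (mA _)).
rewrite -(product_measure1E lebesgue_measure (lebesgue_rV R n))//; last exact: mA.
rewrite /= /cons_lebesgue /pushforward; congr (_ _).
apply/seteqP; split => -[a v] /=.
  move=> H; have /= E := cons_rVK (a, v); move: (congr1 fst E) => /= Ea.
  move: (congr1 snd E) => /= Ev; split; first by rewrite -Ea; exact: H.
  by move=> i; rewrite -Ev mxE; exact: H.
move=> [Aa Bv] i; have /= E := cons_rVK (a, v).
have [->|i0] := eqVneq i 0; first by move: (congr1 fst E) => /= ->.
have [k ->] : exists k, i = lift 0 k.
  by have [k ->|] := unliftP 0 i; [exists k|move/eqP; rewrite (negbTE i0)].
by move: (congr1 snd E) => /= /rowP/(_ k); rewrite mxE => ->; exact: Bv.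
Qed.

Section linear_algebra.
Context (R : realType).

Definition posdef k (C : 'M[R]_k) : Prop :=
  C^T = C /\ forall x : 'rV[R]_k, x != 0 -> 0 < (x *m C *m x^T) 0 0.

Definition mahalanobis k (x m : 'rV[R]_k) (C : 'M[R]_k) : R :=
  ((x - m) *m invmx C *m (x - m)^T) 0 0.

Definition mahalanobis_star k (x m : 'rV[R]_k) (C : 'M[R]_k) : R :=
  mahalanobis x m ((\det C `^ k%:R^-1)^-1 *: C).

(* A vector u of {0,1}^p is encoded as the set of the j such that u_j = 1, so
   that p(u) is #|u|; the retained coordinates are listed in increasing order. *)
Definition subvec p (u : {set 'I_p}) (m : 'rV[R]_p) : 'rV[R]_#|u| :=
  colsub enum_val m.

Definition submat p (u : {set 'I_p}) (A : 'M[R]_p) : 'M[R]_#|u| :=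
  mxsub enum_val enum_val A.

End linear_algebra.

Definition argmin (R : realType) (T : Type) (A : set T) (f : T -> R) : set T :=
  [set x | A x /\ forall y, A y -> f x <= f y].

Section probability.
Context (R : realType).

(* Density with respect to Lebesgue measure on R^k. *)
Definition has_density k (mu : set 'rV[R]_k -> \bar R) (f : 'rV[R]_k -> R) :
    Prop :=
  [/\ forall x, 0 <= f x, measurable_fun setT f &
      forall A, measurable A ->
        mu A = (\int[lebesgue_rV R k]_(x in A) (f x)%:E)%E].

Definition mvnormal_pdf k (m : 'rV[R]_k) (C : 'M[R]_k) (x : 'rV[R]_k) : R :=
  (Num.sqrt ((2 * pi) ^+ k * \det C))^-1 * expR (- (mahalanobis x m C / 2)).

Definition mvnormal k (m : 'rV[R]_k) (C : 'M[R]_k) (A : set 'rV[R]_k) :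
    \bar R :=
  (\int[lebesgue_rV R k]_(x in A) (mvnormal_pdf m C x)%:E)%E.

Definition iid d (T : measurableType d) (P : probability T R)
    d' (E : measurableType d') (H : probability E R)
    (X : nat -> {RV P >-> E}) : Prop :=
  (forall i A, measurable A -> distribution P (X i) A = H A) /\
  (forall (J : {fset nat}) (A : nat -> set E), (forall i, measurable (A i)) ->
    P (\bigcap_(i in [set` J]) (X i @^-1` A i)) =
    (\prod_(i <- J) P (X i @^-1` A i))%E).

End probability.

Section filter.
Context (R : realType) (p : nat).
(* The initial estimators T0 j and S0 j are applied to the j-th column of the
   data matrix; F j is the reference distribution of the j-th coordinate. *)
Variables (T0 S0 : 'I_p -> forall n, 'cV[R]_n -> R).
Variables (F : 'I_p -> probability R R) (alpha : R).

Definition cdf_abs (j : 'I_p) (t : R) : R := fine (F j [set z : R | `|z| <= t]).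

(* Generalized inverse of F_j^+ at alpha. *)
Definition filter_eta (j : 'I_p) : R := inf [set t | alpha <= cdf_abs j t].

Section sample.
Context (n : nat).
Variable D : 'M[R]_(n, p).

Definition filter_Z : 'M[R]_(n, p) :=
  \matrix_(i, j) ((D i j - T0 j (col j D)) / S0 j (col j D)).

Definition ecdf_abs (j : 'I_p) (t : R) : R :=
  #|[pred i : 'I_n | `|filter_Z i j| <= t]|%:R / n%:R.

Definition filter_d (j : 'I_p) : R :=
  sup [set Num.max (cdf_abs j t - ecdf_abs j t) 0 |
       t in [set t | filter_eta j <= t]].

(* The infimum is a minimum whenever [filter_d j < 1]. Otherwise every t
   qualifies, there is no minimum, and [inf] defaults to 0: column j is then
   entirely filtered. *)
Definition filter_t (j : 'I_p) : R :=
  inf [set t | 1 - filter_d j <= ecdf_abs j t].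

Definition filter_U (i : 'I_n) : {set 'I_p} :=
  finset (fun j => `|filter_Z i j| < filter_t j).

Definition prop_complete : R :=
  #|[pred i : 'I_n | #|filter_U i| == p]|%:R / n%:R.

End sample.
End filter.

Section estimators.
Context (R : realType) (p : nat).
Variables (rho : R -> R) (c : nat -> R).

Definition tuning_b : R := 2^-1.

(* c_k is the positive solution of E[rho(|Y|^2 / c_k)] = b, Y ~ N_k(0, I). *)
Definition tuning_constant (k : nat) : Prop :=
  0 < c k /\
  (\int[lebesgue_rV R k]_y
     (rho ((y *m y^T) 0 0 / c k) * mvnormal_pdf 0 1%:M y)%:E = tuning_b%:E)%E.

(* Scales are positive; the infimum of the set of solutions is the solution
   whenever it is unique. If rho is flat at level b there may be several
   solutions, and the smallest one is taken; it is 0 if there is none. *)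
Definition pop_scale (H : set 'rV[R]_p -> \bar R)
    (mu : 'rV[R]_p) (Sigma : 'M[R]_p) : R :=
  inf [set s | 0 < s /\
    (\int[H]_x (rho (mahalanobis x mu Sigma / (c p * s)))%:E = tuning_b%:E)%E].

Definition GS_scale n (X : 'M[R]_(n, p)) (U : 'I_n -> {set 'I_p})
    (mu : 'rV[R]_p) (Sigma Omega : 'M[R]_p) : R :=
  inf [set s | 0 < s /\
    \sum_(i < n | (0 < #|U i|)%N) c #|U i| *
      rho (mahalanobis_star (subvec (U i) (row i X)) (subvec (U i) mu)
                            (submat (U i) Sigma)
           / (s * c #|U i| * \det (submat (U i) Omega) `^ #|U i|%:R^-1)) =
    tuning_b * \sum_(i < n | (0 < #|U i|)%N) c #|U i|].

Definition GS_estimators n (X : 'M[R]_(n, p)) (U : 'I_n -> {set 'I_p})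
    (Omega : 'M[R]_p) : set ('rV[R]_p * 'M[R]_p) :=
  argmin [set th | posdef th.2 /\ GS_scale X U th.1 th.2 th.2 = 1]
         (fun th => GS_scale X U th.1 th.2 Omega).

End estimators.

Definition data_matrix (R : realType) (p : nat) (X : nat -> 'rV[R]_p) (n : nat) :
    'M[R]_(n, p) :=
  \matrix_(i < n, j < p) X i 0 j.

(* Main.v *)
Require Import Defs.
From HB Require Import structures.
From mathcomp Require Import all_boot all_order perm monoid fingroup.
From mathcomp Require Import all_algebra finmap.
From mathcomp Require Import all_classical all_reals all_analysis.
From mathcomp Require Import measurable_realfun zify ring lra.

(** Consistency of the generalized S-estimator.

    Write the Mahalanobis distance of [x] as a quadratic polynomial
    [q_Q x = (1, x) Q (1, x)^T], where [Q] is a positive semidefinite matrix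
    depending on the centre and the shape ([homform]). The quantities to compare
    are the expected loss [E rho (q_Q / (c_p s))] ([eloss], [scale_loss]) and
    the average loss of a sample.

    In the variable [s |Omega|^(1/p)], the equation of the generalized scale is,
    whatever [Omega] is, the equation of the complete-data scale up to an error
    proportional to the fraction of incomplete cases, which tends to 0
    ([weighted_loss_complete], [wloss_average]). Since the population minimiser,
    suitably rescaled, satisfies the constraint ([GS_scale_normalise]), the
    estimator is nearly optimal: at every scale above [sigma0] the average loss
    at the estimated centre and shape is eventually at most [1/2 + o(1)]. The
    constraint says that its average loss at the scale [|Sigma|^(1/p)] is
    [1/2 + o(1)].

    Almost surely, the average losses converge to the expected ones along every
    convergent sequence of forms ([average_qloss_cvg]). This follows from a
    strong law for countably many bounded functions ([slln_bounded],
    [ae_typical]) and from equicontinuity of the losses on cubes. Fix such a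
    sample and an ultrafilter on the indices ([consistency_core]). If the traces
    of the forms were unbounded, the normalised forms would converge to a nonzero
    positive semidefinite [Q] for which all the expectations of [rho (N q_Q)] are
    at most [1/2]; but they tend to 1, since the zero set of [q_Q] lies in a
    hyperplane and [H_0] has a density ([forms_bounded], [eloss_scale_cvg1]). So
    the forms converge, the shape being nondegenerate because its determinant is
    1, and near-optimality passes to the limit: the limit is a minimiser of the
    population scale, hence the unique one. The estimated size
    [|Sigma|^(1/p)] then converges to [sigma0], because the expected loss at the
    minimiser is strictly decreasing in the scale ([eloss_scale_strict]): [H_0]
    charges every neighbourhood of points close to its centre, and [rho] is
    positive off 0 and continuous at 0.

    In the normal case, whitening ([mvnormal_whitening]) turns [H_0] into the
    standard normal distribution, which is invariant under signed permutations
    of the coordinates. By uniqueness the whitened minimiser is invariant too,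
    hence scalar ([signed_perm_invariant_scalar]), and the tuning constant says
    that its scale is 1 ([normal_scale_shape]). *)

Set Implicit Arguments.
Unset Strict Implicit.
Unset Printing Implicit Defensive.

Import Order.TTheory GRing.Theory Num.Theory.
Import numFieldNormedType.Exports.

Local Open Scope classical_set_scope.
Local Open Scope ring_scope.

(** * A strong law of large numbers *)

Lemma probability_lty (R : realType) d (T : measurableType d)
  (P : probability T R) : ((P : {measure set T -> \bar R}) setT < +oo)%E.
Proof. by rewrite (_ : _ setT = 1%E) ?ltry//; exact: probability_setT. Qed.

Section averages.
Context (R : realType).

Lemma bounded_integrable d1 (T1 : measurableType d1)
    (m : {measure set T1 -> \bar R}) (f : T1 -> R) (M : R) :
  (m setT < +oo)%E ->
  measurable_fun setT f -> (forall x, `|f x| <= M) ->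
  m.-integrable setT (EFin \o f).
Proof.
move=> mT mf fM; apply: measurable_bounded_integrable => //.
exists M; split; first by rewrite num_real.
by move=> y My x _ /=; apply: (le_trans (fM x)); exact: ltW.
Qed.

Lemma sum_inv_sqr_le2 n : \sum_(k < n) (k.+1%:R ^+ 2)^-1 <= 2 :> R.
Proof.
suff: \sum_(k < n.+1) (k.+1%:R ^+ 2)^-1 <= 2 - n.+1%:R^-1 :> R.
  rewrite big_ord_recr/= => h; apply: (@le_trans _ _ (2 - n.+1%:R^-1)).
    by apply: le_trans h; rewrite lerDl invr_ge0 sqr_ge0.
  by rewrite gerBl invr_ge0.
elim: n => [|n IH].
  by rewrite big_ord_recr big_ord0/= add0r expr1n invr1; lra.
rewrite big_ord_recr/=; apply: le_trans (lerD IH (lexx _)) _.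
have p1 : 0 < n.+1%:R :> R by [].
have p2 : 0 < n.+2%:R :> R by [].
have e : n.+2%:R = n.+1%:R + 1 :> R by rewrite -natr1.
rewrite -subr_ge0.
have -> : 2 - n.+2%:R^-1 - (2 - n.+1%:R^-1 + (n.+2%:R ^+ 2)^-1) =
   (n.+1%:R * n.+2%:R ^+ 2)^-1 :> R.
  rewrite e; field; rewrite lt0r_neq0//= -natr1 natr1 pnatr_eq0//=.
by rewrite invr_ge0 mulr_ge0// sqr_ge0.
Qed.

(** Between consecutive squares [k ^ 2 <= n < (k + 1) ^ 2] a sum of terms
    bounded by [M] moves by at most [2 k M]. *)
Lemma cvg_average_of_squares (a : nat -> R) (M : R) : (forall i, `|a i| <= M) ->
  (\sum_(i < k.+1 ^ 2) a i) / (k.+1 ^ 2)%:R @[k --> \oo] --> (0 : R) ->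
  (\sum_(i < n) a i) / n%:R @[n --> \oo] --> (0 : R).
Proof.
move=> aM /cvgrPdist_lt h.
have M0 : 0 <= M by apply: le_trans (aM 0%N).
apply/cvgrPdist_lt => e e0.
have [K _ hK] := h _ (divr_gt0 e0 (ltr0n R 2)).
have /cvgrPdist_lt/(_ _ (divr_gt0 e0 (_ : 0 < 4 * M + 1))) := @cvg_harmonic R.
case; first by rewrite ltr_wpDl// mulr_ge0.
move=> L _ hL.
near=> n.
have n0 : (0 < n)%N by near: n; exists 1%N.
(* k + 1 is the integer square root of n *)
have [k kn nk] : exists2 k, (k.+1 ^ 2 <= n)%N & (n < k.+2 ^ 2)%N.
  have ex : exists k, (k.+1 ^ 2 <= n)%N by exists 0%N.
  have bnd k : (k.+1 ^ 2 <= n)%N -> (k <= n)%N.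
    move=> /(leq_trans _); apply; rewrite (leq_trans (leqnSn k))//.
    by rewrite -{1}(expn1 k.+1) leq_pexp2l.
  exists (ex_maxn ex bnd); first by case: ex_maxnP.
  case: ex_maxnP => j _ hj; rewrite ltnNge; apply/negP => /hj.
  by rewrite ltnn.
have kge N : (N.+2 ^ 2 <= n)%N -> (N <= k)%N.
  move=> Nn; rewrite leqNgt; apply/negP => kN.
  have := leq_trans nk (leq_trans _ Nn); rewrite ltnn => F.
  suff : false by []. apply: F.
  by rewrite leq_exp2r// ltnS ltnW.
have kK : (K <= k)%N by apply: kge; near: n; exists (K.+2 ^ 2)%N.
have kL : (L <= k)%N by apply: kge; near: n; exists (L.+2 ^ 2)%N.
have k20 : 0 < (k.+1 ^ 2)%:R :> R by rewrite ltr0n expn_gt0.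
have nR0 : 0 < n%:R :> R by rewrite ltr0n.
have := hK _ kK; have := hL _ kL; rewrite /= !sub0r !normrN => hk1 hk2.
have -> : \sum_(i < n) a i = \sum_(i < k.+1 ^ 2) a i + \sum_(k.+1 ^ 2 <= i < n) a i.
  by rewrite -!(big_mkord xpredT a) -big_cat_nat.
rewrite mulrDl (le_lt_trans (ler_normD _ _))// (splitr e).
apply: ltr_leD.
  apply: le_lt_trans hk2; rewrite !normrM ler_wpM2l//.
  by rewrite !ger0_norm ?invr_ge0 ?ler0n// lef_pV2 ?posrE// ler_nat.
rewrite normrM [X in _ * X]ger0_norm ?invr_ge0 ?ler0n//.
have b1 : `|\sum_(k.+1 ^ 2 <= i < n) a i| <= (2 * k.+1%:R) * M.
  apply: le_trans (ler_norm_sum _ _ _) _.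
  apply: (@le_trans _ _ (\sum_(k.+1 ^ 2 <= i < n) M)); first exact: ler_sum.
  rewrite sumr_const_nat -[_ *+ _]mulr_natl ler_wpM2r//.
  rewrite -natrM ler_nat leq_subLR.
  by move: nk; rewrite -[k.+2]addn1 sqrnD; lia.
apply: (@le_trans _ _ ((2 * k.+1%:R * M) / (k.+1 ^ 2)%:R)).
  apply: ler_pM => //; last by rewrite lef_pV2 ?posrE// ler_nat.
move: hk1; rewrite /harmonic /= ger0_norm ?invr_ge0 ?ler0n//.
rewrite natrX ltr_pdivlMr ?ltr_wpDl ?mulr_ge0// => hk1.
have p1 : 0 < k.+1%:R :> R by [].
have -> : 2 * k.+1%:R * M / k.+1%:R ^+ 2 = 2 * M * k.+1%:R^-1 :> R.
  by move: p1; set x : R := k.+1%:R => p1; field; rewrite gt_eqF.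
have : 0 < k.+1%:R^-1 :> R by rewrite invr_gt0.
move: hk1; set x : R := k.+1%:R^-1; nra.
Unshelve. all: by end_near. Qed.

End averages.

Section slln.
Context (R : realType) d (T : measurableType d) (P : probability T R)
  d' (E : measurableType d') (H : probability E R) (X : nat -> {RV P >-> E}).
Hypothesis X_iid : iid H X.

Lemma iid_pair (i j : nat) (A B : set E) : i != j ->
  measurable A -> measurable B ->
  P (X i @^-1` A `&` X j @^-1` B) = (H A * H B)%E.
Proof.
move=> ij mA mB.
have [XH XI] := X_iid.
pose S k := if k == i then A else if k == j then B else setT.
have mS k : measurable (S k) by rewrite /S; case: ifP => // _; case: ifP.
have HX k B' (mB' : measurable B') : P (X k @^-1` B') = H B' by exact: XH.
have := XI [fset i; j]%fset S mS.
rewrite big_fsetU1/= ?inE// big_seq_fset1 /S eqxx eq_sym (negbTE ij) eqxx.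
rewrite !HX// => <-.
congr (P _); apply/seteqP; split => w /=.
  move=> [Aw Bw] k; rewrite /= !inE => /orP[] /eqP ->; rewrite ?eqxx//.
  by rewrite eq_sym (negbTE ij).
move=> K; split; first by have := K i; rewrite /= !inE eqxx /=; apply.
by have := K j; rewrite /= !inE eqxx orbT /= eq_sym (negbTE ij); apply.
Qed.

Lemma iid_pair_integral (i j : nat) (g : E -> R) (M : R) : i != j ->
  measurable_fun setT g -> (forall x, `|g x| <= M) ->
  (\int[H]_x (g x)%:E = 0)%E ->
  (\int[P]_w (g (X i w) * g (X j w))%:E = 0)%E.
Proof.
move=> ij mg gM g0.
pose phi w := (X i w, X j w).
have mphi : measurable_fun setT phi by exact: measurable_fun_pair.
pose G (z : E * E) := g z.1 * g z.2.
have mG : measurable_fun setT G.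
  apply: measurable_realfun.measurable_funM.
  - exact: (measurableT_comp mg measurable_fst).
  - exact: (measurableT_comp mg measurable_snd).
have GM z : `|G z| <= M * M by rewrite normrM ler_pM.
transitivity (\int[pushforward P phi]_z (G z)%:E)%E.
  rewrite integral_pushforward//=; first exact/measurable_EFinP.
  apply: (@bounded_integrable _ _ _ P (G \o phi) (M * M)).
    exact: probability_lty.
    exact: measurableT_comp.
  by move=> w; exact: GM.
transitivity (\int[H \x H]_z (G z)%:E)%E.
  apply: eq_measure_integral => A mA _; symmetry.
  apply: product_measure_unique => // B C mB mC /=.
  by rewrite -(iid_pair ij mB mC) /pushforward.
rewrite -integral12_prod_meas1; last first.
  apply: (@bounded_integrable _ _ _ (H \x H)%E G (M * M)) => //.
  have HH : ((H \x H) (setT `*` setT) = 1 * 1)%E.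
    by rewrite product_measure1E//; congr (_ * _)%E; exact: probability_setT.
  rewrite setXTT mule1 in HH.
  by apply: (@le_lt_trans _ _ 1%E); [rewrite -HH; exact: lexx|exact: ltry].
have iH := bounded_integrable (probability_lty H) mg gM.
rewrite /fubini_F /G /=.
under eq_integral => x _.
  under eq_integral do rewrite EFinM.
  rewrite integralZl//.
  rewrite g0 mule0; over.
by rewrite integral0.
Qed.

Section centered.
Variables (g : E -> R) (M : R).
Hypotheses (mg : measurable_fun setT g) (gM : forall x, `|g x| <= M)
  (g0 : (\int[H]_x (g x)%:E = 0)%E).

Let S n w : R := \sum_(i < n) g (X i w).

Let mgX i : measurable_fun setT (fun w => g (X i w)).
Proof. exact: measurableT_comp. Qed.

Let mS n : measurable_fun setT (S n).
Proof. by apply: measurable_sum => i; exact: mgX. Qed.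

(** Distinct terms are uncorrelated, so only the diagonal of the double sum
    contributes. *)
Lemma iid_second_moment n :
  (\int[P]_w ((\sum_(i < n) g (X i w)) ^+ 2)%:E <= (n%:R * M ^+ 2)%:E)%E.
Proof.
have M0 : 0 <= M by apply: le_trans (gM point).
have gg i j w : `|g (X i w) * g (X j w)| <= M * M by rewrite normrM ler_pM.
have mgg i j : measurable_fun setT (fun w => g (X i w) * g (X j w)).
  exact: measurable_realfun.measurable_funM.
have PT := probability_lty P.
have igg i j := bounded_integrable PT (mgg i j) (gg i j).
have -> : (\int[P]_w ((\sum_(i < n) g (X i w)) ^+ 2)%:E =
    \sum_(i < n) \sum_(j < n) \int[P]_w (g (X i w) * g (X j w))%:E)%E.
  transitivity (\int[P]_w
      \sum_(i < n) \sum_(j < n) (g (X i w) * g (X j w))%:E)%E.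
    apply: eq_integral => w _; rewrite expr2 big_distrl/= -sumEFin.
    by apply: eq_bigr => i _; rewrite big_distrr/= -sumEFin.
  rewrite (integral_sum measurableT
      (f := fun (i : 'I_n) w => (\sum_(j < n) (g (X i w) * g (X j w))%:E)%E)); last first.
    by move=> i; apply: integrable_sum => // j _; exact: igg.
  apply: eq_bigr => i _.
  rewrite (integral_sum measurableT
      (f := fun (j : 'I_n) w => (g (X i w) * g (X j w))%:E))//.
  by move=> j; exact: igg.
under eq_bigr => i _.
  rewrite (bigD1 i)//= big1 ?adde0; last first.
    by move=> j ji; apply: (iid_pair_integral _ mg gM g0); rewrite eq_sym.
  over.
apply: (@le_trans _ _ (\sum_(i < n) (M ^+ 2)%:E)%E).
  apply: lee_sum => i _.
  apply: (@le_trans _ _ (\int[P]_w (M ^+ 2)%:E)%E).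
    apply: ge0_le_integral => //.
    - by move=> w _; rewrite lee_fin -expr2 sqr_ge0.
    - exact/measurable_EFinP/mgg.
    - by move=> w _; rewrite lee_fin expr2 (le_trans (ler_norm _)).
  by rewrite integral_cst//= probability_setT mule1.
by rewrite sumEFin sumr_const card_ord mulr_natl lexx.
Qed.

(** Along the squares the second moments of the averages are summable, so that
    the squared averages are almost surely summable, hence tend to 0. *)
Lemma slln_squares :
  {ae P, forall w, S (k.+1 ^ 2)%N w / (k.+1 ^ 2)%:R @[k --> \oo] --> (0 : R)}.
Proof.
pose f k w := ((S (k.+1 ^ 2)%N w / (k.+1 ^ 2)%:R) ^+ 2)%:E.
have f0 k w : (0 <= f k w)%E by rewrite lee_fin sqr_ge0.
have mf k : measurable_fun setT (f k).
  apply/measurable_EFinP; apply: measurable_funX.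
  by apply: measurable_realfun.measurable_funM => //; exact: mS.
have fle k : (\int[P]_w f k w <= (M ^+ 2 * (k.+1%:R ^+ 2)^-1)%:E)%E.
  have k0 : 0 < (k.+1 ^ 2)%:R :> R by rewrite ltr0n expn_gt0.
  rewrite /f.
  under eq_integral => w _ do rewrite exprMn EFinM.
  rewrite ge0_integralZr//=.
  - apply: (@le_trans _ _ (((k.+1 ^ 2)%:R * M ^+ 2)%:E * (((k.+1 ^ 2)%:R^-1) ^+ 2)%:E)%E).
      by apply: lee_wpmul2r; rewrite ?lee_fin ?sqr_ge0//; exact: iid_second_moment.
    rewrite -EFinM lee_fin natrX.
    have : k.+1%:R != 0 :> R by rewrite pnatr_eq0.
    set a : R := k.+1%:R => a0.
    by rewrite le_eqVlt; apply/orP; left; apply/eqP; field.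
  - by apply/measurable_EFinP/measurable_funX/mS.
  - by move=> w _; rewrite ?lee_fin sqr_ge0.
have fin : (\int[P]_w (\sum_(k <oo) f k w) < +oo)%E.
  rewrite integral_nneseries//.
  apply: (@le_lt_trans _ _ (M ^+ 2 * 2)%:E); last exact: ltry.
  apply: lime_le; first by apply: is_cvg_nneseries => k _ _; exact: integral_ge0.
  near=> n; rewrite big_mkord.
  apply: (@le_trans _ _ (\sum_(k < n) (M ^+ 2 * (k.+1%:R ^+ 2)^-1)%:E)%E).
    by apply: lee_sum => k _; exact: fle.
  by rewrite sumEFin lee_fin -mulr_sumr ler_wpM2l ?sqr_ge0// sum_inv_sqr_le2.
have : P.-integrable setT (fun w => \sum_(k <oo) f k w)%E.
  apply/integrableP; split; first exact: ge0_emeasurable_sum.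
  under eq_integral do rewrite gee0_abs ?nneseries_ge0//.
  exact: fin.
move=> /(integrable_ae measurableT); apply: filterS => w /(_ I) fw.
have : series (fun k => (S (k.+1 ^ 2)%N w / (k.+1 ^ 2)%:R) ^+ 2) @ \oo --> fine (\sum_(k <oo) f k w).
  apply: (@fine_cvg _ _ _ _ (fun n => (series
    (fun k => (S (k.+1 ^ 2)%N w / (k.+1 ^ 2)%:R) ^+ 2) n)%:E)).
  rewrite fineK//.
  have := @is_cvg_nneseries R (fun k => f k w) xpredT 0 (fun k _ _ => f0 k w).
  apply: cvg_trans; apply: near_eq_cvg; near=> n.
  by rewrite /series/= sumEFin.
move=> /cvgP/cvg_series_cvg_0 h.
apply/norm_cvg0P.
rewrite (_ : (fun k => _) = Num.sqrt \o
    (fun k => (S (k.+1 ^ 2)%N w / (k.+1 ^ 2)%:R) ^+ 2)); last first.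
  by apply/funext => k; rewrite /= sqrtr_sqr.
by rewrite -[X in _ --> X]sqrtr0; exact: cvg_comp h (@sqrt_continuous R 0).
Unshelve. all: by end_near. Qed.

End centered.
Lemma slln_bounded (f : E -> R) (M : R) : measurable_fun setT f ->
  (forall x, `|f x| <= M) ->
  {ae P, forall w, (\sum_(i < n) f (X i w)) / n%:R @[n --> \oo] -->
    (\int[H]_x f x)}.
Proof.
move=> mf fM.
pose m := \int[H]_x f x; rewrite -/m.
have fi := bounded_integrable (probability_lty H) mf fM.
pose g x := f x - m.
have mg : measurable_fun setT g by exact: measurable_funB.
have gM x : `|g x| <= M + `|m|.
  by rewrite (le_trans (ler_normB _ _))// lerD2r.
have g0 : (\int[H]_x (g x)%:E = 0)%E.
  rewrite /g; under eq_integral do rewrite EFinB.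
  rewrite integralB_EFin//; last exact: finite_measure_integrable_cst.
  rewrite integral_cst// (_ : _ setT = 1%E); last exact: probability_setT.
  by rewrite mule1 /m /Rintegral fineK ?subee//; exact: integrable_fin_num.
have := slln_squares mg gM g0; apply: filterS => w hw.
have hg := cvg_average_of_squares (fun i => gM (X i w)) hw.
have : (\sum_(i < n) g (X i w)) / n%:R + m @[n --> \oo] --> 0 + m.
  by apply: cvgD => //; exact: cvg_cst.
rewrite add0r; apply: cvg_trans; apply: near_eq_cvg; near=> n.
have n0 : n%:R != 0 :> R by rewrite pnatr_eq0 -lt0n; near: n; exists 1%N.
rewrite /g sumrB sumr_const card_ord -[m *+ n]mulr_natl.
by rewrite mulrBl mulrAC divff// mul1r subrK.
Unshelve. all: by end_near. Qed.

End slln.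

(** * Quadratic forms and positive definite matrices *)

Section quadratic_forms.
Context (R : realType).

Definition qform k (Q : 'M[R]_k) (y : 'rV[R]_k) : R := (y *m Q *m y^T) 0 0.

Definition psd k (Q : 'M[R]_k) := Q^T = Q /\ forall y, 0 <= qform Q y.

Lemma qformE k (Q : 'M[R]_k) y :
  qform Q y = \sum_i \sum_j y 0 i * Q i j * y 0 j.
Proof.
rewrite /qform mxE exchange_big/=; apply: eq_bigr => j _.
by rewrite !mxE big_distrl.
Qed.

Lemma qformZ k (Q : 'M[R]_k) (a : R) y : qform (a *: Q) y = a * qform Q y.
Proof. by rewrite /qform -scalemxAr -scalemxAl mxE. Qed.

Lemma qformD k (Q : 'M[R]_k) (y z : 'rV[R]_k) (t : R) : Q^T = Q ->
  qform Q (y + t *: z) =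
  qform Q y + 2 * t * (y *m Q *m z^T) 0 0 + t ^+ 2 * qform Q z.
Proof.
move=> QT; rewrite /qform linearD/= linearZ/= !mulmxDl !mulmxDr.
have -> : t *: z *m Q *m y^T = t *: (y *m Q *m z^T).
  have tr1 (B : 'M[R]_1) : B = B^T by apply/matrixP => i j; rewrite mxE !ord1.
  by rewrite -!scalemxAl [z *m _ *m _]tr1 !trmx_mul QT trmxK mulmxA.
rewrite -!scalemxAl -!scalemxAr !mxE; ring.
Qed.

(** A nonnegative quadratic polynomial in [t] without constant term has no
    linear term, so the kernel of the form is the kernel of the matrix. *)
Lemma psd_qform0 k (Q : 'M[R]_k) y : psd Q -> qform Q y = 0 -> y *m Q = 0.
Proof.
move=> [QT Q0] y0; apply/rowP => j; rewrite [RHS]mxE.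
set b := (y *m Q) 0 j.
have bE : (y *m Q *m (delta_mx 0 j : 'rV_k)^T) 0 0 = b.
  by rewrite trmx_delta -colE mxE.
set c := qform Q (delta_mx 0 j).
have h t : 0 <= 2 * t * b + t ^+ 2 * c.
  by have := Q0 (y + t *: delta_mx 0 j); rewrite qformD// y0 add0r bE.
have c0 : 0 <= c by exact: Q0.
apply/eqP/negP => /negP bn0.
have := h (- b / (1 + c)).
have c1 : 0 < 1 + c by lra.
have -> : 2 * (- b / (1 + c)) * b + (- b / (1 + c)) ^+ 2 * c =
   - (b ^+ 2) * ((2 + c) / (1 + c) ^+ 2).
  by field; rewrite gt_eqF.
rewrite mulNr oppr_ge0 leNgt => /negP; apply.
apply: mulr_gt0; first by rewrite exprn_even_gt0.
by apply: divr_gt0; [lra|rewrite exprn_gt0].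
Qed.

Lemma qform_delta k (Q : 'M[R]_k) i : qform Q (delta_mx 0 i) = Q i i.
Proof.
rewrite qformE (bigD1 i)//= (bigD1 i)//= !mxE !eqxx mul1r mulr1.
rewrite big1 ?addr0; last by move=> j /negbTE ji; rewrite !mxE ji /= !mulr0.
rewrite big1 ?addr0// => j /negbTE ji; apply: big1 => l _.
by rewrite !mxE ji /= !mul0r.
Qed.

Lemma qform_delta2 k (Q : 'M[R]_k) i j :
  ((delta_mx 0 i : 'rV[R]_k) *m Q *m (delta_mx 0 j : 'rV[R]_k)^T) 0 0 = Q i j.
Proof.
rewrite -rowE trmx_delta -colE !mxE//.
Qed.

Lemma psd_entry_le_trace k (Q : 'M[R]_k) i j : psd Q -> `|Q i j| <= \tr Q.
Proof.
move=> [QT Q0].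
have d0 l : 0 <= Q l l by rewrite -qform_delta.
have trE l : Q l l <= \tr Q.
  by rewrite /mxtrace (bigD1 l)//= lerDl sumr_ge0.
have h t := Q0 (delta_mx 0 i + t *: delta_mx 0 j).
have hp := h 1; have hm := h (- 1); move: hp hm.
rewrite !qformD// !qform_delta !qform_delta2 !mulrN !mulr1 sqrrN !expr1n !mul1r.
have := trE i; have := trE j.
by move=> ? ? ? ?; rewrite ler_norml; apply/andP; split; lra.
Qed.

Lemma posdef_psd k (Q : 'M[R]_k) : posdef Q -> psd Q.
Proof.
move=> [QT Q0]; split => // y; have [->|/Q0/ltW//] := eqVneq y 0.
by rewrite /qform !mul0mx mxE.
Qed.

Lemma posdef_unit k (Q : 'M[R]_k) : posdef Q -> Q \in unitmx.
Proof.
move=> [QT Q0]; rewrite -row_free_unit; apply/inj_row_free => y yQ.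
apply/eqP/negPn/negP => /Q0; rewrite yQ mul0mx mxE ltxx//.
Qed.

Lemma psd_unit_posdef k (Q : 'M[R]_k) : psd Q -> Q \in unitmx -> posdef Q.
Proof.
move=> pQ uQ; split; first by case: pQ.
move=> y y0; rewrite lt_neqAle pQ.2 andbT eq_sym; apply/eqP => /(psd_qform0 pQ).
by move=> /(congr1 (mulmx^~ (invmx Q))); rewrite mulmxK// mul0mx => /eqP; apply/negP.
Qed.

Lemma posdef_inv k (Q : 'M[R]_k) : posdef Q -> posdef (invmx Q).
Proof.
move=> pQ; have uQ := posdef_unit pQ; have [QT Q0] := pQ.
have iT : (invmx Q)^T = invmx Q by rewrite trmx_inv QT.
split => // y y0.
have -> : y *m invmx Q *m y^T = (y *m invmx Q) *m Q *m (y *m invmx Q)^T.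
  by rewrite trmx_mul iT !mulmxA mulmxKV.
apply: Q0; apply: contra_neq y0 => /(congr1 (mulmx^~ Q)).
by rewrite mulmxKV// mul0mx.
Qed.

Lemma posdefZ k (Q : 'M[R]_k) (a : R) : 0 < a -> posdef Q -> posdef (a *: Q).
Proof.
move=> a0 [QT Q0]; split; first by rewrite linearZ/= QT.
move=> y y0; have := Q0 _ y0.
by rewrite -/(qform _ _) -/(qform _ _) qformZ => ?; rewrite mulr_gt0.
Qed.

Lemma posdef_mxsub k l (f : 'I_l -> 'I_k) (Q : 'M[R]_k) : injective f ->
  posdef Q -> posdef (mxsub f f Q).
Proof.
move=> fI [QT Q0]; split.
  by apply/matrixP => i j; rewrite !mxE -{1}QT mxE.
move=> y y0.
pose z : 'rV[R]_k := \row_j \sum_(i | f i == j) y 0 i.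
have zf i : z 0 (f i) = y 0 i.
  by rewrite mxE (eq_bigl (pred1 i)) ?big_pred1_eq// => j /=; rewrite (inj_eq fI).
have z0 : z != 0.
  apply: contra_neq y0 => z0; apply/rowP => i; rewrite mxE -zf z0 mxE//.
have zn j : j \notin codom f -> z 0 j = 0.
  move=> jf; rewrite mxE big1// => i /eqP fij; case/negP: jf.
  by rewrite -fij codom_f.
have sumf (F : 'I_k -> R) : (forall j, j \notin codom f -> F j = 0) ->
    \sum_j F j = \sum_i F (f i).
  move=> F0; rewrite [RHS](partition_big f xpredT)//=; apply: eq_bigr => j _.
  have [/codomP[i ->]|jf] := boolP (j \in codom f).
    by rewrite (eq_bigl (pred1 i)) ?big_pred1_eq// => r /=; rewrite (inj_eq fI).
  rewrite F0// big1// => i /eqP fij; case/negP: jf.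
  by rewrite -fij codom_f.
have := Q0 _ z0; rewrite -/(qform _ _) qformE sumf; last first.
  by move=> j /zn zj; rewrite big1// => i _; rewrite zj !mul0r.
suff -> : \sum_i \sum_j z 0 (f i) * Q (f i) j * z 0 j = qform (mxsub f f Q) y by [].
  rewrite qformE; apply: eq_bigr => i _; rewrite sumf.
    by apply: eq_bigr => j _; rewrite !zf mxE.
  by move=> j /zn ->; rewrite mulr0.
Qed.

(** One step of the Cholesky factorisation: the Schur complement of the upper
    left entry of a positive definite matrix is positive definite. *)
Lemma posdef_schur n (C : 'M[R]_(1 + n)) : posdef C ->
  exists (s : R) (u : 'rV[R]_n) (S : 'M[R]_n), [/\ 0 < s, posdef S &
    C = block_mx (s ^+ 2)%:M (s *: u) (s *: u^T) (u^T *m u + S)].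
Proof.
move=> [CT C0].
set a : R := C 0 0.
have a0 : 0 < a.
  have := C0 (delta_mx 0 0); rewrite -/(qform _ _) qform_delta; apply.
  by apply/eqP => /rowP/(_ 0); rewrite !mxE/= => /eqP; rewrite oner_eq0.
set s := Num.sqrt a.
have s0 : 0 < s by rewrite sqrtr_gt0.
have s2 : s ^+ 2 = a by rewrite sqr_sqrtr// ltW.
pose b := ursubmx C.
pose u := s^-1 *: b.
have su : s *: u = b by rewrite scalerA divff ?gt_eqF// scale1r.
pose S := drsubmx C - u^T *m u.
have CE : C = block_mx (s ^+ 2)%:M (s *: u) (s *: u^T) (u^T *m u + S).
  rewrite -[LHS]submxK; congr block_mx => //.
  - apply/matrixP => i j; rewrite !ord1 s2 !mxE eqxx mulr1n.
    by congr (C _ _); apply/val_inj.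
  - by rewrite -linearZ/= su trmx_ursub CT.
  - by rewrite /S addrC subrK.
exists s, u, S; split => //.
have ST : S^T = S.
  by rewrite /S linearB/= trmx_mul trmxK trmx_drsub CT.
split => // y y0.
(* the first coordinate is chosen to minimise the form of C over it *)
pose x : 'rV[R]_(1 + n) := row_mx (- s^-1 *: (y *m u^T)) y.
have x0 : x != 0.
  apply: contra_neq y0 => x0; have := congr1 rsubmx x0.
  by rewrite row_mxKr => ->; rewrite linear0.
have := C0 _ x0; rewrite CE /x mul_row_block tr_row_mx mul_row_col.
suff -> : (- s^-1 *: (y *m u^T) *m (s ^+ 2)%:M + y *m (s *: u^T)) = 0.
  rewrite mul0mx add0r.
  suff -> : - s^-1 *: (y *m u^T) *m (s *: u) + y *m (u^T *m u + S) = y *m S by [].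
  rewrite mulmxDr addrA -scalemxAl -scalemxAr scalerA mulNr mulVf ?gt_eqF//.
  by rewrite scaleN1r mulmxA addNr add0r.
rewrite mul_mx_scalar scalerA -scalemxAr -scalerDl.
suff -> : s ^+ 2 * - s^-1 + s = 0 by rewrite scale0r.
by rewrite mulrN expr2 mulfK ?gt_eqF// addNr.
Qed.

Definition homog n (x : 'rV[R]_n) : 'rV[R]_(1 + n) := row_mx 1%:M x.

(** The matrix of [x |-> (x - m) V (x - m)^T] in the homogeneous coordinates
    [(1, x)]. The parameter enters linearly in these coordinates, which puts
    diverging centres and degenerating shapes on the same footing. *)
Definition homform n (m : 'rV[R]_n) (V : 'M[R]_n) : 'M[R]_(1 + n) :=
  col_mx (- m) 1%:M *m V *m (col_mx (- m) 1%:M)^T.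

Lemma homformE n (m x : 'rV[R]_n) (V : 'M[R]_n) :
  qform (homform m V) (homog x) = qform V (x - m).
Proof.
rewrite /qform /homform !mulmxA.
have -> : homog x *m col_mx (- m) 1%:M = x - m.
  by rewrite /homog mul_row_col mul1mx mulmx1 addrC.
rewrite -[_ *m _^T *m _^T]mulmxA -trmx_mul.
by have -> : homog x *m col_mx (- m) 1%:M = x - m
  by rewrite /homog mul_row_col mul1mx mulmx1 addrC.
Qed.

Lemma homform_psd n (m : 'rV[R]_n) (V : 'M[R]_n) : psd V -> psd (homform m V).
Proof.
move=> [VT V0]; split; first by rewrite /homform !trmx_mul VT trmxK mulmxA.
move=> y; rewrite /qform /homform.
set A := col_mx _ _.
have -> : y *m (A *m V *m A^T) *m y^T = (y *m A) *m V *m (y *m A)^T.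
  by rewrite trmx_mul !mulmxA.
exact: V0.
Qed.

Lemma drsub_homform n (m : 'rV[R]_n) (V : 'M[R]_n) :
  drsubmx (homform m V) = V.
Proof.
by rewrite /homform mul_col_mx tr_col_mx mul_col_row block_mxKdr trmx1 mulmx1 mul1mx.
Qed.

Lemma ursub_homform n (m : 'rV[R]_n) (V : 'M[R]_n) :
  ursubmx (homform m V) = - (m *m V).
Proof.
by rewrite /homform mul_col_mx tr_col_mx mul_col_row block_mxKur trmx1 mulmx1 mulNmx.
Qed.

Lemma mahalanobisE n (x m : 'rV[R]_n) (C : 'M[R]_n) :
  mahalanobis x m C = qform (homform m (invmx C)) (homog x).
Proof. by rewrite homformE. Qed.

End quadratic_forms.

(** * Lebesgue measure on row vectors *)

Section measurability.
Context (R : realType) d (T : measurableType d).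

Lemma measurable_mulmx n k (f : T -> 'rV[R]_n) (A : 'M[R]_(n, k)) :
  measurable_fun setT f -> measurable_fun setT (fun t => f t *m A).
Proof.
move=> mf; apply: measurable_fun_rV => j.
rewrite (_ : (fun t => _) = (fun t => \sum_i f t 0 i * A i j)).
  apply: measurable_sum => i; apply: measurable_realfun.measurable_funM => //.
  exact: (measurableT_comp (@measurable_coor R n i)).
by apply/funext => t; rewrite mxE.
Qed.

Lemma measurable_addmx n (f g : T -> 'rV[R]_n) :
  measurable_fun setT f -> measurable_fun setT g ->
  measurable_fun setT (fun t => f t + g t).
Proof.
move=> mf mg; apply: measurable_fun_rV => j.
rewrite (_ : (fun t => _) = (fun t => f t 0 j + g t 0 j)).
  by apply: measurable_funD; exact: (measurableT_comp (@measurable_coor R n j)).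
by apply/funext => t; rewrite mxE.
Qed.

Lemma measurable_qform n (f : T -> 'rV[R]_n) (A : 'M[R]_n) :
  measurable_fun setT f -> measurable_fun setT (fun t => qform A (f t)).
Proof.
move=> mf; rewrite (_ : (fun t => _) =
   (fun t => \sum_i \sum_j f t 0 i * A i j * f t 0 j)); last first.
  by apply/funext => t; rewrite qformE.
have mc i := measurableT_comp (@measurable_coor R n i) mf.
apply: measurable_sum => i; apply: measurable_sum => j.
apply: measurable_realfun.measurable_funM; last exact: mc.
apply: measurable_realfun.measurable_funM => //; exact: mc.
Qed.

Lemma measurable_homog n (f : T -> 'rV[R]_n) :
  measurable_fun setT f -> measurable_fun setT (fun t => homog (f t)).
Proof.
move=> mf; apply: measurable_fun_rV => j; rewrite /homog.
case: (split_ordP j) => i -> /=.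
  rewrite (_ : (fun t => _) = cst (1%:M 0 i)) //.
  by apply/funext => t; rewrite row_mxEl.
rewrite (_ : (fun t => _) = (fun t => f t 0 i)).
  exact: (measurableT_comp (@measurable_coor R n i) mf).
by apply/funext => t; rewrite row_mxEr.
Qed.

End measurability.

Section lebesgue_rV_theory.
Context (R : realType).

Local Notation leb n := (lebesgue_rV R n).
Local Notation mu := (@lebesgue_measure R).

Lemma ge0_integral_cons n (h : 'rV[R]_n.+1 -> \bar R) :
  measurable_fun setT h -> (forall x, 0 <= h x)%E ->
  (\int[leb n.+1]_x h x =
   \int[mu]_z \int[leb n]_v h (row_mx (z%:M : 'rV_1) v))%E.
Proof.
move=> mh h0.
transitivity (\int[pushforward (mu \x leb n) (@cons_rV R n)]_x h x)%E.
  by apply: eq_measure_integral => //; exact: measurable_cons_rV.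
rewrite ge0_integral_pushforward//; last exact: measurable_cons_rV.
rewrite fubini_tonelli1//=.
exact: (measurableT_comp mh (@measurable_cons_rV R n)).
Qed.

Lemma ge0_integral_cons_swap n (h : 'rV[R]_n.+1 -> \bar R) :
  measurable_fun setT h -> (forall x, 0 <= h x)%E ->
  (\int[leb n.+1]_x h x =
   \int[leb n]_v \int[mu]_z h (row_mx (z%:M : 'rV_1) v))%E.
Proof.
move=> mh h0.
transitivity (\int[pushforward (mu \x leb n) (@cons_rV R n)]_x h x)%E.
  by apply: eq_measure_integral => //; exact: measurable_cons_rV.
rewrite ge0_integral_pushforward//; last exact: measurable_cons_rV.
rewrite fubini_tonelli2//=.
exact: (measurableT_comp mh (@measurable_cons_rV R n)).
Qed.

Definition box p (A : 'I_p -> set R) : set 'rV[R]_p :=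
  [set x | forall i, A i (x 0 i)].

Lemma measurable_boxes p (A : 'I_p -> set R) :
  (forall i, measurable (A i)) -> measurable (box A).
Proof.
move=> mA; rewrite (_ : box A = \bigcap_(i in [set: 'I_p])
   [set y : 'rV[R]_p | A i (y 0 i)]); last first.
  by apply/seteqP; split => [y yA i _|y yA i]; [exact: yA|exact: (yA i I)].
apply: fin_bigcap_measurable => // i _.
rewrite -[X in measurable X]setTI.
exact: (@measurable_coor R p i measurableT _ (mA i)).
Qed.

Lemma measurable_zeros n (Q : 'M[R]_(1 + n)) :
  measurable [set x : 'rV[R]_n | qform Q (homog x) = 0].
Proof.
rewrite -[X in measurable X]setTI.
have : measurable_fun setT (fun x : 'rV[R]_n => qform Q (homog x)).
  by apply: measurable_qform; exact: measurable_homog.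
by move=> /(_ measurableT [set 0] (measurable_set1 0)).
Qed.

Lemma measurable_hyperplane n (w : 'rV[R]_n) (a : R) :
  measurable [set x : 'rV[R]_n | (x *m w^T) 0 0 = a].
Proof.
rewrite -[X in measurable X]setTI.
have : measurable_fun setT (fun x : 'rV[R]_n => (x *m w^T) 0 0).
  apply: (measurableT_comp (@measurable_coor R 1 0)).
  exact: (@measurable_mulmx _ _ _ _ _ id).
by move=> /(_ measurableT [set a] (measurable_set1 a)).
Qed.

Lemma lebesgue_hyperplane n (w : 'rV[R]_n) (a : R) : w != 0 ->
  leb n [set x : 'rV[R]_n | (x *m w^T) 0 0 = a] = 0%E.
Proof.
elim: n w a => [w a|n IH w a w0].
  by move=> /eqP []; apply/rowP => -[].
have mA := measurable_hyperplane w a.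
set A := [set _ | _] in mA *.
transitivity (\int[leb n.+1]_x (\1_A x)%:E)%E.
  by rewrite integral_indic// setIT.
pose w1 : 'rV[R]_1 := lsubmx (w : 'rV[R]_(1 + n)).
pose w2 : 'rV[R]_n := rsubmx (w : 'rV[R]_(1 + n)).
have wE : w = row_mx w1 w2 by rewrite hsubmxK.
have AE (z : R) v : (\1_A (row_mx (z%:M : 'rV_1) v : 'rV_n.+1) : R) =
    (z * w1 0 0 + (v *m w2^T) 0 0 == a)%:R.
  rewrite indicE; congr (_%:R : R); congr nat_of_bool.
  apply/idP/idP.
    rewrite inE /A /= wE (@tr_row_mx _ 1 1 n) (@mul_row_col _ 1 1 n 1) mxE => <-.
    by rewrite mul_scalar_mx; apply/eqP; congr (_ + _); rewrite !mxE.
  move=> /eqP e; rewrite inE /A /= -e wE (@tr_row_mx _ 1 1 n).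
  rewrite (@mul_row_col _ 1 1 n 1) mxE.
  by rewrite mul_scalar_mx; congr (_ + _); rewrite !mxE.
have mi : measurable_fun setT (fun x => (\1_A x : R)%:E).
  exact/measurable_EFinP/measurable_indic.
have i0 x : (0 <= (\1_A x)%:E :> \bar R)%E by rewrite lee_fin.
have [w10|w10] := eqVneq (w1 0 0) 0.
- rewrite (ge0_integral_cons mi i0).
  have w20 : w2 != 0.
    apply: contra_neq w0 => w20; rewrite wE w20.
    have -> : w1 = 0 by apply/rowP => i; rewrite ord1 w10 mxE.
    exact: (@row_mx0 _ 1 1 n).
  apply: integral0_eq => z _.
  transitivity (leb n [set v | (v *m w2^T) 0 0 = a]); last exact: IH.
  rewrite -[X in leb n X]setIT -integral_indic//; last exact: measurable_hyperplane.
  apply: eq_integral => v _; rewrite AE w10 mulr0 add0r indicE.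
  by congr (_%:R%:E); congr nat_of_bool; apply/eqP/idP; rewrite inE.
- rewrite (ge0_integral_cons_swap mi i0).
  apply: integral0_eq => v _.
  transitivity (mu [set (a - (v *m w2^T) 0 0) / w1 0 0]); last first.
    exact: lebesgue_measure_set1.
  rewrite -[X in mu X]setIT -integral_indic//.
  apply: eq_integral => z _; rewrite AE indicE.
  congr (_%:R%:E); congr nat_of_bool; apply/eqP/idP; rewrite inE/=.
    by move=> <-; rewrite addrK mulfK.
  by move=> ->; rewrite divfK// subrK.
Qed.

Lemma ge0_integral_affine (m s : R) (h : R -> \bar R) : 0 < s ->
  measurable_fun setT h -> (forall x, 0 <= h x)%E ->
  (\int[mu]_z h z = s%:E * \int[mu]_z h (m + s * z)%R)%E.
Proof.
move=> s0 mh h0.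
pose phi z : measurableTypeR R := m + s * z.
have mphi : measurable_fun setT phi.
  by apply: measurable_funD => //; exact: measurable_realfun.measurable_funM.
pose nu := @measure_function_pushforward__canonical__measure_function_Measure
  _ _ _ _ _ mu phi mphi.
transitivity (\int[mscale (NngNum (ltW s0)) nu]_z h z)%E.
  apply: eq_measure_integral => A mA _.
  apply: lebesgue_measure_unique => // _ [[a b]] _ <- /=.
  rewrite /mscale/= /pushforward.
  rewrite (_ : phi @^-1` _ = `](a - m) / s, (b - m) / s]%classic); last first.
    apply/seteqP; split => z; rewrite /phi /= !in_itv/= ltr_pdivrMr// ler_pdivlMr//;
    rewrite ltrBlDl lerBrDl [z * s]mulrC//.
  rewrite !lebesgue_measure_itv/= !lte_fin ltr_pM2r ?invr_gt0// ltrD2r.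
  case: ifPn => _; last by rewrite mule0.
  by rewrite -!EFinD -EFinM; congr EFin; field; rewrite gt_eqF.
rewrite ge0_integral_mscale//; congr (_ * _)%E.
by rewrite /nu ge0_integral_pushforward.
Qed.

(** The Cholesky factor is built from one Schur complement at a time, so that
    the change of variables reduces to Tonelli's theorem and the one-dimensional
    case; no general Jacobian formula is involved. *)
Lemma posdef_whitening n (C : 'M[R]_n) : posdef C ->
  exists L : 'M[R]_n, [/\ L^T *m L = C, 0 < \det L &
    forall (m : 'rV[R]_n) (h : 'rV[R]_n -> \bar R),
      measurable_fun setT h -> (forall x, 0 <= h x)%E ->
      (\int[leb n]_x h x = (\det L)%:E * \int[leb n]_y h (m + y *m L)%R)%E].
Proof.
elim: n C => [C _|n IH C pC].
  exists 1%:M; split.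
  - by apply/matrixP => -[].
  - by rewrite det1.
  - move=> m h mh h0; rewrite det1 mul1e; apply: eq_integral => x _.
    by congr h; apply/rowP => -[].
have [s [u [S [s0 pS ->]]]] := posdef_schur (pC : posdef (C : 'M[R]_(1 + n))).
have [K [KS dK hK]] := IH S pS.
exists (block_mx s%:M u 0 K); split.
- rewrite (@tr_block_mx _ 1 n 1 n) (@mulmx_block _ 1 n 1 n 1 n) !trmx0 !tr_scalar_mx.
  rewrite !mul0mx !addr0 mulmx0 addr0 -scalar_mxM -expr2 KS.
  by rewrite mul_scalar_mx mul_mx_scalar.
- by rewrite (@det_ublock _ 1 n) det_scalar1 mulr_gt0.
- move=> m h mh h0.
  rewrite (@det_ublock _ 1 n) det_scalar1.
  pose m1 : R := m 0 0; pose m2 : 'rV[R]_n := rsubmx (m : 'rV[R]_(1 + n)).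
  pose G z := (\int[leb n]_v h (row_mx (z%:M : 'rV_1) v))%E.
  have mcons : measurable_fun setT (fun zv : measurableTypeR R * 'rV[R]_n =>
      h (row_mx (zv.1%:M : 'rV_1) zv.2)).
    exact: (measurableT_comp mh (@measurable_cons_rV R n)).
  have mG : measurable_fun setT G.
    apply: (measurable_fun_fubini_tonelli_F
      (fun zv : measurableTypeR R * 'rV[R]_n => h (row_mx (zv.1%:M : 'rV_1) zv.2))) => //.
  have G0 z : (0 <= G z)%E by apply: integral_ge0 => v _; exact: h0.
  have mh' : measurable_fun setT (fun y : 'rV[R]_n.+1 =>
      h (m + y *m (block_mx s%:M u 0 K : 'M[R]_n.+1))%R).
    apply: (measurableT_comp mh); apply: measurable_addmx => //.
    exact: (@measurable_mulmx _ _ _ _ _ id).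
  rewrite (ge0_integral_cons mh h0).
  rewrite (ge0_integral_affine m1 s0 mG G0) EFinM -muleA; congr (_ * _)%E.
  rewrite (ge0_integral_cons mh' (fun y => h0 _)).
  rewrite -ge0_integralZl//=; last 3 first.
  + apply: (measurable_fun_fubini_tonelli_F
      (fun zv : measurableTypeR R * 'rV[R]_n =>
       h (m + row_mx (zv.1%:M : 'rV_1) zv.2 *m (block_mx s%:M u 0 K : 'M[R]_n.+1))%R)) => //.
    exact: (measurableT_comp mh' (@measurable_cons_rV R n)).
  + by move=> z _; apply: integral_ge0 => v _; exact: h0.
  + by rewrite lee_fin ltW.
  apply: eq_integral => z _; rewrite /G.
  rewrite (hK (m2 + z *: u) (fun v => h (row_mx ((m1 + s * z)%:M : 'rV_1) v))); last 2 first.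
  + exact: (measurableT_comp mcons (pair1_measurable (m1 + s * z))).
  + by move=> v; exact: h0.
  congr (_ * _)%E; apply: eq_integral => v _; congr h.
  rewrite (@mul_row_block _ 1 1 n 1 n) -[in RHS](@hsubmxK _ 1 1 n m).
  rewrite (@add_row_mx _ 1 1 n).
  rewrite mulmx0 addr0 -scalar_mxM mul_scalar_mx addrA.
  congr (row_mx _ _ : 'rV[R]_(1 + n)).
  apply/rowP => i; rewrite ord1 !mxE/= mulr1n mulrC; congr (_ + _).
  by rewrite /m1; congr (m _ _); apply/val_inj.
Qed.

Lemma posdef_det_gt0 n (C : 'M[R]_n) : posdef C -> 0 < \det C.
Proof.
move=> /posdef_whitening[L [<- L0 _]].
by rewrite det_mulmx det_tr mulr_gt0.
Qed.

End lebesgue_rV_theory.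

(** * Bounded losses of quadratic polynomials *)

Record loss_function (R : realType) (rho : R -> R) : Prop := LossFunction {
  loss_nondecr : forall s t, `|s| <= `|t| -> rho s <= rho t;
  loss_incr0 : forall t, 0 < t -> rho 0 < rho t;
  loss_cont : continuous rho;
  loss0 : rho 0 = 0;
  loss_lim : rho v @[v --> +oo] --> (1 : R) }.

Section loss_theory.
Context (R : realType) (rho : R -> R) (rhoP : loss_function rho).

Lemma loss_ge0 t : 0 <= rho t.
Proof. by rewrite -(loss0 rhoP) loss_nondecr// normr0. Qed.

Lemma loss_le1 t : rho t <= 1.
Proof.
apply: (cvgr_to_ge (loss_lim rhoP)).
near=> v; apply: (loss_nondecr rhoP).
rewrite [leRHS]ger0_norm; near: v; exact: nbhs_pinfty_ge (num_real _).
Unshelve. all: by end_near. Qed.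

Lemma loss_gt0 t : 0 < t -> 0 < rho t.
Proof. by move=> t0; rewrite -[X in X < _](loss0 rhoP) (loss_incr0 rhoP). Qed.

Lemma loss_norm_le1 t : `|rho t| <= 1.
Proof. by rewrite ger0_norm ?loss_ge0 ?loss_le1. Qed.

Lemma loss_ge0_nondecr s t : 0 <= s -> s <= t -> rho s <= rho t.
Proof.
move=> s0 st; apply: (loss_nondecr rhoP).
by rewrite !ger0_norm// (le_trans s0).
Qed.

Lemma loss_dist_le1 s t : `|rho s - rho t| <= 1.
Proof.
have := loss_ge0 s; have := loss_ge0 t; have := loss_le1 s; have := loss_le1 t.
by move=> *; rewrite ler_norml; apply/andP; split; lra.
Qed.

Lemma loss_unif_cont (C e : R) : 0 < e -> exists2 d : R, 0 < d &
  forall s t, `|s| <= C -> `|s - t| < d -> `|rho s - rho t| <= e.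
Proof.
move=> e0.
have /compact_near_coveringP/(_ _ 0^'+ (fun d s => forall t, `|s - t| < d ->
    `|rho s - rho t| <= e)) := @segment_compact R (- C) C.
case.
  move=> s _.
  have /cvgrPdist_lt/(_ _ (divr_gt0 e0 (ltr0n R 2)))[d /= d0 hd] := loss_cont rhoP (x := s).
  have d20 : 0 < d / 2 by rewrite divr_gt0.
  exists (ball s (d / 2), [set x | x < d / 2]) => /=.
    split; first exact: nbhsx_ballx.
    exact: nbhs_right_lt.
  move=> [s' d'] /= [ss' d'd] t s't.
  have h1 := hd s' (lt_trans ss' (_ : d / 2 < d)).
  have h2 : `|rho s - rho t| < e / 2.
    apply: hd; rewrite /= (splitr d) -(subrKA s').
    by rewrite (le_lt_trans (ler_normD _ _))// ltrD// (lt_trans s't).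
  rewrite -(subrKA (rho s)) (splitr e) (le_trans (ler_normD _ _))// lerD ?(ltW h2)//.
  by rewrite distrC ltW// h1//; lra.
move=> d0 /= d00 hd.
exists (d0 / 2); first by rewrite divr_gt0.
move=> s t sC st; apply: (hd (d0 / 2) _ _ s) => //=.
- by rewrite sub0r normrN ger0_norm; lra.
- by rewrite divr_gt0.
- by rewrite in_itv/= -ler_norml.
Qed.

End loss_theory.

Section quadratic_loss.
Context (R : realType) (rho : R -> R) (rhoP : loss_function rho) (p : nat).

Definition qloss (Q : 'M[R]_(1 + p)) (x : 'rV[R]_p) : R :=
  rho (qform Q (homog x)).

Definition cube (B : R) : set 'rV[R]_p := [set x | forall i, `|x 0 i| <= B].

Lemma measurable_qloss Q : measurable_fun setT (qloss Q).
Proof.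
apply: (measurableT_comp (continuous_measurable_fun (loss_cont rhoP))).
by apply: measurable_qform; exact: measurable_homog.
Qed.

Lemma qloss_norm_le1 Q x : `|qloss Q x| <= 1.
Proof. exact: loss_norm_le1. Qed.

Lemma measurable_cube B : measurable (cube B).
Proof.
apply: (measurable_boxes (A := fun=> [set t | `|t| <= B])) => _.
rewrite (_ : [set t | _] = `[- B, B]%classic)//.
by apply/seteqP; split => t /=; rewrite in_itv/= ler_norml.
Qed.

(** On a cube the form is Lipschitz in the entries of its matrix, and [rho] is
    uniformly continuous on bounded sets; off the cube the losses differ by at
    most 1. *)
Lemma qloss_equicontinuous (Q : 'M[R]_(1 + p)) (B e : R) : 0 < e ->
  exists2 d : R, 0 < d & forall Q' : 'M[R]_(1 + p),
    (forall i j, `|Q' i j - Q i j| < d) ->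
    forall x, `|qloss Q x - qloss Q' x| <= e + \1_(~` cube B) x.
Proof.
move=> e0.
pose B1 := Num.max 1 B.
have B10 : 0 < B1 by rewrite lt_max ltr01.
have hB x i : cube B x -> `|homog x 0 i| <= B1.
  move=> xB; rewrite /homog; case: (split_ordP i) => j ->.
    by rewrite row_mxEl ord1 mxE eqxx normr1 le_max lexx.
  by rewrite row_mxEr le_max xB orbT.
have bnd (D : 'M[R]_(1 + p)) x : cube B x ->
    `|qform D (homog x)| <= \sum_i \sum_j B1 ^+ 2 * `|D i j|.
  move=> xB; rewrite qformE (le_trans (ler_norm_sum _ _ _))//.
  apply: ler_sum => i _; rewrite (le_trans (ler_norm_sum _ _ _))//.
  apply: ler_sum => j _; rewrite !normrM expr2 mulrAC.
  by rewrite ler_wpM2r// ler_pM// hB.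
pose C := \sum_i \sum_j B1 ^+ 2 * `|Q i j|.
have [d d0 hd] := loss_unif_cont rhoP C e0.
pose N : R := \sum_(i < 1 + p) \sum_(j < 1 + p) B1 ^+ 2.
have N0 : 0 <= N by apply: sumr_ge0 => i _; apply: sumr_ge0 => j _; exact: sqr_ge0.
have N10 : 0 < N + 1 by lra.
exists (d / (N + 1)); first exact: divr_gt0.
move=> Q' QQ' x.
have [xB|xB] := pselect (cube B x); last first.
  rewrite indicE mem_set//; apply: (le_trans (loss_dist_le1 rhoP _ _)).
  by rewrite lerDr ltW.
rewrite indicE memNset ?addr0; last by move=> /=; apply.
apply: hd; first exact: bnd.
rewrite distrC.
have -> : qform Q' (homog x) - qform Q (homog x) = qform (Q' - Q) (homog x).
  by rewrite /qform mulmxBr mulmxBl !mxE.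
apply: (le_lt_trans (bnd _ _ xB)).
apply: (@le_lt_trans _ _ (N * (d / (N + 1)))).
  rewrite /N mulr_suml; apply: ler_sum => i _; rewrite mulr_suml.
  apply: ler_sum => j _; apply: ler_wpM2l; first exact: sqr_ge0.
  by have := QQ' i j; rewrite !mxE => /ltW.
rewrite mulrA ltr_pdivrMr// mulrC ltr_pM2l//; lra.
Qed.

Section expectation.
Context (H : probability 'rV[R]_p R).

Definition eloss (Q : 'M[R]_(1 + p)) : R := \int[H]_x qloss Q x.

Lemma integrable_qloss Q : H.-integrable setT (EFin \o qloss Q).
Proof.
exact: (bounded_integrable (probability_lty H) (measurable_qloss Q)
  (qloss_norm_le1 Q)).
Qed.

Lemma elossE Q : (\int[H]_x (qloss Q x)%:E)%E = (eloss Q)%:E.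
Proof.
by rewrite /eloss /Rintegral fineK//; exact: integrable_fin_num (integrable_qloss Q).
Qed.

Definition tail (B : R) : R := fine (H (~` cube B)).

Lemma tail_integral B : \int[H]_x \1_(~` cube B) x = tail B.
Proof.
rewrite /Rintegral integral_indic//; last exact: measurableC (measurable_cube B).
by rewrite setIT.
Qed.

Lemma tail_cvg0 : tail n%:R @[n --> \oo] --> (0 : R).
Proof.
have capE : \bigcap_n ~` cube n%:R = set0.
  rewrite -setC_bigcup (_ : \bigcup_n _ = setT) ?setCT//.
  apply/seteqP; split => // x _.
  exists (Num.bound (\sum_i `|x 0 i|)) => //= i.
  rewrite ltW// (le_lt_trans _ (archi_boundP _)) ?sumr_ge0//.
  by rewrite (bigD1 i)//= lerDl sumr_ge0.
have : H (~` cube n%:R) @[n --> \oo] --> H (\bigcap_n ~` cube n%:R).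
  apply: nonincreasing_cvg_mu.
  - exact: le_lt_trans (probability_le1 _ (measurableC (measurable_cube _))) (ltry 1).
  - by move=> n; exact: measurableC (measurable_cube _).
  - by rewrite capE.
  - move=> m n mn; apply/subsetPset; apply: subsetC => x xm i.
    by rewrite (le_trans (xm i))// ler_nat.
rewrite capE measure0 => h.
apply: (@fine_cvg _ _ _ _ (fun n => H (~` cube n%:R))).
exact: h.
Qed.

Lemma eloss_le (Q Q' : 'M[R]_(1 + p)) :
  (forall x, qloss Q x <= qloss Q' x) -> eloss Q <= eloss Q'.
Proof. by move=> h; apply: le_Rintegral => //; exact: integrable_qloss. Qed.

Lemma eloss0 : eloss 0 = 0.
Proof.
rewrite /eloss; under eq_Rintegral.
  move=> x _; rewrite /qloss /qform mulmx0 mul0mx mxE (loss0 rhoP); over.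
by rewrite Rintegral_cst// mul0r.
Qed.

Lemma eloss_continuous (Q : 'M[R]_(1 + p)) (e : R) : 0 < e ->
  exists2 d : R, 0 < d & forall Q' : 'M[R]_(1 + p),
    (forall i j, `|Q' i j - Q i j| < d) -> `|eloss Q - eloss Q'| <= e.
Proof.
move=> e0.
have e20 : 0 < e / 2 by rewrite divr_gt0.
have /cvgrPdist_lt/(_ _ e20)[n _ /(_ n (leqnn n))] := tail_cvg0.
rewrite /= sub0r normrN => tn.
have [d d0 hd] := qloss_equicontinuous Q n%:R e20.
exists d => // Q' /hd QQ'.
rewrite /eloss -RintegralB//; [|exact: integrable_qloss..].
have mi : measurable (~` cube n%:R) by exact: measurableC (measurable_cube _).
have ii : H.-integrable setT (EFin \o (\1_(~` cube n%:R) : 'rV[R]_p -> R)).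
  by apply: integrable_indic => //; exact: fin_num_fun_lty.
have iQ : H.-integrable setT (EFin \o (fun x => qloss Q x - qloss Q' x)).
  exact: (integrableB measurableT (integrable_qloss Q) (integrable_qloss Q')).
apply: le_trans (le_normr_Rintegral _ _) _ => //.
apply: (@le_trans _ _ (\int[H]_x (e / 2 + \1_(~` cube n%:R) x))).
  apply: le_Rintegral => //.
  - exact: integrable_norm iQ.
  - exact: (integrableD measurableT
      (finite_measure_integrable_cst H (e / 2) measurableT) ii).
rewrite RintegralD//; last exact: finite_measure_integrable_cst.
rewrite Rintegral_cst// tail_integral.
have HT : fine (H setT) = 1 by rewrite probability_setT.
rewrite (_ : fine _ = 1) ?mulr1; last exact: HT.
rewrite [leRHS](splitr e) lerD2l ltW// (le_lt_trans _ tn)//.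
exact: ler_norm.
Qed.

End expectation.
End quadratic_loss.

(** * Uniform convergence of average losses *)

Section empirical.
Context (R : realType) (rho : R -> R) (rhoP : loss_function rho) (p : nat)
  (H : probability 'rV[R]_p R).

Definition average (x : nat -> 'rV[R]_p) (f : 'rV[R]_p -> R) (n : nat) : R :=
  (\sum_(i < n) f (x i)) / n%:R.

Lemma average_le x f g n : (forall y, f y <= g y) ->
  average x f n <= average x g n.
Proof. by move=> fg; rewrite ler_wpM2r ?invr_ge0 ?ler0n// ler_sum. Qed.

Lemma averageD x f g n :
  average x (fun y => f y + g y) n = average x f n + average x g n.
Proof. by rewrite /average big_split mulrDl. Qed.

Lemma average_cst x (a : R) n : (0 < n)%N -> average x (fun=> a) n = a.
Proof.
move=> n0; rewrite /average sumr_const card_ord -[a *+ n]mulr_natl mulrAC divff ?mul1r//.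
by rewrite pnatr_eq0 -lt0n.
Qed.

(** The sequences along which countably many averages converge: the losses with
    rational matrices and the fractions of points outside the integer cubes. *)
Definition typical (x : nat -> 'rV[R]_p) : Prop :=
  (forall Q : 'M[rat]_(1 + p), average x (qloss rho (map_mx ratr Q)) n
     @[n --> \oo] --> eloss rho H (map_mx ratr Q)) /\
  (forall B : nat, average x (\1_(~` cube B%:R)) n
     @[n --> \oo] --> tail H B%:R).

Lemma ae_typical d (T : measurableType d) (P : probability T R)
    (X : nat -> {RV P >-> 'rV[R]_p}) : iid H X ->
  {ae P, forall w, typical (fun i => X i w)}.
Proof.
move=> X_iid.
have h1 : {ae P, forall w, forall k : nat,
    forall Q, choice.unpickle k = Some Q :> option 'M[rat]_(1 + p) ->
    average (fun i => X i w) (qloss rho (map_mx ratr Q)) n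
     @[n --> \oo] --> eloss rho H (map_mx ratr Q)}.
  apply: ae_foralln => k.
  case: choice.unpickle => [Q|]; last exact: aeW.
  have := slln_bounded X_iid (measurable_qloss rhoP (map_mx ratr Q))
    (qloss_norm_le1 rhoP (map_mx ratr Q)).
  by apply: filterS => w hw _ [<-].
have h2 : {ae P, forall w, forall B : nat,
    average (fun i => X i w) (\1_(~` cube B%:R)) n @[n --> \oo] --> tail H B%:R}.
  apply: ae_foralln => B.
  have mi : measurable_fun setT (\1_(~` cube B%:R) : 'rV[R]_p -> R).
    by apply: measurable_indic; exact: measurableC (measurable_cube _).
  have i1 (x : 'rV[R]_p) : `|\1_(~` cube B%:R) x| <= 1 :> R.
    by rewrite indicE; case: (_ \in _); rewrite ?normr1 ?normr0.
  have := slln_bounded X_iid mi i1.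
  by apply: filterS => w; rewrite tail_integral.
apply: filterS2 h1 h2 => w h1 h2; split => // Q.
by apply: (h1 (choice.pickle Q)); rewrite choice.pickleK.
Qed.

(** Uniform law of large numbers, in the form of continuous convergence: by
    equicontinuity on a cube of mass close to 1, a nearby rational matrix can
    be used in place of the moving one. *)
Lemma average_qloss_cvg (x : nat -> 'rV[R]_p) (G : set_system nat)
    {FG : ProperFilter G} (Qn : nat -> 'M[R]_(1 + p)) (Q : 'M[R]_(1 + p)) :
  typical x -> G --> \oo ->
  (forall i j, Qn n i j @[n --> G] --> Q i j) ->
  average x (qloss rho (Qn n)) n @[n --> G] --> eloss rho H Q.
Proof.
move=> [xQ xB] Goo QnQ; apply/cvgrPdist_le => e e0.
pose e1 := e / 9.
have e10 : 0 < e1 by rewrite divr_gt0.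
have /cvgrPdist_lt/(_ _ e10)[B _ /(_ B (leqnn B))] := tail_cvg0 H.
rewrite /= sub0r normrN => tB.
have tB' : tail H B%:R < e1 by rewrite (le_lt_trans (ler_norm _)).
have [d d0 hd] := qloss_equicontinuous rhoP Q B%:R e10.
have [d' d'0 hd'] := eloss_continuous rhoP H Q e10.
pose d1 := Num.min d d'.
have d10 : 0 < d1 by rewrite lt_min d0.
pose Q1 : 'M[rat]_(1 + p) := \matrix_(i, j)
  xget 0 [set q | ratr q \in `]Q i j - d1, Q i j + d1[ ].
have Q1E i j : `|ratr (Q1 i j) - Q i j| < d1.
  have /rat_in_itvoo[q hq] : Q i j - d1 < Q i j + d1 by lra.
  rewrite mxE; case: xgetP => [y _ /=|/(_ q)//].
  by rewrite in_itv/= ltr_distl.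
have ulln := cvg_trans (cvg_app _ Goo) (xQ Q1).
have tln := cvg_trans (cvg_app _ Goo) (xB B).
near=> n.
have n0 : (0 < n)%N by near: n; apply: Goo; exists 1%N.
have near1 : `|eloss rho H (map_mx ratr Q1) -
    average x (qloss rho (map_mx ratr Q1)) n| <= e1.
  by near: n; move/cvgrPdist_le : ulln; exact.
have near2 : `|tail H B%:R - average x (\1_(~` cube B%:R)) n| <= e1.
  by near: n; move/cvgrPdist_le : tln; exact.
have QnE : forall i j, `|Qn n i j - Q i j| < d.
  near: n; apply: filter_forall => i; apply: filter_forall => j.
  by have /cvgrPdist_lt/(_ _ d0) := QnQ i j; apply: filterS => k; rewrite distrC.
have near3 : `|eloss rho H Q - eloss rho H (map_mx ratr Q1)| <= e1.
  by apply: hd' => i j; rewrite mxE (lt_le_trans (Q1E i j))// ge_min lexx orbT.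
have near4 : `|average x (qloss rho (Qn n)) n -
    average x (qloss rho (map_mx ratr Q1)) n| <= 6 * e1.
  have close y : `|qloss rho (Qn n) y - qloss rho (map_mx ratr Q1) y| <=
      2 * e1 + 2 * \1_(~` cube B%:R) y.
    have h1 := hd _ QnE y.
    have h2 : `|qloss rho Q y - qloss rho (map_mx ratr Q1) y| <=
        e1 + \1_(~` cube B%:R) y.
      by apply: hd => i j; rewrite mxE (lt_le_trans (Q1E i j))// ge_min lexx.
    rewrite -(subrKA (qloss rho Q y)) (le_trans (ler_normD _ _))//.
    by rewrite distrC; lra.
  rewrite -mulrBl -sumrB normrM [X in _ * X]ger0_norm ?invr_ge0//.
  apply: (@le_trans _ _ (average x (fun y => 2 * e1 + 2 * \1_(~` cube B%:R) y) n)).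
    rewrite ler_wpM2r ?invr_ge0// (le_trans (ler_norm_sum _ _ _))//.
    by apply: ler_sum => i _; exact: close.
  rewrite averageD average_cst//.
  have -> : average x (fun y => 2 * \1_(~` cube B%:R) y) n =
     2 * average x (\1_(~` cube B%:R)) n by rewrite /average -mulr_sumr mulrA.
  by move: near2; rewrite ler_norml => /andP[? ?]; lra.
have e9 : e = 9 * e1 by rewrite /e1; field.
move: near1 near3 near4; rewrite !ler_norml e9.
by move=> /andP[? ?] /andP[? ?] /andP[? ?]; apply/andP; split; lra.
Unshelve. all: by end_near. Qed.

End empirical.

(** * Scale equations and the limits of the expected loss *)

Section scale_equation.
Context (R : realType).

(** Both the population scale and the generalized scale are the infimum of the
    solutions of an equation [h s = b] of this kind. By continuity the infimum
    is itself a solution, unless it is 0. *)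
Variables (h : R -> R) (b : R).
Hypothesis h_noninc : forall s t, 0 < s -> s <= t -> h t <= h s.
Hypothesis h_cont : forall s, 0 < s -> {for s, continuous h}.

Definition scales : set R := [set s | 0 < s /\ h s = b].

Lemma has_inf_scales s : scales s -> has_inf scales.
Proof. by move=> Ss; split; [exists s|exists 0 => x [/ltW]]. Qed.

Lemma scale_ge_inf s : scales s -> inf scales <= s.
Proof. by move=> Ss; apply: ge_inf => //; exists 0 => x [/ltW]. Qed.

Lemma scales_neq0 s1 s2 : 0 < s1 -> 0 < s2 -> b <= h s1 -> h s2 <= b ->
  exists2 s, scales s & s <= s2.
Proof.
move=> s10 s20 h1 h2.
have [s12|s21] := leP s1 s2; last first.
  exists s2 => //; split => //; apply/eqP; rewrite eq_le h2/=.
  by rewrite (le_trans h1)// h_noninc// ltW.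
have cont : {within `[s1, s2], continuous h}.
  apply: continuous_in_subspaceT => s; rewrite inE/= in_itv/= => /andP[s1s _].
  by apply: h_cont; rewrite (lt_le_trans s10).
have [] := @IVT _ h s1 s2 b s12 cont.
  by rewrite ge_min h2 orbT /= le_max h1.
move=> s; rewrite in_itv/= => /andP[s1s ss2] hs; exists s => //.
by split => //; rewrite (lt_le_trans s10).
Qed.

Lemma inf_scales_gt0 s1 s : 0 < s1 -> b < h s1 -> scales s -> 0 < inf scales.
Proof.
move=> s10 h1 Ss; apply: (lt_le_trans s10).
apply: lb_le_inf; first by exists s.
move=> t [t0 ht]; rewrite leNgt; apply/negP => ts1.
by have := h_noninc t0 (ltW ts1); rewrite ht leNgt h1.
Qed.

Lemma inf_scales s : scales s -> 0 < inf scales -> scales (inf scales).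
Proof.
move=> Ss i0'; split => //.
have hb : h (inf scales) >= b.
  have [_ <-] := Ss.
  by apply: h_noninc => //; exact: scale_ge_inf.
apply/eqP; rewrite eq_le hb andbT leNgt; apply/negP => hlt.
have /cvgrPdist_lt/(_ _ (_ : 0 < h (inf scales) - b))[|d /= d0 hd] := h_cont i0'.
  by rewrite subr_gt0.
have [t St td] := @inf_adherent _ scales d d0 (has_inf_scales Ss).
have it := scale_ge_inf St.
have := hd t; rewrite /= ler0_norm ?subr_le0// opprB ltrBlDl => /(_ td).
by have [_ ->] := St; rewrite ger0_norm ?subr_ge0// ltxx.
Qed.

End scale_equation.

Section density.
Context (R : realType) (p : nat) (H : probability 'rV[R]_p R)
  (f : 'rV[R]_p -> R) (Hf : has_density H f).

Lemma density_null (A : set 'rV[R]_p) : measurable A ->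
  lebesgue_rV R p A = 0%E -> H A = 0%E.
Proof.
move=> mA A0; have [f0 mf HE] := Hf.
by rewrite HE// null_set_integral//; exact/measurable_EFinP/measurable_funTS.
Qed.

Lemma density_pos (A : set 'rV[R]_p) (c : R) : measurable A -> 0 < c ->
  (forall x, A x -> c <= f x) -> (0 < lebesgue_rV R p A)%E -> (0 < H A)%E.
Proof.
move=> mA c0 cf A0; have [f0 mf HE] := Hf.
rewrite HE//; apply: (@lt_le_trans _ _ (c%:E * lebesgue_rV R p A)%E).
  by rewrite mule_gt0.
rewrite -integral_cst//; apply: ge0_le_integral => //.
- by move=> x _; rewrite lee_fin ltW.
- exact/measurable_EFinP/measurable_funTS.
Qed.

(** The zero set of a nonnegative quadratic polynomial that is not identically
    0 lies in the set where one of the components of its gradient vanishes,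
    which is a hyperplane or empty. *)
Lemma psd_zeros_null (Q : 'M[R]_(1 + p)) : psd Q -> Q != 0 ->
  H [set x | qform Q (homog x) = 0] = 0%E.
Proof.
move=> pQ Q0.
have mZ := measurable_zeros Q.
have [i [j Qij]] : exists i j, Q i j != 0.
  apply: contrapT => h; move/eqP: Q0; apply; apply/matrixP => i j.
  by rewrite [RHS]mxE; apply/eqP/negPn/negP => Qij; apply: h; exists i, j.
pose w : 'rV[R]_p := \row_k Q (rshift 1 k) j.
have colE (x : 'rV[R]_p) : (homog x *m Q) 0 j = Q (lshift p 0) j + (x *m w^T) 0 0.
  rewrite mxE big_split_ord/= big_ord1 /homog row_mxEl mxE eqxx mul1r; congr (_ + _).
  by rewrite mxE; apply: eq_bigr => k _; rewrite row_mxEr !mxE.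
have sub : [set x | qform Q (homog x) = 0] `<=`
    [set x | (x *m w^T) 0 0 = - Q (lshift p 0) j].
  move=> x /= /(psd_qform0 pQ)/rowP/(_ j).
  by rewrite colE [RHS]mxE => /eqP; rewrite addrC addr_eq0 => /eqP.
have [w0|w0] := eqVneq w 0; last first.
  apply/eqP; rewrite -measure_le0.
  rewrite -(density_null (measurable_hyperplane w _)
    (lebesgue_hyperplane (- Q (lshift p 0) j) w0)).
  by apply: le_measure; rewrite ?inE//; exact: measurable_hyperplane.
suff -> : [set x | qform Q (homog x) = 0] = set0 by rewrite measure0.
apply/seteqP; split => // x /sub /=; rewrite w0 trmx0 mulmx0 mxE => /eqP.
rewrite eq_sym oppr_eq0 => /eqP Q0j; move/negP: Qij; apply.
case: (split_ordP i) => k ->; first by rewrite ord1 Q0j.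
by have /rowP/(_ k) := w0; rewrite !mxE => ->.
Qed.

End density.

Section loss_scaling.
Context (R : realType) (rho : R -> R) (rhoP : loss_function rho) (p : nat)
  (H : probability 'rV[R]_p R).

Lemma eloss_scale_le (Q : 'M[R]_(1 + p)) (t1 t2 : R) : psd Q -> 0 <= t1 ->
  t1 <= t2 -> eloss rho H (t1 *: Q) <= eloss rho H (t2 *: Q).
Proof.
move=> pQ t10 t12; apply: eloss_le => // x; rewrite /qloss !qformZ.
apply: (loss_ge0_nondecr rhoP).
  by rewrite mulr_ge0//; exact: pQ.2.
by rewrite ler_wpM2r//; exact: pQ.2.
Qed.

Lemma eloss_scale_continuous (Q : 'M[R]_(1 + p)) :
  continuous (fun t : R => eloss rho H (t *: Q)).
Proof.
move=> t; apply/cvgrPdist_le => e e0.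
have [d d0 hd] := eloss_continuous rhoP H (t *: Q) e0.
pose m := 1 + \sum_i \sum_j `|Q i j|.
have m0 : 0 < m.
  by rewrite ltr_pwDl//; apply: sumr_ge0 => i _; apply: sumr_ge0 => j _.
have Qm i j : `|Q i j| < m.
  rewrite /m (bigD1 i)//= (bigD1 j)//=.
  have h1 : 0 <= \sum_(k | k != j) `|Q i k| by exact: sumr_ge0.
  have h2 : 0 <= \sum_(k | k != i) \sum_l `|Q k l|.
    by apply: sumr_ge0 => k _; exact: sumr_ge0.
  lra.
near=> s.
apply: hd => i j; rewrite !mxE -mulrBl normrM distrC.
apply: (@le_lt_trans _ _ (`|t - s| * m)); first by rewrite ler_wpM2l// ltW// Qm.
rewrite -ltr_pdivlMr//; near: s.
have dm : 0 < d / m by rewrite divr_gt0.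
exists (d / m) => //= s.
Unshelve. all: by end_near. Qed.

(** Where the form vanishes is a null set, and elsewhere [rho (n q)] tends
    to 1. *)
Lemma eloss_scale_cvg1 (f : 'rV[R]_p -> R) (Q : 'M[R]_(1 + p)) :
  has_density H f -> psd Q -> Q != 0 ->
  eloss rho H (n%:R *: Q) @[n --> \oo] --> (1 : R).
Proof.
move=> Hf pQ Q0.
have Z0 := psd_zeros_null Hf pQ Q0.
have mZ := measurable_zeros Q.
have := @dominated_convergence _ _ _ H setT measurableT
  (fun n x => (qloss rho (n%:R *: Q) x)%:E) (cst 1%E) (cst 1%E).
case.
- by move=> n; apply/measurable_EFinP; exact: measurable_qloss.
- exact: measurable_cst.
- exists [set x | qform Q (homog x) = 0]; split => // x /=.
  move=> h; apply: contrapT => q0; apply: h => _.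
  have q_gt0 : 0 < qform Q (homog x).
    by rewrite lt_neqAle pQ.2 andbT eq_sym; exact/eqP.
  apply: cvg_EFin; first exact: nearW.
  have qoo : n%:R * qform Q (homog x) @[n --> \oo] --> +oo.
    apply/cvgryPge => A; near=> n.
    by rewrite -ler_pdivrMr//; near: n; exact: nbhs_infty_ger.
  have := cvg_comp _ _ qoo (loss_lim rhoP).
  by apply: cvg_trans; apply: near_eq_cvg; apply: nearW => n; rewrite /= /qloss qformZ.
- exact: finite_measure_integrable_cst.
- by apply: aeW => x n _; rewrite gee0_abs lee_fin ?(loss_le1 rhoP)// (loss_ge0 rhoP).
move=> _ _.
rewrite integral_cst// mul1e (_ : _ setT = 1%E); last exact: probability_setT.
move=> h; apply: (@fine_cvg _ _ _ _ (fun n => (eloss rho H (n%:R *: Q))%:E)).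
by apply: cvg_trans h; apply: near_eq_cvg; apply: nearW => n; rewrite /= elossE.
Unshelve. all: by end_near. Qed.

End loss_scaling.

(** * Entrywise convergence and strict monotony of the expected loss *)

Section entrywise.
Context (R : realType) (T : Type) (G : set_system T) {FG : Filter G}.

Lemma cvg_bigsum (I : Type) (r : seq I) (f : I -> T -> R) (l : I -> R) :
  (forall i, f i x @[x --> G] --> l i) ->
  \sum_(i <- r) f i x @[x --> G] --> \sum_(i <- r) l i.
Proof.
move=> fl; elim: r => [|i r IH].
  by under eq_fun do rewrite big_nil; rewrite big_nil; exact: cvg_cst.
under eq_fun do rewrite big_cons; rewrite big_cons; exact: cvgD (fl i) IH.
Qed.

Lemma cvg_bigprod (I : Type) (r : seq I) (f : I -> T -> R) (l : I -> R) :
  (forall i, f i x @[x --> G] --> l i) ->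
  \prod_(i <- r) f i x @[x --> G] --> \prod_(i <- r) l i.
Proof.
move=> fl; elim: r => [|i r IH].
  by under eq_fun do rewrite big_nil; rewrite big_nil; exact: cvg_cst.
under eq_fun do rewrite big_cons; rewrite big_cons; exact: cvgM (fl i) IH.
Qed.

Definition mxcvg m n (A : T -> 'M[R]_(m, n)) (B : 'M[R]_(m, n)) : Prop :=
  forall i j, A x i j @[x --> G] --> B i j.

Lemma mxcvg_mul m n k (A : T -> 'M[R]_(m, n)) A0 (B : T -> 'M[R]_(n, k)) B0 :
  mxcvg A A0 -> mxcvg B B0 -> mxcvg (fun x => A x *m B x) (A0 *m B0).
Proof.
move=> AA0 BB0 i j; under eq_fun do rewrite mxE; rewrite mxE.
by apply: cvg_bigsum => l; exact: cvgM.
Qed.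

Lemma mxcvg_scale m n (a : T -> R) (l : R) (A : T -> 'M[R]_(m, n)) A0 :
  a x @[x --> G] --> l -> mxcvg A A0 -> mxcvg (fun x => a x *: A x) (l *: A0).
Proof.
move=> al AA0 i j; under eq_fun do rewrite mxE; rewrite mxE; exact: cvgM.
Qed.

Lemma mxcvg_cst m n (A : 'M[R]_(m, n)) : mxcvg (fun=> A) A.
Proof. by move=> i j; exact: cvg_cst. Qed.

Lemma mxcvg_opp m n (A : T -> 'M[R]_(m, n)) A0 :
  mxcvg A A0 -> mxcvg (fun x => - A x) (- A0).
Proof.
move=> AA0 i j; under eq_fun do rewrite mxE; rewrite mxE; exact: cvgN.
Qed.

Lemma mxcvg_tr m n (A : T -> 'M[R]_(m, n)) A0 :
  mxcvg A A0 -> mxcvg (fun x => (A x)^T) A0^T.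
Proof.
by move=> AA0 i j; under eq_fun do rewrite mxE; rewrite mxE; exact: AA0.
Qed.

Lemma mxcvg_col_mx m1 m2 n (A : T -> 'M[R]_(m1, n)) A0 (B : T -> 'M[R]_(m2, n)) B0 :
  mxcvg A A0 -> mxcvg B B0 -> mxcvg (fun x => col_mx (A x) (B x)) (col_mx A0 B0).
Proof.
move=> AA0 BB0 i j; case: (split_ordP i) => k ->.
  by under eq_fun do rewrite col_mxEu; rewrite col_mxEu; exact: AA0.
by under eq_fun do rewrite col_mxEd; rewrite col_mxEd; exact: BB0.
Qed.

Lemma mxcvg_det n (A : T -> 'M[R]_n) A0 :
  mxcvg A A0 -> \det (A x) @[x --> G] --> \det A0.
Proof.
move=> AA0; apply: cvg_bigsum => s; apply: cvgM; first exact: cvg_cst.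
by apply: cvg_bigprod => i; exact: AA0.
Qed.

Lemma mxcvg_adj n (A : T -> 'M[R]_n) A0 :
  mxcvg A A0 -> mxcvg (fun x => \adj (A x)) (\adj A0).
Proof.
move=> AA0 i j; under eq_fun do rewrite mxE /cofactor; rewrite mxE /cofactor.
apply: cvgM; first exact: cvg_cst.
apply: mxcvg_det => k l.
by under eq_fun do rewrite !mxE; rewrite !mxE; exact: AA0.
Qed.

Lemma mxcvg_qform n (A : T -> 'M[R]_n) A0 (y : T -> 'rV[R]_n) y0 :
  mxcvg A A0 -> mxcvg y y0 -> qform (A x) (y x) @[x --> G] --> qform A0 y0.
Proof.
by move=> AA0 yy0; apply: (mxcvg_mul (mxcvg_mul yy0 AA0) (mxcvg_tr yy0)).
Qed.

Lemma mxcvg_homform n (m : T -> 'rV[R]_n) m0 (V : T -> 'M[R]_n) V0 :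
  mxcvg m m0 -> mxcvg V V0 ->
  mxcvg (fun x => homform (m x) (V x)) (homform m0 V0).
Proof.
move=> mm0 VV0.
have h := mxcvg_col_mx (mxcvg_opp mm0) (@mxcvg_cst _ _ 1%:M).
exact: (mxcvg_mul (mxcvg_mul h VV0) (mxcvg_tr h)).
Qed.

Lemma mxcvgP m n (A : T -> 'M[R]_(m, n)) A0 :
  mxcvg A A0 -> A x @[x --> G] --> A0.
Proof.
move=> AA0 B /= [P Pn PB].
rewrite /nbhs/=.
have : \forall x \near G, forall i j, P i j (A x i j).
  by apply: filter_forall => i; apply: filter_forall => j; exact: AA0 i j _ (Pn i j).
by apply: filterS => x hx; apply: PB.
Qed.

End entrywise.

Section positivity_near_center.
Context (R : realType) (p : nat).

Definition positive_near (H : probability 'rV[R]_p R) (m : 'rV[R]_p) : Prop :=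
  exists2 r : R, 0 < r & forall (x : 'rV[R]_p) (e : R), (forall i, `|x 0 i - m 0 i| < r) -> 0 < e ->
    (0 < H [set y : 'rV[R]_p | forall i, (`|y 0 i - x 0 i| < e)%R])%E.

Lemma measurable_box (x : 'rV[R]_p) (e : R) :
  measurable [set y : 'rV[R]_p | forall i, `|y 0 i - x 0 i| < e].
Proof.
apply: (measurable_boxes (A := fun i => [set t | `|t - x 0 i| < e])) => i.
rewrite (_ : [set t | _] = `](x 0 i - e), (x 0 i + e)[%classic)//.
by apply/seteqP; split => t /=; rewrite in_itv/= ltr_distl.
Qed.

Lemma lebesgue_box_gt0 (x : 'rV[R]_p) (e : R) : 0 < e ->
  (0 < lebesgue_rV R p [set y : 'rV[R]_p | forall i, (`|y 0 i - x 0 i| < e)%R])%E.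
Proof.
move=> e0.
have -> : [set y : 'rV[R]_p | forall i, `|y 0 i - x 0 i| < e] =
    [set y | forall i, `](x 0 i - e), (x 0 i + e)[%classic (y 0 i)].
  apply/seteqP; split => y /= h i; have := h i;
  by rewrite ?in_itv/= ltr_distl.
rewrite (lebesgue_rV_box (A := fun i => `](x 0 i - e), (x 0 i + e)[%classic))//.
apply: (big_ind (fun z : \bar R => (0 < z)%E)) => //; first by move=> a b; exact: mule_gt0.
move=> i _; rewrite lebesgue_measure_itv/= lte_fin ifT; last by lra.
by rewrite -EFinB lte_fin; lra.
Qed.

Lemma box_continuous (g : 'rV[R]_p -> R) (x : 'rV[R]_p) (e : R) :
  {for x, continuous g} -> 0 < e -> exists2 d : R, 0 < d &
  forall y : 'rV[R]_p, (forall i, `|y 0 i - x 0 i| < d) -> `|g y - g x| < e.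
Proof.
move=> gx e0; have /cvgrPdist_lt/(_ _ e0)/nbhs_ballP[d /= d0 hd] := gx.
exists d => // y yx; rewrite distrC; apply: hd; split => // i j.
by rewrite ord1 /ball/= distrC.
Qed.

Lemma qform_homog_continuous (Q : 'M[R]_(1 + p)) :
  continuous (fun x : 'rV[R]_p => qform Q (homog x)).
Proof.
move=> x; apply: (@mxcvg_qform R _ (nbhs x) _ _ (fun=> Q) Q (@homog R p) (homog x)).
  exact: mxcvg_cst.
move=> i j; rewrite /homog; case: (split_ordP j) => k ->.
  by under eq_fun do rewrite row_mxEl; rewrite row_mxEl; exact: cvg_cst.
under eq_fun do rewrite row_mxEr; rewrite row_mxEr.
exact: coord_continuous.
Qed.

Lemma homform_neq0 (m : 'rV[R]_p) (V : 'M[R]_p) : (0 < p)%N -> posdef V ->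
  homform m V != 0.
Proof.
move=> p0 [_ V0]; apply/eqP => /(congr1 drsubmx); rewrite drsub_homform => VE.
pose i0 := Ordinal p0.
have V00 : V i0 i0 = 0 by rewrite VE !mxE.
have d0 : delta_mx 0 i0 != 0 :> 'rV[R]_p.
  by apply/eqP => /rowP/(_ i0)/eqP; rewrite !mxE !eqxx oner_eq0.
by have := V0 _ d0; rewrite -/(qform _ _) qform_delta V00 ltxx.
Qed.

(** A nonincreasing generator of a density is positive near 0, and then the
    density is bounded below by a positive constant near the centre. *)
Lemma elliptical_positive_near (H : probability 'rV[R]_p R) (m : 'rV[R]_p)
    (S : 'M[R]_p) (f0 : R -> R) : (0 < p)%N -> posdef S ->
  (forall s t, 0 <= s -> s <= t -> f0 t <= f0 s) ->
  has_density H (fun x => (Num.sqrt (\det S))^-1 * f0 (mahalanobis x m S)) ->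
  positive_near H m.
Proof.
move=> p0 pS f0n Hf.
set k := (Num.sqrt (\det S))^-1 in Hf.
have k0 : 0 < k by rewrite invr_gt0 sqrtr_gt0 posdef_det_gt0.
pose Q := homform m (invmx S).
have pV := posdef_inv pS.
have pQ : psd Q by apply: homform_psd; exact: posdef_psd.
have Q0 : Q != 0 by exact: homform_neq0.
have [t t0 ft] : exists2 t, 0 < t & 0 < f0 t.
  apply: contrapT => h.
  have f0le t : 0 < t -> f0 t <= 0.
    by move=> t0; rewrite leNgt; apply/negP => ft; apply: h; exists t.
  pose Z := [set x : 'rV[R]_p | qform Q (homog x) = 0].
  have mZ : measurable Z by exact: measurable_zeros.
  have HZ : H Z = 0%E by exact: (psd_zeros_null Hf pQ Q0).
  have HZC : H (~` Z) = 0%E.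
    have [fge mf HE] := Hf.
    rewrite HE; last exact: measurableC.
    apply: integral0_eq => x Zx; congr EFin; apply/eqP; rewrite eq_le fge andbT.
    rewrite pmulr_rle0// f0le// mahalanobisE lt_neqAle pQ.2 andbT eq_sym.
    exact/eqP.
  have HT : H setT = 1%E by exact: probability_setT.
  have : (H setT <= H Z + H (~` Z))%E.
    by rewrite -(setUv Z); apply: measureU2 => //; exact: measurableC.
  by rewrite HT HZ HZC adde0 lee_fin ler10.
have qm : qform Q (homog m) = 0 by rewrite homformE subrr /qform mul0mx mul0mx mxE.
have [d d0 hd] := box_continuous (@qform_homog_continuous Q m) t0.
have d20 : 0 < d / 2 by rewrite divr_gt0.
exists (d / 2) => // x e xm e0.
apply: (@lt_le_trans _ _ (H [set y : 'rV[R]_p |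
    forall i, `|y 0 i - x 0 i| < Num.min e (d / 2)])); last first.
  apply: le_measure; rewrite ?inE; [exact: measurable_box..|].
  by move=> y /= yx i; rewrite (lt_le_trans (yx i))// ge_min lexx.
apply: (density_pos Hf (c := k * f0 t)); first exact: measurable_box.
- exact: mulr_gt0.
- move=> y /= yx; rewrite ler_pM2l// f0n//.
    by rewrite mahalanobisE; exact: pQ.2.
  have := hd y; rewrite qm subr0 mahalanobisE -/Q => h.
  apply: ltW; apply: le_lt_trans (ler_norm _) _; apply: h => i.
  rewrite -(subrKA (x 0 i)) (splitr d) (le_lt_trans (ler_normD _ _))// ltrD//.
  by rewrite (lt_le_trans (yx i))// ge_min lexx orbT.
- by apply: lebesgue_box_gt0; rewrite lt_min e0.
Qed.

End positivity_near_center.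

Section strict_monotony.
Context (R : realType) (rho : R -> R) (rhoP : loss_function rho) (p : nat)
  (H : probability 'rV[R]_p R).

(** If [rho a = rho (k a)] for some [k < 1] and all small [a], iterating gives
    [rho a = rho 0]. *)
Lemma loss_not_homogeneous (k A : R) : 0 <= k -> k < 1 -> 0 < A ->
  exists a, [/\ 0 < a, a < A & rho (k * a) < rho a].
Proof.
move=> k0 k1 A0; apply: contrapT => h.
have eqa a : 0 < a -> a < A -> rho a <= rho (k * a).
  by move=> a0 aA; rewrite leNgt; apply/negP => ha; apply: h; exists a.
pose a := A / 2.
have a0 : 0 < a by rewrite divr_gt0.
have aA : a < A by rewrite /a; lra.
have it n : rho a <= rho (k ^+ n * a).
  elim: n => [|n IH]; first by rewrite expr0 mul1r.
  apply: (le_trans IH); rewrite exprS -mulrA.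
  have [->|kn] := eqVneq (k ^+ n * a) 0; first by rewrite mulr0.
  apply: eqa.
    by rewrite lt_neqAle eq_sym kn mulr_ge0// ?exprn_ge0// ltW.
  by rewrite (le_lt_trans _ aA)// ler_piMl ?(ltW a0)// exprn_ile1// ltW.
have : rho (k ^+ n * a) @[n --> \oo] --> rho (0 * a).
  apply: (cvg_comp (fun n => k ^+ n * a) rho _ (@loss_cont _ _ rhoP _)).
  apply: cvgM; last exact: cvg_cst.
  by apply: cvg_expr; rewrite ger0_norm.
move=> /cvgr_to_ge => /(_ (rho a)) hle.
have : rho a <= rho (0 * a) by apply: hle; exact: nearW.
by rewrite mul0r (loss0 rhoP) leNgt loss_gt0.
Qed.

(** The losses at the two scales differ at one point near the centre
    ([loss_not_homogeneous]), hence by continuity on a box around it, which has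
    positive mass. *)
Lemma eloss_scale_strict (m : 'rV[R]_p) (V : 'M[R]_p) (t1 t2 : R) :
  (0 < p)%N -> positive_near H m -> posdef V -> 0 < t1 -> t1 < t2 ->
  eloss rho H (t1 *: homform m V) < eloss rho H (t2 *: homform m V).
Proof.
move=> p0 [r r0 Hr] pV t10 t12.
have t20 : 0 < t2 by exact: lt_trans t12.
pose i0 : 'I_p := Ordinal p0.
pose v := V i0 i0.
have v0 : 0 < v.
  rewrite /v -qform_delta; apply: pV.2; apply/eqP => /rowP/(_ i0).
  by rewrite !mxE !eqxx => /eqP; rewrite oner_eq0.
have t2v : 0 < t2 * v by exact: mulr_gt0.
have [a [a0 aA ha]] : exists a, [/\ 0 < a, a < t2 * v * r ^+ 2 &
    rho (t1 / t2 * a) < rho a].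
  apply: loss_not_homogeneous.
  - by rewrite divr_ge0// ltW.
  - by rewrite ltr_pdivrMr// mul1r.
  - by rewrite mulr_gt0// exprn_gt0.
pose s := Num.sqrt (a / (t2 * v)).
have s2 : s ^+ 2 = a / (t2 * v) by rewrite sqr_sqrtr// divr_ge0// ltW.
have sr : s < r.
  rewrite -(ltr_pXn2r (n := 2))// ?nnegrE ?sqrtr_ge0 ?(ltW r0)// s2.
  by rewrite ltr_pdivrMr// mulrC.
have s0 : 0 <= s by exact: sqrtr_ge0.
pose x : 'rV[R]_p := m + s *: delta_mx 0 i0.
pose Q := homform m V.
have qx : qform Q (homog x) = a / t2.
  rewrite homformE /x addrAC subrr add0r /qform linearZ/= -scalemxAr -!scalemxAl.
  rewrite 2!mxE mulrA -expr2 s2 -/(qform _ _) qform_delta -/v.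
  by field; rewrite !gt_eqF.
pose g y := qloss rho (t2 *: Q) y - qloss rho (t1 *: Q) y.
have gx : 0 < g x.
  rewrite /g /qloss !qformZ qx subr_gt0.
  have -> : t2 * (a / t2) = a by field; rewrite gt_eqF.
  by rewrite mulrA [t1 * a]mulrC -mulrA mulrC.
have pQ : psd Q by apply: homform_psd; exact: posdef_psd.
have g0 y : 0 <= g y.
  rewrite subr_ge0 /qloss !qformZ; apply: (loss_ge0_nondecr rhoP).
    by rewrite mulr_ge0 ?(ltW t10)//; exact: pQ.2.
  by rewrite ler_wpM2r ?(ltW t12)//; exact: pQ.2.
have gc : {for x, continuous g}.
  apply: continuousB.
  - apply: (@continuous_comp _ _ _ (fun y => qform (t2 *: Q) (homog y)) rho).
      exact: qform_homog_continuous.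
    exact: (loss_cont rhoP).
  - apply: (@continuous_comp _ _ _ (fun y => qform (t1 *: Q) (homog y)) rho).
      exact: qform_homog_continuous.
    exact: (loss_cont rhoP).
have [e e0 he] := box_continuous gc (divr_gt0 gx (ltr0n R 2)).
pose B := [set y : 'rV[R]_p | forall i, `|y 0 i - x 0 i| < e].
have mB : measurable B by exact: measurable_box.
have HB : (0 < H B)%E.
  apply: Hr => // i; rewrite !mxE addrAC subrr add0r eqxx /=.
  by case: (i == i0); rewrite ?mulr1 ?mulr0 ?normr0// ger0_norm.
rewrite -subr_gt0 /eloss -RintegralB//; [|exact: integrable_qloss..].
apply: (@lt_le_trans _ _ (\int[H]_y (g x / 2 * \1_B y))).
  have iB : H.-integrable setT (EFin \o (\1_B : 'rV[R]_p -> R)).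
    by apply: integrable_indic => //; exact: fin_num_fun_lty.
  rewrite RintegralZl// mulr_gt0 ?divr_gt0//.
  rewrite /Rintegral integral_indic// setIT fine_gt0// HB/=.
  exact: le_lt_trans (probability_le1 _ mB) (ltry 1).
apply: le_Rintegral => //.
- apply: (bounded_integrable (probability_lty H) (M := g x / 2)).
    by apply: measurable_realfun.measurable_funM => //; exact: measurable_indic.
  move=> y; rewrite normrM ger0_norm; last by rewrite divr_ge0// ltW.
  rewrite ler_piMr//; first by rewrite divr_ge0// ltW.
  by rewrite indicE; case: (_ \in _); rewrite ?normr1 ?normr0.
- exact: (integrableB measurableT (integrable_qloss rhoP H _) (integrable_qloss rhoP H _)).
move=> y _; rewrite -/(g y) indicE.
case: (boolP (y \in B)) => [|_]; last by rewrite mulr0.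
rewrite inE => /he; rewrite ltr_norml mulr1 => /andP[h _].
by lra.
Qed.

End strict_monotony.

(** * Consistency from near-optimality *)

Section ultrafilters.

(** Convergence can be tested along ultrafilters, along which every bounded
    sequence converges; this replaces the extraction of subsequences. *)
Lemma cvg_ultraP (T : Type) (Y : topologicalType) (F : set_system T)
    {FF : Filter F} (f : T -> Y) (l : Y) :
  (forall G, UltraFilter G -> G --> F -> f x @[x --> G] --> l) ->
  f x @[x --> F] --> l.
Proof.
move=> h B Bl; apply: contrapT => nFB.
pose F' := [set A | F [set x | ~ B (f x) -> A x]].
have F'E A : F' A = F [set x | ~ B (f x) -> A x] by [].
have F'P : ProperFilter F'.
  split.
    move=> F0; apply: nFB; change (F (f @^-1` B)).
    have {}F0 : F [set x | ~ B (f x) -> False] by exact: F0.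
    by apply: filterS F0 => x hx; apply: contrapT => /hx.
  split.
  - by rewrite F'E; apply: filterE.
  - move=> A A'; rewrite !F'E => FA FA'.
    by apply: filterS2 FA FA' => x h1 h2 nB; split; [exact: h1|exact: h2].
  - move=> A A' AA'; rewrite !F'E; apply: filterS => x h1 nB.
    by apply: AA'; exact: h1.
have [G [GU F'G]] := ultraFilterLemma F'P.
have GF : G --> F by move=> A FA; apply: F'G; rewrite F'E; apply: filterS FA => x Ax _.
have G1 : G (f @^-1` B) by exact: (h G GU GF).
have G2 : G (~` (f @^-1` B)) by apply: F'G; rewrite F'E; apply: filterE => x.
have GP : ProperFilter G by exact: ultra_proper.
by case: (@filter_not_empty _ G GP); rewrite -(setICr (f @^-1` B)); exact: filterI.
Qed.

Lemma ultra_bounded_cvg (R : realType) (T : Type) (G : set_system T)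
    {GU : UltraFilter G} (a : T -> R) (M : R) :
  (\forall x \near G, `|a x| <= M) -> exists l : R, a x @[x --> G] --> l.
Proof.
move=> aM.
have GP : ProperFilter G by exact: ultra_proper.
have KG : fmap a G `[- M, M]%classic.
  by apply: filterS aM => x ax; rewrite /preimage /= in_itv/= -ler_norml.
have [l [_ hl]] := @segment_compact R (- M) M (fmap a G) _ KG.
exists l => B Bl.
have [//|GB] := in_ultra_setVsetC (a @^-1` B) GU.
by have [y []] := hl (~` B) B GB Bl.
Qed.

Lemma ultra_mxcvg (R : realType) (T : Type) (G : set_system T)
    {GU : UltraFilter G} m n (A : T -> 'M[R]_(m, n)) (M : R) :
  (\forall x \near G, forall i j, `|A x i j| <= M) -> exists B, mxcvg G A B.
Proof.
move=> AM.
have h i j : exists l : R, A x i j @[x --> G] --> l.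
  by apply: (ultra_bounded_cvg (M := M)); apply: filterS AM.
exists (\matrix_(i, j) sval (cid (h i j))) => i j; rewrite mxE.
by case: cid.
Qed.

End ultrafilters.

Section population_scale.
Context (R : realType) (rho : R -> R) (rhoP : loss_function rho) (p : nat)
  (H : probability 'rV[R]_p R) (f : 'rV[R]_p -> R) (Hf : has_density H f)
  (c : nat -> R) (cp0 : 0 < c p).
Local Notation b := (tuning_b R).

Definition scale_loss (Q : 'M[R]_(1 + p)) (s : R) : R :=
  eloss rho H ((c p * s)^-1 *: Q).

Lemma pop_scaleE mu S : pop_scale rho c H mu S =
  inf (scales (scale_loss (homform mu (invmx S))) b).
Proof.
have lossE s : (\int[H]_x (rho (mahalanobis x mu S / (c p * s)))%:E =
    (scale_loss (homform mu (invmx S)) s)%:E)%E.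
  rewrite /scale_loss -elossE//; apply: eq_integral => x _.
  by rewrite /qloss qformZ mahalanobisE mulrC.
congr inf; apply/seteqP; split => s /= [s0 hs]; split => //.
  by apply: EFin_inj; rewrite -lossE.
by rewrite lossE hs.
Qed.

Variables (Q : 'M[R]_(1 + p)) (pQ : psd Q) (Q0 : Q != 0).

Lemma scale_loss_noninc s t : 0 < s -> s <= t -> scale_loss Q t <= scale_loss Q s.
Proof.
move=> s0 st; have t0 : 0 < t by exact: lt_le_trans st.
apply: eloss_scale_le => //; first by rewrite invr_ge0 mulr_ge0// ltW.
by rewrite lef_pV2 ?posrE ?mulr_gt0// ler_pM2l.
Qed.

Lemma scale_loss_cont s : 0 < s -> {for s, continuous (scale_loss Q)}.
Proof.
move=> s0.
apply: (@continuous_comp _ _ _ (fun s => (c p * s)^-1) (fun t => eloss rho H (t *: Q))).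
  apply: continuousV; first by rewrite mulf_neq0// gt_eqF.
  by apply: continuousM; [exact: cvg_cst|exact: cvg_id].
exact: eloss_scale_continuous.
Qed.

Lemma scale_loss_large a : a < 1 -> exists2 s, 0 < s & a < scale_loss Q s.
Proof.
move=> a1; have := eloss_scale_cvg1 rhoP Hf pQ Q0.
move=> /cvgrPdist_lt/(_ (1 - a)); rewrite subr_gt0 => /(_ a1)[n _ hn].
exists (c p * n.+1%:R)^-1; first by rewrite invr_gt0 mulr_gt0.
rewrite /scale_loss (_ : (_ * _)^-1 = n.+1%:R); last first.
  by rewrite invfM invrK mulrA mulVf ?mul1r// gt_eqF.
have := hn n.+1 (leqnSn n); rewrite /= ltr_norml => /andP[_].
by rewrite ltrBlDl -ltrBlDr opprB addrC subrK.
Qed.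

Lemma scale_loss_small a : 0 < a -> exists2 s, 0 < s & scale_loss Q s < a.
Proof.
move=> a0.
have := @eloss_scale_continuous _ _ rhoP _ H Q 0.
rewrite /continuous_at/= scale0r eloss0//.
move=> /cvgrPdist_lt/(_ _ a0)[d /= d0 hd].
exists (c p * (d / 2))^-1; first by rewrite invr_gt0 !mulr_gt0// divr_gt0.
rewrite /scale_loss (_ : (_ * _)^-1 = d / 2); last first.
  by rewrite invfM invrK mulrA mulVf ?mul1r// gt_eqF.
have := hd (d / 2); rewrite /= !sub0r !normrN => h.
apply: le_lt_trans (ler_norm _) _; apply: h.
by rewrite ger0_norm; [lra|rewrite divr_ge0// ltW].
Qed.

Let half_lt1 : b < 1. Proof. by rewrite /tuning_b invf_lt1 ?ltr1n. Qed.
Let half_gt0 : 0 < b. Proof. by rewrite /tuning_b invr_gt0. Qed.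

Local Notation sc := (inf (scales (scale_loss Q) b)).

Lemma pop_scale_sol : 0 < sc /\ scale_loss Q sc = b.
Proof.
have [s1 s10 h1] := scale_loss_large half_lt1.
have [s2 s20 h2] := scale_loss_small half_gt0.
have [s Ss _] := scales_neq0 scale_loss_noninc scale_loss_cont s10 s20 (ltW h1) (ltW h2).
apply: (inf_scales scale_loss_noninc scale_loss_cont Ss).
exact: (inf_scales_gt0 scale_loss_noninc s10 h1 Ss).
Qed.

Lemma pop_scale_le s : 0 < s -> scale_loss Q s <= b -> sc <= s.
Proof.
move=> s0 hs.
have [s1 s10 h1] := scale_loss_large half_lt1.
have [t St ts] := scales_neq0 scale_loss_noninc scale_loss_cont s10 s0 (ltW h1) hs.
by apply: le_trans ts; exact: scale_ge_inf.
Qed.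

Lemma scale_loss_gt s : 0 < s -> s < sc -> b < scale_loss Q s.
Proof.
by move=> s0; apply: contraTT; rewrite -!leNgt => /(pop_scale_le s0).
Qed.

End population_scale.

Section consistency_core.
Context (R : realType) (rho : R -> R) (rhoP : loss_function rho) (p : nat)
  (H : probability 'rV[R]_p R) (f : 'rV[R]_p -> R) (Hf : has_density H f)
  (c : nat -> R) (cp0 : 0 < c p).
Local Notation b := (tuning_b R).
Local Notation sloss := (scale_loss rho H c).
Local Notation aloss x Q s n := (average x (qloss rho ((c p * s)^-1 *: Q)) n).

Variables (mu0 : 'rV[R]_p) (V0 : 'M[R]_p) (sigma0 : R).
Hypothesis sigma0_gt0 : 0 < sigma0.
Hypothesis min_unique : forall m V, posdef V -> \det V = 1 ->
  (forall s, sigma0 < s -> sloss (homform m V) s <= b) -> m = mu0 /\ V = V0.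
Hypothesis sloss_gt : forall s, 0 < s -> s < sigma0 ->
  b < sloss (homform mu0 V0) s.
Hypothesis sloss_lt : forall s, sigma0 < s -> sloss (homform mu0 V0) s < b.

Variables (x : nat -> 'rV[R]_p) (m : nat -> 'rV[R]_p) (V : nat -> 'M[R]_p)
  (nu e : nat -> R).
Hypothesis x_typical : typical rho H x.
Hypothesis V_posdef : \forall n \near \oo, [/\ posdef (V n), \det (V n) = 1 & 0 < nu n].
Hypothesis e_cvg0 : e n @[n --> \oo] --> (0 : R).
Hypothesis near_optimal : forall s, sigma0 < s -> \forall n \near \oo,
  aloss x (homform (m n) (V n)) s n <= b + e n.
Hypothesis near_scale : \forall n \near \oo,
  `|aloss x (homform (m n) (V n)) (nu n) n - b| <= e n.

Section along_ultrafilter.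
Variables (G : set_system nat) (GU : UltraFilter G) (Goo : G --> \oo).

#[local] Instance ultra_properG : ProperFilter G.
Proof. exact: ultra_proper. Qed.

Let near_oo (A : set nat) : (\forall n \near \oo, A n) -> \forall n \near G, A n.
Proof. exact: Goo. Qed.

Let eG : e n @[n --> G] --> (0 : R).
Proof. exact: cvg_trans (cvg_app _ Goo) e_cvg0. Qed.

Lemma limit_near_optimal (Qn : nat -> 'M[R]_(1 + p)) (Q : 'M[R]_(1 + p)) :
  mxcvg G Qn Q ->
  (\forall n \near G, average x (qloss rho (Qn n)) n <= b + e n) ->
  eloss rho H Q <= b.
Proof.
move=> QnQ hle.
have h1 : average x (qloss rho (Qn n)) n @[n --> G] --> eloss rho H Q.
  exact: average_qloss_cvg.
have h2 : b + e n @[n --> G] --> b + 0 by apply: cvgD => //; exact: cvg_cst.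
by rewrite -[b]addr0; apply: ler_cvg_to h1 h2 hle.
Qed.

(** If the forms were unbounded, the normalised forms would have a nonzero limit
    [Q], and near-optimality would bound the expectation of [rho (N q)] by
    [b = 1/2] for all [N], whereas these expectations tend to 1. This excludes
    at once diverging centres and degenerating shapes. *)
Lemma forms_bounded : exists L, \forall n \near G, \tr (homform (m n) (V n)) <= L.
Proof.
apply: contrapT => unb.
have tr_gt L : \forall n \near G, L < \tr (homform (m n) (V n)).
  have [h|h] := in_ultra_setVsetC [set n | \tr (homform (m n) (V n)) <= L] GU.
    by exfalso; apply: unb; exists L.
  by apply: filterS h => n /= /negP; rewrite -ltNge.
pose tau n := \tr (homform (m n) (V n)).
pose Qh n := (tau n)^-1 *: homform (m n) (V n).
have psdQn : \forall n \near G, psd (homform (m n) (V n)).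
  apply: filterS (near_oo V_posdef) => n [pV _ _].
  by apply: homform_psd; exact: posdef_psd.
have psdQh : \forall n \near G, psd (Qh n) /\ \tr (Qh n) = 1.
  apply: filterS2 psdQn (tr_gt 0) => n [QT Q0] t0; split; last first.
    by rewrite /Qh linearZ/= mulVf// gt_eqF.
  split; first by rewrite /Qh linearZ/= QT.
  by move=> y; rewrite qformZ mulr_ge0// invr_ge0 ltW.
have [|Q QhQ] := @ultra_mxcvg R _ G GU _ _ Qh 1.
  apply: filterS psdQh => n [pQ t1] i j; rewrite -t1; exact: psd_entry_le_trace.
have trQ : \tr Q = 1.
  have h : \tr (Qh n) @[n --> G] --> \tr Q by apply: cvg_bigsum => i; exact: QhQ.
  have h1 : \tr (Qh n) @[n --> G] --> (1 : R).
    by apply: cvg_near_cst; apply: filterS psdQh => n [_ ->].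
  exact: cvg_unique h h1.
have pQ : psd Q.
  split.
    apply/matrixP => i j; rewrite mxE.
    apply: (cvg_unique _ (QhQ j i)) => //.
    apply: cvg_trans (QhQ i j); apply: near_eq_cvg.
    by apply: filterS psdQh => n [[QT _] _]; rewrite -{1}QT mxE.
  move=> y; have h : qform (Qh n) y @[n --> G] --> qform Q y.
    by apply: mxcvg_qform => //; exact: mxcvg_cst.
  by apply: (cvgr_to_ge h); apply: filterS psdQh => n [[_ +] _]; apply.
have Q0 : Q != 0.
  by apply/eqP => Q0; move: trQ; rewrite Q0 mxtrace0 => /eqP; rewrite eq_sym oner_eq0.
have s10 : 0 < sigma0 + 1 by rewrite addr_gt0.
have ss1 : sigma0 < sigma0 + 1 by rewrite ltrDl.
have le_half (N : nat) : eloss rho H (N%:R *: Q) <= b.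
  apply: (limit_near_optimal (Qn := fun n => N%:R *: Qh n)).
    by apply: mxcvg_scale => //; exact: cvg_cst.
  have h1 := near_oo (near_optimal ss1).
  have h2 := tr_gt (N%:R * (c p * (sigma0 + 1))).
  apply: filterS3 h1 h2 (filterI psdQn (tr_gt 0)) => n h1 h2 [pQn t0].
  apply: le_trans h1; apply: average_le => y.
  rewrite /qloss !qformZ; apply: (loss_ge0_nondecr rhoP).
    by rewrite !mulr_ge0// ?invr_ge0 ?(ltW t0)//; exact: pQn.2.
  rewrite mulrA ler_wpM2r//; first exact: pQn.2.
  rewrite ler_pdivrMr// ler_pdivlMl ?mulr_gt0// mulrC.
  exact: ltW.
have : 1 <= b.
  apply: (cvgr_to_le (eloss_scale_cvg1 rhoP Hf pQ Q0)); exact: nearW.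
by rewrite leNgt /tuning_b invf_lt1 ?ltr1n.
Qed.

(** The inverse shape and the centre are recovered from the blocks [V] and [- m V]
    of the form. Inverting [V] is continuous here because its determinant
    is 1. *)
Lemma core_cvg_ultra :
  [/\ mxcvg G m mu0, mxcvg G (fun n => invmx (V n)) (invmx V0) &
     nu n @[n --> G] --> sigma0].
Proof.
have [L trL] := forms_bounded.
have psdQn : \forall n \near G, psd (homform (m n) (V n)).
  apply: filterS (near_oo V_posdef) => n [pV _ _].
  by apply: homform_psd; exact: posdef_psd.
have entL : \forall n \near G, forall i j, `|homform (m n) (V n) i j| <= L.
  apply: filterS2 psdQn trL => n pQ tL i j.
  by apply: le_trans tL; exact: psd_entry_le_trace.
have drE (M : 'M[R]_(1 + p)) i j : drsubmx M i j = M (rshift 1 i) (rshift 1 j).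
  by rewrite !mxE.
have urE (M : 'M[R]_(1 + p)) i j : ursubmx M i j = M (lshift p i) (rshift 1 j).
  by rewrite !mxE.
have [|V1 VV1] := @ultra_mxcvg R _ G GU _ _ V L.
  apply: filterS entL => n h i j; rewrite -[V n](drsub_homform (m n)) drE; exact: h.
have [|W1 WW1] := @ultra_mxcvg R _ G GU _ _ (fun n => m n *m V n) L.
  apply: filterS entL => n h i j.
  rewrite -normrN (_ : - _ = ursubmx (homform (m n) (V n)) i j); last first.
    by rewrite ursub_homform [RHS]mxE.
  rewrite urE; exact: h.
have detV1 : \det V1 = 1.
  apply: (cvg_unique _ (mxcvg_det VV1)) => //.
  by apply: cvg_near_cst; apply: filterS (near_oo V_posdef) => n [_ -> _].
have uV1 : V1 \in unitmx by rewrite unitmxE detV1 unitr1.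
have pV1 : posdef V1.
  apply: psd_unit_posdef => //; split.
    apply/matrixP => i j; rewrite mxE.
    apply: (cvg_unique _ (VV1 j i)) => //.
    apply: cvg_trans (VV1 i j); apply: near_eq_cvg.
    by apply: filterS (near_oo V_posdef) => n [[QT _] _ _]; rewrite -{1}QT mxE.
  move=> y; have h : qform (V n) y @[n --> G] --> qform V1 y.
    by apply: mxcvg_qform => //; exact: mxcvg_cst.
  apply: (cvgr_to_ge h).
  by apply: filterS (near_oo V_posdef) => n [pV _ _]; exact: (posdef_psd pV).2.
have invE (A : 'M[R]_p) : \det A = 1 -> invmx A = \adj A.
  by move=> dA; rewrite /invmx unitmxE dA unitr1 invr1 scale1r.
have iVV1 : mxcvg G (fun n => invmx (V n)) (invmx V1).
  have adjV : mxcvg G (fun n => \adj (V n)) (\adj V1) by exact: mxcvg_adj.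
  move=> i j; rewrite invE//; apply: cvg_trans (adjV i j).
  apply: near_eq_cvg; apply: filterS (near_oo V_posdef) => n [_ dV _].
  by rewrite invE.
have mm1 : mxcvg G m (W1 *m invmx V1).
  have mulV : mxcvg G (fun n => m n *m V n *m invmx (V n)) (W1 *m invmx V1).
    exact: mxcvg_mul.
  move=> i j; apply: cvg_trans (mulV i j).
  apply: near_eq_cvg; apply: filterS (near_oo V_posdef) => n [pV _ _].
  by rewrite mulmxK//; exact: posdef_unit.
have QQ1 : mxcvg G (fun n => homform (m n) (V n)) (homform (W1 *m invmx V1) V1).
  exact: mxcvg_homform.
have aloss_cvg s : aloss x (homform (m n) (V n)) s n @[n --> G] -->
    sloss (homform (W1 *m invmx V1) V1) s.
  apply: average_qloss_cvg => //.
  by apply: mxcvg_scale => //; exact: cvg_cst.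
have [m1E V1E] : W1 *m invmx V1 = mu0 /\ V1 = V0.
  apply: min_unique => // s ss.
  apply: (limit_near_optimal (Qn := fun n => (c p * s)^-1 *: homform (m n) (V n))).
    by apply: mxcvg_scale => //; exact: cvg_cst.
  exact: near_oo (near_optimal ss).
rewrite m1E V1E in mm1 iVV1 aloss_cvg.
split => //.
have anti : \forall n \near G, forall s t, 0 < s -> s <= t ->
    aloss x (homform (m n) (V n)) t n <= aloss x (homform (m n) (V n)) s n.
  apply: filterS psdQn => n pQ s t s0 st; have t0 := lt_le_trans s0 st.
  apply: average_le => y; rewrite /qloss !qformZ; apply: (loss_ge0_nondecr rhoP).
    by rewrite mulr_ge0 ?invr_ge0 ?mulr_ge0 ?(ltW t0) ?(ltW cp0)//; exact: pQ.2.
  rewrite ler_wpM2r//; first exact: pQ.2.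
  by rewrite lef_pV2 ?posrE ?mulr_gt0// ler_pM2l.
apply/cvgrPdist_le => d d0.
(* a scale strictly between 0 and sigma0 at distance at most d *)
pose s1 := Num.max (sigma0 - d) (sigma0 / 2).
have s10 : 0 < s1 by rewrite lt_max (divr_gt0 sigma0_gt0)// orbT.
have s1s : s1 < sigma0.
  by rewrite gt_max gtrBl d0 ltr_pdivrMr// ltr_pMr// ltr1n.
have s2s : sigma0 < sigma0 + d by rewrite ltrDl.
pose g1 := sloss (homform mu0 V0) s1 - b.
pose g2 := b - sloss (homform mu0 V0) (sigma0 + d).
have g10 : 0 < g1 by rewrite subr_gt0 sloss_gt.
have g20 : 0 < g2 by rewrite subr_gt0 sloss_lt.
near=> n.
have nu0 : 0 < nu n by near: n; apply: filterS (near_oo V_posdef) => k [].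
have hn : `|aloss x (homform (m n) (V n)) (nu n) n - b| <= e n.
  by near: n; exact: near_oo near_scale.
have antin : forall s t, 0 < s -> s <= t ->
    aloss x (homform (m n) (V n)) t n <= aloss x (homform (m n) (V n)) s n.
  by near: n.
have e1 : `|0 - e n| < g1 / 2.
  by near: n; move/cvgrPdist_lt : eG; apply; exact: divr_gt0.
have e2 : `|0 - e n| < g2 / 2.
  by near: n; move/cvgrPdist_lt : eG; apply; exact: divr_gt0.
have a1 : `|sloss (homform mu0 V0) s1 - aloss x (homform (m n) (V n)) s1 n| < g1 / 2.
  by near: n; move/cvgrPdist_lt : (aloss_cvg s1); apply; exact: divr_gt0.
have a2 : `|sloss (homform mu0 V0) (sigma0 + d) -
    aloss x (homform (m n) (V n)) (sigma0 + d) n| < g2 / 2.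
  by near: n; move/cvgrPdist_lt : (aloss_cvg (sigma0 + d)); apply; exact: divr_gt0.
have lo : sigma0 - d <= nu n.
  apply: (@le_trans _ _ s1); first by rewrite le_max lexx.
  rewrite leNgt; apply/negP => lt1.
  have := antin _ _ nu0 (ltW lt1).
  move: e1 a1 hn; rewrite /g1 sub0r normrN !ltr_norml ler_norml.
  by move=> /andP[? ?] /andP[? ?] /andP[? ?] ?; lra.
have up : nu n <= sigma0 + d.
  rewrite leNgt; apply/negP => lt2.
  have := antin _ _ (lt_trans sigma0_gt0 s2s) (ltW lt2).
  move: e2 a2 hn; rewrite /g2 sub0r normrN !ltr_norml ler_norml.
  by move=> /andP[? ?] /andP[? ?] /andP[? ?] ?; lra.
by rewrite ler_distl; apply/andP; split; lra.
Unshelve. all: by end_near. Qed.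

End along_ultrafilter.

Lemma consistency_core :
  [/\ mxcvg \oo m mu0, mxcvg \oo (fun n => invmx (V n)) (invmx V0) &
     nu n @[n --> \oo] --> sigma0].
Proof.
split.
- by move=> i j; apply: cvg_ultraP => G GU Goo; have [+ _ _] := core_cvg_ultra GU Goo; apply.
- by move=> i j; apply: cvg_ultraP => G GU Goo; have [_ + _] := core_cvg_ultra GU Goo; apply.
- by apply: cvg_ultraP => G GU Goo; have [_ _] := core_cvg_ultra GU Goo; apply.
Qed.

End consistency_core.

(** * The equation of the generalized scale *)

Section determinant_root.
Context (R : realType).

Definition det_root k (C : 'M[R]_k) : R := \det C `^ k%:R^-1.

Lemma det_root_gt0 k (C : 'M[R]_k) : posdef C -> 0 < det_root C.
Proof. by move=> /posdef_det_gt0; exact: powR_gt0. Qed.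

Lemma det_rootX k (C : 'M[R]_k) : (0 < k)%N -> posdef C ->
  det_root C ^+ k = \det C.
Proof.
move=> k0 /posdef_det_gt0 d0; rewrite /det_root -powR_mulrn ?powR_ge0// -powRrM.
by rewrite mulVf ?pnatr_eq0 -?lt0n// powRr1// ltW.
Qed.

Lemma det_rootZ k (C : 'M[R]_k) (a : R) : (0 < k)%N -> 0 < a -> posdef C ->
  det_root (a *: C) = a * det_root C.
Proof.
move=> k0 a0 /posdef_det_gt0 d0; rewrite /det_root detZ powRM ?exprn_ge0 ?ltW//.
rewrite -powR_mulrn ?(ltW a0)// -powRrM mulfV ?pnatr_eq0 -?lt0n// powRr1//.
exact: ltW.
Qed.

Lemma det_root1 k (C : 'M[R]_k) : \det C = 1 -> det_root C = 1.
Proof. by move=> dC; rewrite /det_root dC powR1. Qed.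

Lemma mahalanobis_starZ k (x m : 'rV[R]_k) (C : 'M[R]_k) (a : R) : (0 < k)%N ->
  0 < a -> posdef C -> mahalanobis_star x m (a *: C) = mahalanobis_star x m C.
Proof.
move=> k0 a0 pC; rewrite /mahalanobis_star -!/(det_root _) det_rootZ// scalerA.
by rewrite invfM mulrAC mulVf ?mul1r// gt_eqF.
Qed.

Lemma mahalanobis_starE k (x m : 'rV[R]_k) (C : 'M[R]_k) : posdef C ->
  mahalanobis_star x m C = qform (homform m (det_root C *: invmx C)) (homog x).
Proof.
move=> pC; have r0 := det_root_gt0 pC.
rewrite /mahalanobis_star mahalanobisE invmxZ ?invrK// posdef_unit//.
by apply: posdefZ => //; rewrite invr_gt0.
Qed.

(** In a complete case the selection of the observed coordinates is bijective;
    it permutes them, which affects neither the distance nor the determinant. *)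
Lemma mahalanobis_star_reindex k l (g : 'I_k -> 'I_l) (x m : 'rV[R]_l)
    (C : 'M[R]_l) : k = l -> injective g -> posdef C ->
  mahalanobis_star (colsub g x) (colsub g m) (mxsub g g C) =
    mahalanobis_star x m C /\ det_root (mxsub g g C) = det_root C.
Proof.
move=> kl; case: l / kl g x m C => g x m C gI pC.
pose P : 'M[R]_k := (perm_mx (perm gI))^T.
have PE : P = perm_mx (perm gI)^-1%g by rewrite /P tr_perm_mx.
have PPT : P *m P^T = 1%:M by rewrite PE tr_perm_mx -perm_mxM mulgV perm_mx1.
have PTP : P^T *m P = 1%:M by rewrite PE tr_perm_mx -perm_mxM mulVg perm_mx1.
have colE (y : 'rV[R]_k) : colsub g y = y *m P.
  rewrite PE -[RHS]col_permE; apply/matrixP => i j; rewrite !mxE.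
  by rewrite permE.
have subE (A : 'M[R]_k) : mxsub g g A = P^T *m A *m P.
  rewrite PE tr_perm_mx invgK -row_permE -[RHS]col_permE.
  by apply/matrixP => i j; rewrite !mxE !permE.
have detE : \det (mxsub g g C) = \det C.
  rewrite subE !det_mulmx mulrAC -det_mulmx PTP det1 mul1r//.
split; last by rewrite /det_root detE.
have uC := posdef_unit pC.
have invE : invmx (mxsub g g C) = P^T *m invmx C *m P.
  have h : mxsub g g C *m (P^T *m invmx C *m P) = 1%:M.
    rewrite subE -!mulmxA [P *m (P^T *m _)]mulmxA PPT mul1mx.
    by rewrite [C *m _]mulmxA mulmxV// mul1mx PTP.
  have [u _] := mulmx1_unit h.
  by rewrite -[RHS](mulKmx u) h mulmx1.
rewrite !mahalanobis_starE//; last exact: posdef_mxsub.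
rewrite !homformE !qformZ /det_root detE invE; congr (_ * _).
have PPTK r (A : 'M[R]_(r, k)) : A *m P *m P^T = A by rewrite -mulmxA PPT mulmx1.
by rewrite !colE -mulmxBl /qform trmx_mul !mulmxA !PPTK.
Qed.

End determinant_root.

Section generalized_scale.
Context (R : realType) (rho : R -> R) (rhoP : loss_function rho) (p n : nat)
  (c : nat -> R) (p0 : (0 < p)%N)
  (c_gt0 : forall k, (1 <= k <= p)%N -> 0 < c k)
  (X : 'M[R]_(n, p)) (U : 'I_n -> {set 'I_p}).
Local Notation b := (tuning_b R).

Let observed (i : 'I_n) := (0 < #|U i|)%N.

Let card_le_dim i : (#|U i| <= p)%N.
Proof. by rewrite (leq_trans (max_card _))// card_ord. Qed.

Let c_obs i : observed i -> 0 < c #|U i|.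
Proof.
by move=> oi; apply: c_gt0; apply/andP; split => //; exact: card_le_dim.
Qed.

(** The left-hand side of the equation of the generalized scale; separating the
    distances [a] from the weights [w] allows the constraint and the objective,
    which differ in [w] only, to be treated together. *)
Definition weighted_loss (a w : 'I_n -> R) (s : R) : R :=
  \sum_(i < n | (0 < #|U i|)%N) c #|U i| * rho (a i / (s * c #|U i| * w i)).

Definition total_weight : R := b * \sum_(i < n | (0 < #|U i|)%N) c #|U i|.

Definition GS_dist (mu : 'rV[R]_p) (S : 'M[R]_p) (i : 'I_n) : R :=
  mahalanobis_star (subvec (U i) (row i X)) (subvec (U i) mu) (submat (U i) S).

Definition GS_weight (Om : 'M[R]_p) (i : 'I_n) : R := det_root (submat (U i) Om).

Lemma GS_scaleE mu S Om : GS_scale rho c X U mu S Om =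
  inf (scales (weighted_loss (GS_dist mu S) (GS_weight Om)) total_weight).
Proof. by []. Qed.

Lemma GS_scale_solvable mu S Om : GS_scale rho c X U mu S Om = 1 ->
  exists s, scales (weighted_loss (GS_dist mu S) (GS_weight Om)) total_weight s.
Proof.
rewrite GS_scaleE => scale1; apply/set0P/negP => /eqP E.
by move: scale1; rewrite E inf0 => /eqP; rewrite eq_sym oner_eq0.
Qed.

Lemma submat_posdef (S : 'M[R]_p) (u : {set 'I_p}) : posdef S -> posdef (submat u S).
Proof. by apply: posdef_mxsub; exact: enum_val_inj. Qed.

Lemma GS_weight_gt0 Om i : posdef Om -> 0 < GS_weight Om i.
Proof. by move=> pOm; apply: det_root_gt0; exact: submat_posdef. Qed.

Lemma GS_weightZ Om a i : observed i -> 0 < a -> posdef Om ->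
  GS_weight (a *: Om) i = a * GS_weight Om i.
Proof.
move=> i0 a0 pOm; rewrite /GS_weight.
have -> : submat (U i) (a *: Om) = a *: submat (U i) Om.
  by apply/matrixP => k l; rewrite !mxE.
by rewrite det_rootZ//; exact: submat_posdef.
Qed.

Lemma GS_distZ mu S a i : observed i -> 0 < a -> posdef S ->
  GS_dist mu (a *: S) i = GS_dist mu S i.
Proof.
move=> i0 a0 pS; rewrite /GS_dist.
have -> : submat (U i) (a *: S) = a *: submat (U i) S.
  by apply/matrixP => k l; rewrite !mxE.
by rewrite mahalanobis_starZ//; exact: submat_posdef.
Qed.

Lemma weighted_loss_le a w w' s s' :
  (forall i, observed i -> 0 < s * w i /\ s * w i <= s' * w' i) ->
  weighted_loss a w' s' <= weighted_loss a w s.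
Proof.
move=> h; apply: ler_sum => i oi; have [sw0 le] := h i oi.
have ci := c_obs oi.
apply: ler_wpM2l; first exact: ltW.
apply: (loss_nondecr rhoP); rewrite !normrM ler_wpM2l//.
have e1 (t v : R) : t * c #|U i| * v = c #|U i| * (t * v) by ring.
rewrite !e1 !ger0_norm ?invr_ge0; last 2 first.
- by rewrite mulr_ge0// ltW.
- by rewrite mulr_ge0 ?(ltW ci)// (le_trans (ltW sw0)).
have sw1 : 0 < s' * w' i by exact: lt_le_trans le.
by rewrite lef_pV2 ?posrE ?(mulr_gt0 ci)// ler_pM2l.
Qed.

Lemma weighted_loss_noninc a w : (forall i, 0 < w i) ->
  forall s t, 0 < s -> s <= t -> weighted_loss a w t <= weighted_loss a w s.
Proof.
move=> w0 s t s0 st; apply: weighted_loss_le => i _.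
by split; [exact: mulr_gt0|rewrite ler_wpM2r// ltW//].
Qed.

Lemma weighted_loss_cont a w : (forall i, 0 < w i) ->
  forall s : R, 0 < s -> {for s, continuous (weighted_loss a w)}.
Proof.
move=> w0 s s0.
have -> : weighted_loss a w = fun s => \sum_(i < n) if (0 < #|U i|)%N then
    c #|U i| * rho (a i / (s * c #|U i| * w i)) else 0.
  by apply/funext => t; rewrite /weighted_loss big_mkcond.
apply: cvg_bigsum => i; case: ifPn => oi; last exact: cvg_cst.
apply: cvgM; first exact: cvg_cst.
have h : {for s, continuous (fun s : R => a i / (s * c #|U i| * w i))}.
  apply: continuousM; first exact: cvg_cst.
  apply: continuousV; first by rewrite !mulf_neq0// gt_eqF// c_obs.
  apply: continuousM; last exact: cvg_cst.
  by apply: continuousM; [exact: cvg_id|exact: cvg_cst].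
exact: (cvg_comp _ _ h (@loss_cont _ _ rhoP _)).
Qed.

(** Whether the equation has a solution does not depend on the weights: each
    term at a scale [s] is dominated by, or dominates, the corresponding term
    for other weights once the other scale is small, or large, enough. *)
Lemma weighted_loss_solvable a w w' s : (forall i, 0 < w i) ->
  (forall i, 0 < w' i) -> scales (weighted_loss a w) total_weight s ->
  exists s', scales (weighted_loss a w') total_weight s'.
Proof.
move=> w0 w'0 [s0 hs].
have sum_ge (F : 'I_n -> R) i : (forall i, 0 < F i) -> F i <= 1 + \sum_j F j.
  move=> F0; rewrite (bigD1 i)//= addrCA lerDl addr_ge0// sumr_ge0// => j _.
  exact: ltW.
have sum_gt0 (F : 'I_n -> R) : (forall i, 0 < F i) -> 0 < 1 + \sum_j F j.
  by move=> F0; rewrite ltr_pwDl// sumr_ge0// => j _; exact: ltW.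
have F0 i : 0 < w' i / (s * w i) by rewrite divr_gt0// mulr_gt0.
have G0 i : 0 < s * w i / w' i by rewrite divr_gt0// mulr_gt0.
pose lo := (1 + \sum_j w' j / (s * w j))^-1.
pose hi := 1 + \sum_j s * w j / w' j.
have lo0 : 0 < lo by rewrite invr_gt0 sum_gt0.
have hi0 : 0 < hi by exact: sum_gt0.
have h1 : total_weight <= weighted_loss a w' lo.
  rewrite -hs; apply: weighted_loss_le => i _; split; first exact: mulr_gt0.
  rewrite ler_pdivrMl ?sum_gt0// -ler_pdivrMr ?mulr_gt0//.
  exact: (sum_ge (fun j => w' j / (s * w j))).
have h2 : weighted_loss a w' hi <= total_weight.
  rewrite -hs; apply: weighted_loss_le => i _; split; first exact: mulr_gt0.
  by rewrite -ler_pdivrMr//; exact: (sum_ge (fun j => s * w j / w' j)).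
have [s' Ss' _] := scales_neq0 (@weighted_loss_noninc a _ w'0)
  (@weighted_loss_cont a _ w'0) lo0 hi0 h1 h2.
by exists s'.
Qed.

Lemma weighted_lossZ a w r s : weighted_loss a (fun i => r * w i) s =
  weighted_loss a w (r * s).
Proof. by apply: eq_bigr => i _; congr (_ * rho (_ / _)); ring. Qed.

Lemma eq_weighted_loss a a' w w' s :
  (forall i, observed i -> a i = a' i) -> (forall i, observed i -> w i = w' i) ->
  weighted_loss a w s = weighted_loss a' w' s.
Proof. by move=> aa' ww'; apply: eq_bigr => i oi; rewrite aa'// ww'. Qed.

Lemma GS_scale_shapeZ mu S Om a : 0 < a -> posdef S ->
  GS_scale rho c X U mu (a *: S) Om = GS_scale rho c X U mu S Om.
Proof.
move=> a0 pS; rewrite !GS_scaleE; congr (inf (scales _ _)); apply/funext => s.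
by apply: eq_weighted_loss => // i oi; rewrite GS_distZ.
Qed.

(** Every shape can be rescaled so as to meet the constraint, because the
    equation involves the scale and the weights only through their products. *)
Lemma GS_scale_normalise mu S : posdef S ->
  let s := GS_scale rho c X U mu S S in
  scales (weighted_loss (GS_dist mu S) (GS_weight S)) total_weight s ->
  GS_scale rho c X U mu (s *: S) (s *: S) = 1.
Proof.
move=> pS s [s0 hs].
rewrite GS_scale_shapeZ// GS_scaleE.
have E : weighted_loss (GS_dist mu S) (GS_weight (s *: S)) =
    fun t => weighted_loss (GS_dist mu S) (GS_weight S) (s * t).
  apply/funext => t; rewrite -weighted_lossZ.
  by apply: eq_weighted_loss => // i oi; rewrite GS_weightZ.
rewrite E.
have S1 : scales (fun t => weighted_loss (GS_dist mu S) (GS_weight S) (s * t))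
    total_weight 1 by split => //; rewrite mulr1.
apply/eqP; rewrite eq_le (scale_ge_inf S1)/=.
apply: lb_le_inf; first by exists 1.
move=> t [t0 ht]; rewrite -(ler_pM2l s0) mulr1.
by apply: scale_ge_inf; split => //; exact: mulr_gt0.
Qed.

Definition case_bound : R := \sum_(k < p.+1) `|c k| + c p.

(** The equation of the generalized scale is that of the complete-data scale up
    to the incomplete cases, each of which changes one bounded term. *)
Lemma weighted_loss_complete (mu : 'rV[R]_p) (S Om : 'M[R]_p) (s : R) :
  posdef S -> posdef Om -> 0 < s ->
  `|weighted_loss (GS_dist mu S) (GS_weight Om) s - total_weight -
    c p * \sum_(i < n) (qloss rho ((c p * (s * det_root Om))^-1 *:
      homform mu (det_root S *: invmx S)) (row i X) - b)|
  <= case_bound * #|[pred i : 'I_n | #|U i| != p]|%:R.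
Proof.
move=> pS pOm s0.
have cp0 : 0 < c p by apply: c_gt0; rewrite p0 leqnn.
rewrite /weighted_loss /total_weight mulr_sumr -sumrB [X in X - _]big_mkcond/=.
rewrite mulr_sumr -sumrB.
apply: le_trans (ler_norm_sum _ _ _) _.
rewrite mulr_natr -sumr_const [leRHS]big_mkcond/=.
apply: ler_sum => i _; rewrite inE /=.
have half01 (t : R) : 0 <= t -> t <= 1 -> `|t - b| <= 1.
  by move=> ? ?; rewrite ler_norml /tuning_b; apply/andP; split; lra.
case: eqP => [Ui|/eqP Uip] /=.
  have oi : (0 < #|U i|)%N by rewrite Ui.
  rewrite oi.
  have [dE wE] := mahalanobis_star_reindex (row i X) mu Ui
    (@enum_val_inj _ (mem (U i))) pS.
  have [_ omE] := mahalanobis_star_reindex (row i X) mu Ui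
    (@enum_val_inj _ (mem (U i))) pOm.
  rewrite /GS_dist /GS_weight /subvec /submat dE omE Ui mahalanobis_starE//.
  rewrite /qloss qformZ.
  set q := qform _ _.
  rewrite (_ : q / _ = (c p * (s * det_root Om))^-1 * q); last first.
    by rewrite mulrC; congr (_^-1 * _); ring.
  by rewrite le_eqVlt; apply/orP; left; apply/eqP/normr0P/eqP; ring.
rewrite /case_bound (le_trans (ler_normB _ _))// lerD//.
  case: ifPn => oi; last by rewrite normr0 sumr_ge0.
  rewrite [b * _]mulrC -mulrBr normrM.
  have Up : (#|U i| < p.+1)%N by rewrite ltnS.
  rewrite (bigD1 (Ordinal Up))//= (@le_trans _ _ `|c (#|U i|)|)//; last first.
    by rewrite lerDl sumr_ge0.
  by rewrite ler_piMr// half01// ?(loss_ge0 rhoP) ?(loss_le1 rhoP).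
rewrite normrM ger0_norm ?(ltW cp0)// ler_piMr ?(ltW cp0)// half01//.
  exact: loss_ge0.
exact: loss_le1.
Qed.

End generalized_scale.

(** * Consistency along a sample path *)

Section sample_path.
Context (R : realType) (rho : R -> R) (rhoP : loss_function rho) (p : nat)
  (p0 : (0 < p)%N) (c : nat -> R)
  (c_gt0 : forall k, (1 <= k <= p)%N -> 0 < c k).
Local Notation b := (tuning_b R).
Local Notation aloss x Q s n := (average x (qloss rho ((c p * s)^-1 *: Q)) n).

Let cp0 : 0 < c p. Proof. by apply: c_gt0; rewrite p0 leqnn. Qed.

Definition complete_fraction n (U : 'I_n -> {set 'I_p}) : R :=
  #|[pred i | #|U i| == p]|%:R / n%:R.

Definition incomplete_error n (U : 'I_n -> {set 'I_p}) : R :=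
  case_bound p c / c p * (1 - complete_fraction U).

Section fixed_sample.
Context (x : nat -> 'rV[R]_p) (n : nat) (n0 : (0 < n)%N)
  (U : 'I_n -> {set 'I_p}) (mu : 'rV[R]_p) (S Om : 'M[R]_p)
  (pS : posdef S) (pOm : posdef Om).
Local Notation X := (data_matrix x n).
Local Notation wloss := (weighted_loss rho c U (GS_dist X U mu S) (GS_weight U Om)).
Local Notation Q := (homform mu (det_root S *: invmx S)).
Local Notation e := (incomplete_error U).

(** The factor [|Omega|^(1/p)] is absorbed by the scale and [|S|^(1/p)] by the
    form, which leaves an average loss over the whole sample to compare with. *)
Lemma wloss_average s : 0 < s ->
  `|wloss s - total_weight c U - n%:R * c p * (aloss x Q (s * det_root Om) n - b)|
  <= n%:R * c p * e.
Proof.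
move=> s0; have nR : n%:R != 0 :> R by rewrite pnatr_eq0 -lt0n.
have := weighted_loss_complete rhoP p0 c_gt0 X U mu pS pOm s0.
have -> : \sum_(i < n) (qloss rho ((c p * (s * det_root Om))^-1 *: Q) (row i X) - b) =
    n%:R * (aloss x Q (s * det_root Om) n - b).
  rewrite sumrB sumr_const card_ord mulrBr -[b *+ n]mulr_natl; congr (_ - _).
  rewrite /average [RHS]mulrCA divff// mulr1; apply: eq_bigr => i _; congr qloss.
  by apply/rowP => j; rewrite !mxE.
rewrite mulrA [c p * _]mulrC => h; apply: (le_trans h).
have -> : #|[pred i : 'I_n | #|U i| != p]|%:R = n%:R * (1 - complete_fraction U).
  rewrite /complete_fraction mulrBr mulr1 mulrCA divff// mulr1.
  apply/eqP; rewrite eq_sym subr_eq -natrD; apply/eqP; congr (_%:R).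
  rewrite addnC -[LHS]card_ord -(cardC [pred i : 'I_n | #|U i| == p]).
  by congr (_ + _)%N; apply: eq_card => i; rewrite !inE.
rewrite le_eqVlt; apply/orP; left; apply/eqP; rewrite /incomplete_error.
by field; rewrite gt_eqF.
Qed.

Let ncp0 : 0 < n%:R * c p. Proof. by rewrite mulr_gt0// ltr0n. Qed.

Lemma wloss_le_average s : 0 < s -> wloss s <= total_weight c U ->
  aloss x Q (s * det_root Om) n <= b + e.
Proof.
move=> s0 h; have := wloss_average s0; rewrite ler_norml => /andP[h2 _].
rewrite -lerBlDl -(ler_pM2l ncp0).
set A := n%:R * c p * (_ - _) in h2 *; lra.
Qed.

Lemma wloss_eq_average s : 0 < s -> wloss s = total_weight c U ->
  `|aloss x Q (s * det_root Om) n - b| <= e.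
Proof.
move=> s0 h; have := wloss_average s0; rewrite h subrr sub0r normrN normrM.
by rewrite gtr0_norm// ler_pM2l.
Qed.

Lemma average_lt_wloss s : 0 < s -> aloss x Q (s * det_root Om) n < b - e ->
  wloss s <= total_weight c U.
Proof.
move=> s0 h; have := wloss_average s0; rewrite ler_norml => /andP[_ h2].
have h3 : n%:R * c p * (aloss x Q (s * det_root Om) n - b) < n%:R * c p * (- e).
  by rewrite ltr_pM2l// ltrBlDl.
set A := n%:R * c p * (_ - _) in h2 h3; rewrite mulrN in h3; lra.
Qed.

Lemma average_gt_wloss s : 0 < s -> b + e < aloss x Q (s * det_root Om) n ->
  total_weight c U < wloss s.
Proof.
move=> s0 h; have := wloss_average s0; rewrite ler_norml => /andP[h2 _].
have h3 : n%:R * c p * e < n%:R * c p * (aloss x Q (s * det_root Om) n - b).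
  by rewrite ltr_pM2l// ltrBrDl.
set A := n%:R * c p * (_ - _) in h2 h3; lra.
Qed.

Lemma wloss_noninc s t : 0 < s -> s <= t -> wloss t <= wloss s.
Proof.
by apply: (weighted_loss_noninc rhoP c_gt0) => i; exact: GS_weight_gt0.
Qed.

Lemma wloss_cont (s : R) : 0 < s -> {for s, continuous wloss}.
Proof.
by apply: (weighted_loss_cont rhoP c_gt0) => i; exact: GS_weight_gt0.
Qed.

(** Two scales at which the average loss differs from [b] by more than the error
    due to the incomplete cases enclose a solution, by the intermediate value
    theorem. *)
Lemma wloss_solution s1 s2 : 0 < s1 -> 0 < s2 ->
  b + e < aloss x Q s1 n -> aloss x Q s2 n < b - e ->
  scales wloss (total_weight c U) (GS_scale rho c X U mu S Om) /\
  GS_scale rho c X U mu S Om <= s2 / det_root Om.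
Proof.
move=> s10 s20 h1 h2; have r0 := det_root_gt0 pOm; have rn : det_root Om != 0 by rewrite gt_eqF.
have t10 : 0 < s1 / det_root Om by exact: divr_gt0.
have t20 : 0 < s2 / det_root Om by exact: divr_gt0.
have w1 : total_weight c U < wloss (s1 / det_root Om).
  by apply: average_gt_wloss => //; rewrite divfK.
have w2 : wloss (s2 / det_root Om) <= total_weight c U.
  by apply: average_lt_wloss => //; rewrite divfK.
have [t St ts] := scales_neq0 wloss_noninc wloss_cont t10 t20 (ltW w1) w2.
split; last by apply: le_trans ts; exact: scale_ge_inf.
apply: (inf_scales wloss_noninc wloss_cont St).
exact: (inf_scales_gt0 wloss_noninc t10 w1 St).
Qed.

End fixed_sample.

Context (H : probability 'rV[R]_p R) (f : 'rV[R]_p -> R) (Hf : has_density H f).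
Local Notation sloss := (scale_loss rho H c).

Variables (mu0 : 'rV[R]_p) (S00 : 'M[R]_p) (sigma0 : R).
Hypothesis pS00 : posdef S00.
Hypothesis detS00 : \det S00 = 1.
Hypothesis sigma0_gt0 : 0 < sigma0.
Hypothesis min_unique : forall m V, posdef V -> \det V = 1 ->
  (forall s, sigma0 < s -> sloss (homform m V) s <= b) -> m = mu0 /\ V = invmx S00.
Hypothesis sloss_gt : forall s, 0 < s -> s < sigma0 ->
  b < sloss (homform mu0 (invmx S00)) s.
Hypothesis sloss_lt : forall s, sigma0 < s -> sloss (homform mu0 (invmx S00)) s < b.

Variables (x : nat -> 'rV[R]_p) (U : forall n, 'I_n -> {set 'I_p})
  (Om : nat -> 'M[R]_p) (mu : nat -> 'rV[R]_p) (S : nat -> 'M[R]_p).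
Arguments U : clear implicits.
Hypothesis x_typical : typical rho H x.
Hypothesis complete_cvg : complete_fraction (U n) @[n --> \oo] --> (1 : R).
Hypothesis Om_posdef : \forall n \near \oo, posdef (Om n).
Hypothesis GS_min : \forall n \near \oo,
  GS_estimators rho c (data_matrix x n) (U n) (Om n) (mu n, S n).

Let e n := incomplete_error (U n).
Let nu n := det_root (S n).
Let V n := nu n *: invmx (S n).
Let Q0 := homform mu0 (invmx S00).

Let e_cvg0 : e n @[n --> \oo] --> (0 : R).
Proof.
have : case_bound p c / c p * (1 - complete_fraction (U n)) @[n --> \oo] -->
    case_bound p c / c p * (1 - 1).
  by apply: cvgM; [exact: cvg_cst|apply: cvgB; [exact: cvg_cst|]].
by rewrite subrr mulr0.
Qed.

Let aloss0_cvg s : aloss x Q0 s n @[n --> \oo] --> sloss Q0 s.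
Proof. by apply: average_qloss_cvg => // i j; exact: cvg_cst. Qed.

Let aloss0_gt s : 0 < s -> s < sigma0 -> \forall n \near \oo, b + e n < aloss x Q0 s n.
Proof.
move=> s0 ss; have g0 : 0 < (sloss Q0 s - b) / 2 by rewrite divr_gt0// subr_gt0 sloss_gt.
near=> n.
have h1 : `|0 - e n| < (sloss Q0 s - b) / 2.
  by near: n; move/cvgrPdist_lt : e_cvg0; apply.
have h2 : `|sloss Q0 s - aloss x Q0 s n| < (sloss Q0 s - b) / 2.
  by near: n; move/cvgrPdist_lt : (@aloss0_cvg s); apply.
move: h1 h2; rewrite sub0r normrN !ltr_norml => /andP[? ?] /andP[? ?]; lra.
Unshelve. all: by end_near. Qed.

Let aloss0_lt s : sigma0 < s -> \forall n \near \oo, aloss x Q0 s n < b - e n.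
Proof.
move=> ss; have g0 : 0 < (b - sloss Q0 s) / 2 by rewrite divr_gt0// subr_gt0 sloss_lt.
near=> n.
have h1 : `|0 - e n| < (b - sloss Q0 s) / 2.
  by near: n; move/cvgrPdist_lt : e_cvg0; apply.
have h2 : `|sloss Q0 s - aloss x Q0 s n| < (b - sloss Q0 s) / 2.
  by near: n; move/cvgrPdist_lt : (@aloss0_cvg s); apply.
move: h1 h2; rewrite sub0r normrN !ltr_norml => /andP[? ?] /andP[? ?]; lra.
Unshelve. all: by end_near. Qed.

Let S_posdef : \forall n \near \oo, posdef (S n).
Proof. by apply: filterS GS_min => n [[]]. Qed.

(** The population minimiser, rescaled to meet the constraint, is a competitor,
    and for any [s2] above [sigma0] its objective value is eventually at most
    [s2 / |Omega|^(1/p)]. *)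
Let near_optimal s : sigma0 < s -> \forall n \near \oo,
  aloss x (homform (mu n) (V n)) s n <= b + e n.
Proof.
move=> ss.
pose s1 := sigma0 / 2; pose s2 := (sigma0 + s) / 2.
have s10 : 0 < s1 by rewrite divr_gt0.
have s1s : s1 < sigma0 by rewrite ltr_pdivrMr// ltr_pMr// ltr1n.
have [s2s s2s'] := midf_lt ss.
have s20 : 0 < s2 by exact: lt_trans s2s.
near=> n.
have n0 : (0 < n)%N by near: n; exists 1%N.
have pOm : posdef (Om n) by near: n.
have pS : posdef (S n) by near: n.
have h1 : b + e n < aloss x Q0 s1 n by near: n; exact: aloss0_gt.
have h2 : aloss x Q0 s2 n < b - e n by near: n; exact: aloss0_lt.
have [[_ /= feas] opt] : GS_estimators rho c (data_matrix x n) (U n) (Om n) (mu n, S n).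
  by near: n.
have r1 : det_root S00 *: invmx S00 = invmx S00 by rewrite det_root1// scale1r.
have wsol Om' (pOm' : posdef Om') := @wloss_solution x n n0 (U n) mu0 S00 Om' pS00 pOm' s1 s2 s10 s20.
rewrite r1 in wsol.
have [feas0 _] := wsol _ pS00 h1 h2.
have [_ obj0] := wsol _ pOm h1 h2.
pose t := GS_scale rho c (data_matrix x n) (U n) mu0 S00 S00.
have t0 : 0 < t by case: feas0.
have obj : GS_scale rho c (data_matrix x n) (U n) (mu n) (S n) (Om n) <=
    s2 / det_root (Om n).
  apply: le_trans (opt (mu0, t *: S00) _) _; last by rewrite /= GS_scale_shapeZ.
  split; first exact: posdefZ.
  exact: GS_scale_normalise.
have r0 := det_root_gt0 pOm.
have [s' Ss'] : exists s', scales (weighted_loss rho c (U n)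
    (GS_dist (data_matrix x n) (U n) (mu n) (S n)) (GS_weight (U n) (Om n)))
    (total_weight c (U n)) s'.
  have [s' Ss'] := GS_scale_solvable feas.
  apply: (weighted_loss_solvable rhoP c_gt0 _ _ Ss') => i; exact: GS_weight_gt0.
rewrite GS_scaleE in obj.
have lts : inf (scales (weighted_loss rho c (U n)
    (GS_dist (data_matrix x n) (U n) (mu n) (S n)) (GS_weight (U n) (Om n)))
    (total_weight c (U n))) < s / det_root (Om n).
  by apply: (le_lt_trans obj); rewrite ltr_pM2r// invr_gt0.
have [s'' [s''0 hs''] s''s] := inf_lt (has_inf_scales Ss').1 lts.
have -> : s = s / det_root (Om n) * det_root (Om n) by rewrite divfK// gt_eqF.
apply: wloss_le_average => //; first by rewrite divr_gt0// (lt_trans sigma0_gt0).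
rewrite -hs''; apply: wloss_noninc => //; exact: ltW.
Unshelve. all: by end_near. Qed.

Let near_scale : \forall n \near \oo,
  `|aloss x (homform (mu n) (V n)) (nu n) n - b| <= e n.
Proof.
near=> n.
have n0 : (0 < n)%N by near: n; exists 1%N.
have pS : posdef (S n) by near: n.
have [[_ /= feas] opt] : GS_estimators rho c (data_matrix x n) (U n) (Om n) (mu n, S n).
  by near: n.
have [s' Ss'] := GS_scale_solvable feas.
have := inf_scales (@wloss_noninc x n (U n) (mu n) (S n) (S n) pS)
  (@wloss_cont x n (U n) (mu n) (S n) (S n) pS) Ss'.
rewrite -GS_scaleE feas => /(_ ltr01)[_ h1].
by have := wloss_eq_average n0 pS pS ltr01 h1; rewrite mul1r.
Unshelve. all: by end_near. Qed.

Let V_posdef : \forall n \near \oo, [/\ posdef (V n), \det (V n) = 1 & 0 < nu n].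
Proof.
apply: filterS S_posdef => n pS; have nu0 : 0 < nu n by exact: det_root_gt0.
split => //; first by apply: posdefZ => //; exact: posdef_inv.
rewrite /V detZ det_inv det_rootX// mulfV// gt_eqF//; exact: posdef_det_gt0.
Qed.

Lemma GS_consistency :
  mxcvg \oo mu mu0 /\ mxcvg \oo S (sigma0 *: S00).
Proof.
have [muc Vc nuc] := consistency_core rhoP Hf cp0 sigma0_gt0 min_unique sloss_gt
  sloss_lt x_typical V_posdef e_cvg0 near_optimal near_scale.
split => //.
have h : mxcvg \oo (fun n => nu n *: invmx (V n)) (sigma0 *: S00).
  by rewrite -[S00]invmxK; exact: mxcvg_scale.
move=> i j; apply: cvg_trans (h i j); apply: near_eq_cvg.
apply: filterS S_posdef => n pS; have nu0 : 0 < nu n by exact: det_root_gt0.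
have -> : invmx (V n) = (nu n)^-1 *: S n.
  rewrite /V invmxZ ?invmxK// posdef_unit//.
  by apply: posdefZ => //; exact: posdef_inv.
by rewrite scalerA divff ?scale1r// gt_eqF.
Qed.

End sample_path.

(** * Densities and signed permutations *)

(** Integration against a density, by Tonelli's theorem applied to the region
    under the graph of [g]. *)
Lemma integral_density (R : realType) (p : nat) (H : probability 'rV[R]_p R)
    (f g : 'rV[R]_p -> R) :
  measurable_fun setT f -> (forall x, 0 <= f x) ->
  (forall A, measurable A -> H A = \int[lebesgue_rV R p]_(x in A) (f x)%:E)%E ->
  measurable_fun setT g -> (forall x, 0 <= g x) ->
  (\int[H]_x (g x)%:E = \int[lebesgue_rV R p]_x (g x * f x)%:E)%E.
Proof.
move=> mf f0 HE mg g0.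
pose A := [set z : 'rV[R]_p * measurableTypeR R | `[0, g z.1]%classic z.2].
have mA : measurable A.
  rewrite -[X in measurable X]setTI.
  have mb : measurable_fun setT (fun z : 'rV[R]_p * measurableTypeR R =>
      (0 <= z.2) && (z.2 <= g z.1)).
    apply: measurable_and.
      by apply: measurable_fun_ler => //; exact: measurable_snd.
    apply: measurable_fun_ler; first exact: measurable_snd.
    exact: (measurableT_comp mg measurable_fst).
  have := mb measurableT [set true] I.
  rewrite (_ : _ @^-1` _ = A)//.
have mI : measurable_fun setT (fun z => (\1_A z : R)%:E).
  exact/measurable_EFinP/measurable_indic.
have I0 z : (0 <= (\1_A z : R)%:E)%E by rewrite lee_fin.
have gE x : (\int[@lebesgue_measure R]_t (\1_A (x, t) : R)%:E = (g x)%:E)%E.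
  transitivity (@lebesgue_measure R `[0, g x]%classic); last first.
    rewrite lebesgue_measure_itv/= lte_fin; case: ltP => [_|g0'].
      by rewrite -EFinB subr0.
    by congr EFin; apply/eqP; rewrite eq_le g0 g0'.
  rewrite -[X in lebesgue_measure X]setIT -integral_indic//.
under eq_integral => x _ do rewrite -gE.
rewrite (fubini_tonelli (fun z => (\1_A z : R)%:E))//.
have mIf : measurable_fun setT (fun z => (\1_A z * f z.1 : R)%:E).
  apply/measurable_EFinP; apply: measurable_realfun.measurable_funM.
    exact: measurable_indic.
  exact: (measurableT_comp mf measurable_fst).
transitivity (\int[@lebesgue_measure R]_t \int[lebesgue_rV R p]_x
    (\1_A (x, t) * f x)%:E)%E.
  apply: eq_integral => t _.
  have mAt : measurable [set x | A (x, t)].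
    rewrite (_ : [set x | A (x, t)] = ysection A t); first exact: measurable_ysection.
    by apply/seteqP; split => x /=; [move=> ?; apply/ysectionP|move/ysectionP].
  transitivity (H [set x | A (x, t)]).
    rewrite -[X in H X]setIT -integral_indic//.
  rewrite HE// [LHS]integral_mkcond; apply: eq_integral => x _.
  rewrite patchE indicE (_ : (x \in [set x | A (x, t)]) = ((x, t) \in A))//.
  by case: ifPn => _; rewrite ?mul1r ?mul0r.
rewrite -(fubini_tonelli (fun z => (\1_A z * f z.1 : R)%:E))//; last first.
  by move=> z; rewrite lee_fin mulr_ge0.
apply: eq_integral => x _ /=.
under eq_integral => t _ do rewrite mulrC EFinM.
rewrite ge0_integralZl//; last 2 first.
- exact: (measurableT_comp mI (pair1_measurable x)).
- by rewrite lee_fin.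
by rewrite gE -EFinM mulrC.
Qed.

Section signed_permutations.
Context (R : realType) (p : nat).
Local Notation leb := (lebesgue_rV R p).

(** Lebesgue measure is characterised by its values on boxes. *)
Lemma lebesgue_rV_map (phi : 'rV[R]_p -> 'rV[R]_p) (h : 'rV[R]_p -> \bar R) :
  measurable_fun setT phi ->
  (forall A, (forall i, measurable (A i)) ->
    leb (phi @^-1` box A) = (\prod_(i < p) lebesgue_measure (A i))%E) ->
  measurable_fun setT h -> (forall x, 0 <= h x)%E ->
  (\int[leb]_y h (phi y) = \int[leb]_y h y)%E.
Proof.
move=> mphi hbox mh h0.
pose nu := @measure_function_pushforward__canonical__measure_function_Measure
  _ _ _ _ _ leb phi mphi.
transitivity (\int[nu]_y h y)%E; first by rewrite /nu ge0_integral_pushforward.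
apply: eq_measure_integral => B mB _.
pose G := [set C : set 'rV[R]_p | exists A : 'I_p -> set R,
  (forall i, measurable (A i)) /\ C = box A].
pose g (k : nat) : set 'rV[R]_p := box (fun=> `[- k%:R, k%:R]%classic).
apply: (measure_unique G g) => //.
- apply/seteqP; split => [C|].
    move: C; apply: smallest_sub; first exact: smallest_sigma_algebra.
    move=> C; rewrite -bigcup_seq/= => -[i _] [D mD <-].
    apply: sub_sigma_algebra; exists (fun j => if j == i then D else setT).
    split; first by move=> j; case: ifP.
    rewrite setTI; apply/seteqP; split => y /=.
      by move=> Dy j; case: eqP => // ->.
    by move=> /(_ i); rewrite eqxx.
  apply: smallest_sub; first exact: sigma_algebra_measurable.
  by move=> C [A [mA ->]]; exact: measurable_boxes.
- move=> _ _ [A [mA ->]] [A' [mA' ->]]; exists (fun i => A i `&` A' i); split.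
    by move=> i; exact: measurableI.
  apply/seteqP; split => y /=; first by move=> [yA yA'] i; split; [exact: yA|exact: yA'].
  by move=> yAA; split => i; have [] := yAA i.
- by move=> k; exists (fun=> `[- k%:R, k%:R]%classic); split.
- apply/seteqP; split => // y _.
  exists (Num.bound (\sum_i `|y 0 i|)) => //= i.
  rewrite /g /box /= in_itv/= -ler_norml ltW// (le_lt_trans _ (archi_boundP _)) ?sumr_ge0//.
  by rewrite (bigD1 i)//= lerDl sumr_ge0.
- by move=> _ [A [mA ->]]; rewrite /= /pushforward hbox// /box lebesgue_rV_box.
- move=> k; rewrite /= /pushforward hbox//.
  rewrite -[X in (X < _)%E]fineK ?ltry//.
  apply: (big_ind (fun z : \bar R => z \is a fin_num)) => //.
    by move=> u v; exact: fin_numM.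
  by move=> i _; rewrite lebesgue_measure_itv/=; case: ifP => _.
Qed.

Definition signed_perm (s : {perm 'I_p}) (eps : 'I_p -> bool) : 'M[R]_p :=
  \matrix_(k, i) ((-1) ^+ eps i *+ (k == s i)).

Lemma mul_signed_perm s eps (y : 'rV[R]_p) i :
  (y *m signed_perm s eps) 0 i = (-1) ^+ eps i * y 0 (s i).
Proof.
rewrite mxE (bigD1 (s i))//= mxE eqxx mulr1n mulrC big1 ?addr0//.
by move=> k /negbTE ki; rewrite mxE ki mulr0n mulr0.
Qed.

Lemma signed_perm_orthogonal s eps :
  signed_perm s eps *m (signed_perm s eps)^T = 1%:M.
Proof.
apply/matrixP => k l; rewrite !mxE (bigD1 (s^-1%g k))//=.
rewrite !mxE permKV eqxx mulr1n big1 ?addr0; last first.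
  move=> i /negbTE ik; rewrite !mxE.
  by rewrite (_ : (k == s i) = false) ?mulr0n ?mul0r//; apply/negbTE; apply: contraFN ik => /eqP ->; rewrite permK.
by rewrite eq_sym mulrnAr -expr2 sqrr_sign.
Qed.

Lemma lebesgue_signed_perm s eps (h : 'rV[R]_p -> \bar R) :
  measurable_fun setT h -> (forall x, 0 <= h x)%E ->
  (\int[leb]_y h (y *m signed_perm s eps) = \int[leb]_y h y)%E.
Proof.
move=> mh h0; apply: lebesgue_rV_map => //.
  exact: (@measurable_mulmx _ _ _ _ _ id).
move=> A mA.
pose sg (b : bool) (t : R) : R := (-1) ^+ b * t.
have msg b (B : set R) : measurable B -> measurable (sg b @^-1` B).
  move=> mB; rewrite -[X in measurable X]setTI.
  by apply: measurable_realfun.measurable_funM.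
have lsg b (B : set R) : measurable B ->
    @lebesgue_measure R (sg b @^-1` B) = lebesgue_measure B.
  move=> mB; case: b.
    rewrite -[RHS]lebesgue_measureN//; congr lebesgue_measure.
    by apply/seteqP; split => t; rewrite /sg /preimage /= expr1 mulN1r.
  congr lebesgue_measure.
  by apply/seteqP; split => t; rewrite /sg /preimage /= expr0 mul1r.
rewrite (_ : _ @^-1` box A =
    box (fun k => sg (eps (s^-1%g k)) @^-1` A (s^-1%g k))); last first.
  apply/seteqP; split => y /=.
    by move=> yA k; have := yA (s^-1%g k); rewrite mul_signed_perm permKV.
  by move=> yA i; rewrite mul_signed_perm; have := yA (s i); rewrite permK.
transitivity (\prod_(k < p) lebesgue_measure
    (sg (eps (s^-1%g k)) @^-1` A (s^-1%g k)))%E.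
  by apply: lebesgue_rV_box => k; exact: msg.
under eq_bigr do rewrite lsg//.
by rewrite [RHS](reindex_perm (s^-1)%g).
Qed.

End signed_permutations.

(** * The normal case *)

Section gaussian.
Context (R : realType) (p : nat).
Local Notation leb := (lebesgue_rV R p).
Local Notation phi := (mvnormal_pdf (0 : 'rV[R]_p) 1%:M).

Lemma mvnormal_pdf_ge0 (m : 'rV[R]_p) C x : 0 <= mvnormal_pdf m C x.
Proof. by rewrite /mvnormal_pdf mulr_ge0 ?expR_ge0// invr_ge0 sqrtr_ge0. Qed.

Lemma measurable_mvnormal_pdf (m : 'rV[R]_p) C :
  measurable_fun setT (mvnormal_pdf m C).
Proof.
apply: measurable_realfun.measurable_funM => //.
apply: (measurableT_comp (@measurable_expR R)).
apply: measurableT_comp => //.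
apply: measurable_realfun.measurable_funM => //.
rewrite (_ : (fun x => _) = (fun x => qform (homform m (invmx C)) (homog x))).
  by apply: measurable_qform; exact: measurable_homog.
by apply/funext => x; rewrite mahalanobisE.
Qed.

Lemma std_mvnormal_pdfE (y : 'rV[R]_p) :
  phi y = (Num.sqrt ((2 * pi) ^+ p))^-1 * expR (- ((y *m y^T) 0 0 / 2)).
Proof. by rewrite /mvnormal_pdf det1 mulr1 /mahalanobis invmx1 mulmx1 subr0. Qed.

Lemma mvnormal_whitening (H : probability 'rV[R]_p R) (m : 'rV[R]_p)
    (C : 'M[R]_p) : posdef C ->
  (forall A, measurable A -> H A = mvnormal m C A) ->
  exists L : 'M[R]_p, [/\ L^T *m L = C, 0 < \det L &
    forall g : 'rV[R]_p -> R, measurable_fun setT g -> (forall x, 0 <= g x) ->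
    (\int[H]_x (g x)%:E = \int[leb]_y (g (m + y *m L) * phi y)%:E)%E].
Proof.
move=> pC HN; have [L [LC L0 subst]] := posdef_whitening pC.
exists L; split => // g mg g0.
have mpdf := measurable_mvnormal_pdf m C.
have pdf0 := mvnormal_pdf_ge0 m C.
rewrite (integral_density mpdf pdf0 HN mg g0).
have mgp : measurable_fun setT (fun x => (g x * mvnormal_pdf m C x)%:E).
  by apply/measurable_EFinP; exact: measurable_realfun.measurable_funM.
rewrite (subst m _ mgp); last by move=> x; rewrite lee_fin mulr_ge0.
rewrite -ge0_integralZl//=; last 3 first.
- apply: (measurableT_comp mgp); apply: measurable_addmx => //.
  exact: (@measurable_mulmx _ _ _ _ _ id).
- by move=> y _; rewrite lee_fin mulr_ge0.
- by rewrite lee_fin ltW.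
apply: eq_integral => y _; rewrite -EFinM; congr EFin.
have uL : L \in unitmx by rewrite unitmxE unitfE gt_eqF.
have maha : mahalanobis (m + y *m L) m C = (y *m y^T) 0 0.
  have LCL : L *m invmx C *m L^T = 1%:M.
    have uLT : L^T \in unitmx by rewrite unitmx_tr.
    rewrite -[LHS](mulKmx uLT) !mulmxA -[_ *m L^T *m L]mulmxA LC.
    by rewrite -[_ *m C *m invmx C]mulmxA mulmxV ?posdef_unit// mulmx1 mulVmx.
  rewrite /mahalanobis addrAC subrr add0r trmx_mul !mulmxA.
  by rewrite -[_ *m L *m invmx C]mulmxA -[_ *m (L *m _) *m _]mulmxA LCL mulmx1.
rewrite std_mvnormal_pdfE /mvnormal_pdf maha -LC det_mulmx det_tr.
have K0 : 0 < (2 * pi) ^+ p :> R by rewrite exprn_gt0// mulr_gt0// pi_gt0.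
rewrite sqrtrM ?(ltW K0)// -expr2 sqrtr_sqr gtr0_norm// invfM.
have sK : Num.sqrt ((2 * pi) ^+ p) != 0 :> R by rewrite gt_eqF// sqrtr_gt0.
by field; rewrite sK gt_eqF.
Qed.

Lemma posdef_congr (M A : 'M[R]_p) : posdef M -> A \in unitmx ->
  posdef (A *m M *m A^T).
Proof.
move=> [MT M0] uA; split; first by rewrite !trmx_mul trmxK MT mulmxA.
move=> y y0.
have -> : y *m (A *m M *m A^T) *m y^T = (y *m A) *m M *m (y *m A)^T.
  by rewrite trmx_mul !mulmxA.
apply: M0; apply: contra_neq y0 => /(congr1 (mulmx^~ (invmx A))).
by rewrite mulmxK// mul0mx.
Qed.

(** A matrix commuting with the sign changes is diagonal, and one commuting with
    the transpositions has a constant diagonal. *)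
Lemma signed_perm_invariant_scalar (M : 'M[R]_p) (i0 : 'I_p) :
  (forall s eps, signed_perm R s eps *m M *m (signed_perm R s eps)^T = M) ->
  M = (M i0 i0)%:M.
Proof.
move=> inv.
have ent (s : {perm 'I_p}) (eps : 'I_p -> bool) i j :
    M (s i) (s j) = (-1) ^+ eps i * (-1) ^+ eps j * M i j.
  have del k : (delta_mx 0 (s k) : 'rV[R]_p) *m signed_perm R s eps =
      (-1) ^+ eps k *: delta_mx 0 k.
    apply/rowP => l; rewrite mul_signed_perm !mxE !eqxx /= (inj_eq perm_inj).
    by case: eqP => [->//|_]; rewrite !mulr0.
  rewrite -[LHS]qform_delta2 -{1}(inv s eps).
  set O := signed_perm R s eps in del *.
  have -> : (delta_mx 0 (s i) : 'rV[R]_p) *m (O *m M *m O^T) *m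
      (delta_mx 0 (s j) : 'rV[R]_p)^T =
    (delta_mx 0 (s i) *m O) *m M *m (delta_mx 0 (s j) *m O)^T.
    by rewrite trmx_mul !mulmxA.
  rewrite !del linearZ/= -scalemxAr -!scalemxAl scalerA mxE qform_delta2.
  by rewrite [X in X * _]mulrC.
apply/matrixP => i j; rewrite [RHS]mxE.
have [<-|ij] := eqVneq i j.
  rewrite mulr1n; have := ent (perm.tperm i i0) xpred0 i0 i0.
  by rewrite perm.tpermR mulr1 mul1r.
rewrite mulr0n.
have := ent 1%g (pred1 i) i j.
rewrite !perm.perm1 /= eqxx (eq_sym j) (negbTE ij) expr1 expr0 mulr1 mulN1r.
by move=> /eqP; rewrite -subr_eq0 opprK -mulr2n mulrn_eq0 => /eqP.
Qed.

(** At the normal distribution the whitened minimiser is invariant under signed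
    permutations, by uniqueness, hence scalar; the tuning constant then gives
    its scale. *)
Lemma normal_scale_shape (rho : R -> R) (rhoP : loss_function rho) (c : nat -> R)
    (H : probability 'rV[R]_p R) (f : 'rV[R]_p -> R) (m : 'rV[R]_p)
    (C S00 : 'M[R]_p) :
  (0 < p)%N -> tuning_constant rho c p -> has_density H f -> positive_near H m ->
  posdef C -> (forall A, measurable A -> H A = mvnormal m C A) ->
  posdef S00 ->
  (forall S, posdef S -> \det S = \det S00 ->
     pop_scale rho c H m S = pop_scale rho c H m S00 -> S = S00) ->
  pop_scale rho c H m S00 *: S00 = C.
Proof.
move=> p0 [cp0 tune] Hf Hpos pC HN pS00 uniq.
have [L [LC L0 white]] := mvnormal_whitening pC HN.
have uL : L \in unitmx by rewrite unitmxE unitfE gt_eqF.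
pose J t (M : 'M[R]_p) := (\int[leb]_y (rho (t * qform M y) * phi y)%:E)%E.
have congrE (A M : 'M[R]_p) y : qform (A *m M *m A^T) y = qform M (y *m A).
  by rewrite /qform trmx_mul !mulmxA.
have elossJ t V : (eloss rho H (t *: homform m V))%:E = J t (L *m V *m L^T).
  rewrite -elossE// white.
  - apply: eq_integral => y _.
    by rewrite /qloss qformZ homformE addrAC subrr add0r congrE.
  - exact: measurable_qloss.
  - by move=> x; exact: loss_ge0.
have Jinv t M s eps :
    J t (signed_perm R s eps *m M *m (signed_perm R s eps)^T) = J t M.
  rewrite /J -[RHS](lebesgue_signed_perm s eps).
  - apply: eq_integral => y _; rewrite congrE !std_mvnormal_pdfE trmx_mul mulmxA.
    by rewrite -[y *m _ *m (signed_perm R s eps)^T]mulmxA signed_perm_orthogonal mulmx1.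
  - apply/measurable_EFinP; apply: measurable_realfun.measurable_funM.
      apply: (measurableT_comp (continuous_measurable_fun (loss_cont rhoP))).
      apply: measurable_realfun.measurable_funM => //.
      exact: (@measurable_qform _ _ _ _ id).
    exact: measurable_mvnormal_pdf.
  - by move=> y; rewrite lee_fin mulr_ge0 ?mvnormal_pdf_ge0//; exact: loss_ge0.
pose V0 := invmx S00.
have pV0 : posdef V0 by exact: posdef_inv.
pose M := L *m V0 *m L^T.
have uLT : L^T \in unitmx by rewrite unitmx_tr.
have inv s eps : signed_perm R s eps *m M *m (signed_perm R s eps)^T = M.
  set O := signed_perm R s eps.
  have OOT : O *m O^T = 1%:M by exact: signed_perm_orthogonal.
  have detO : \det O * \det O = 1 by rewrite -{2}[\det O]det_tr -det_mulmx OOT det1.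
  have uO : O \in unitmx.
    by rewrite unitmxE unitfE; apply: contra_eq_neq detO => ->; rewrite mul0r eq_sym oner_eq0.
  pose A := invmx L *m O *m L.
  pose V' := A *m V0 *m A^T.
  have uA : A \in unitmx by rewrite !unitmx_mul unitmx_inv uL uO.
  have pV' : posdef V' by exact: posdef_congr.
  have detA : \det A * \det A = 1.
    rewrite !det_mulmx det_inv -[RHS]detO.
    by field; rewrite gt_eqF.
  have LV' : L *m V' *m L^T = O *m M *m O^T.
    by rewrite /V' /A !trmx_mul !mulmxA mulmxV// mul1mx trmx_inv -!mulmxA mulVmx// mulmx1 /M !mulmxA.
  have VE : V' = V0.
    rewrite -[V']invmxK; congr invmx; apply: uniq.
    - exact: posdef_inv.
    - rewrite det_inv /V' det_mulmx (det_mulmx A V0) det_tr mulrAC detA mul1r.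
      by rewrite det_inv invrK.
    - rewrite 2!(pop_scaleE rhoP) (invmxK V') -/V0.
      suff -> : scale_loss rho H c (homform m V') = scale_loss rho H c (homform m V0) by [].
      apply/funext => t; apply: EFin_inj.
      by rewrite /scale_loss (elossJ _ V') (elossJ _ V0) LV' Jinv.
  by rewrite -LV' VE.
have ME := signed_perm_invariant_scalar (Ordinal p0) inv.
set lam := M _ _ in ME.
have pM : posdef M by exact: posdef_congr.
have lam0 : 0 < lam.
  rewrite /lam -qform_delta; apply: pM.2; apply/eqP => /rowP/(_ (Ordinal p0))/eqP.
  by rewrite !mxE !eqxx oner_eq0.
have CE : C = lam *: S00.
  have h : V0 *m C = lam%:M.
    have : invmx L *m M *m L = V0 *m C.
      by rewrite /M -LC !mulmxA mulVmx// mul1mx.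
    by rewrite ME mul_mx_scalar -scalemxAl mulVmx// scalemx1 => ->.
  have := congr1 (mulmx S00) h.
  by rewrite mulmxA mulmxV ?posdef_unit// mul1mx mul_mx_scalar.
pose Q := homform m V0.
have pQ : psd Q by apply: homform_psd; exact: posdef_psd.
have Q0 : Q != 0 by exact: homform_neq0.
have [sc0 scb] := pop_scale_sol rhoP Hf cp0 pQ Q0.
have lamb : scale_loss rho H c Q lam = tuning_b R.
  apply: EFin_inj; rewrite -tune /scale_loss elossJ -/M ME.
  apply: eq_integral => y _; congr (_ * _)%:E; congr rho.
  rewrite /qform mul_mx_scalar -scalemxAl mxE.
  by field; rewrite !gt_eqF.
have lt_loss s t : 0 < s -> s < t -> scale_loss rho H c Q t < scale_loss rho H c Q s.
  move=> s0 st; have t0 : 0 < t := lt_trans s0 st.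
  apply: eloss_scale_strict => //; first by rewrite invr_gt0 mulr_gt0.
  by rewrite ltf_pV2 ?posrE ?mulr_gt0// ltr_pM2l.
rewrite CE; congr (_ *: _); rewrite pop_scaleE// -/V0 -/Q.
set sc := inf _ in sc0 scb *.
have [h|h|//] := ltgtP sc lam.
- by have := lt_loss _ _ sc0 h; rewrite scb lamb ltxx.
- by have := lt_loss _ _ lam0 h; rewrite scb lamb ltxx.
Qed.

End gaussian.

(** * Consistency of the generalized S-estimator *)

Theorem theorem3p1 (R : realType) (p : nat) (p_gt0 : (0 < p)%N)
  (d : measure_display) (T : measurableType d) (P : probability T R)
  (* the sample *)
  (H0 : probability 'rV[R]_p R) (X : nat -> {RV P >-> 'rV[R]_p})
  (X_iid : iid H0 X)
  (* the tuning constants *)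
  (rho : R -> R) (c : nat -> R)
  (c_tuned : forall k, (1 <= k <= p)%N -> tuning_constant rho c k)
  (* the filter *)
  (T0 S0 : 'I_p -> forall n, 'cV[R]_n -> R)
  (F : 'I_p -> probability R R) (alpha : R) (alpha01 : 0 < alpha < 1)
  (* (A1) *)
  (rho_even : forall t, rho (- t) = rho t)
  (rho_nondecr : forall s t, `|s| <= `|t| -> rho s <= rho t)
  (rho_incr0 : forall t, 0 < t -> rho 0 < rho t)
  (rho_cont : continuous rho)
  (rho0 : rho 0 = 0)
  (rho_lim : rho v @[v --> +oo] --> (1 : R))
  (* (A2) *)
  (mu0 : 'rV[R]_p) (Sigma0 : 'M[R]_p) (Sigma0_posdef : posdef Sigma0)
  (f0 : R -> R)
  (f0_nonincr : forall s t, 0 <= s -> s <= t -> f0 t <= f0 s)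
  (f0_decr0 : forall t, 0 < t -> f0 t < f0 0)
  (H0_density : has_density H0
     (fun x => (Num.sqrt (\det Sigma0))^-1 * f0 (mahalanobis x mu0 Sigma0)))
  (* (A3) *)
  (Sigma00 : 'M[R]_p)
  (scale_argmin :
     argmin [set th : 'rV[R]_p * 'M[R]_p | posdef th.2 /\ \det th.2 = 1]
            (fun th => pop_scale rho c H0 th.1 th.2) = [set (mu0, Sigma00)])
  (sigma0 : R) (sigma0E : sigma0 = pop_scale rho c H0 mu0 Sigma00)
  (* (A4) *)
  (complete_cvg : {ae P, forall w,
     prop_complete T0 S0 F alpha (data_matrix (fun i => X i w) n)
       @[n --> \oo] --> (1 : R)})
  (* the initial estimator of Sigma0 and the generalized S-estimator *)
  (Omega : nat -> T -> 'M[R]_p)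
  (Omega_posdef : {ae P, forall w, \forall n \near \oo, posdef (Omega n w)})
  (muGS : nat -> T -> 'rV[R]_p) (SigmaGS : nat -> T -> 'M[R]_p)
  (GS_def : {ae P, forall w, \forall n \near \oo,
     let D := data_matrix (fun i => X i w) n in
     GS_estimators rho c D (filter_U T0 S0 F alpha D) (Omega n w)
       (muGS n w, SigmaGS n w)}) :
  [/\ {ae P, forall w, muGS n w @[n --> \oo] --> mu0},
      {ae P, forall w, SigmaGS n w @[n --> \oo] --> sigma0 *: Sigma00} &
      (forall A, measurable A -> H0 A = mvnormal mu0 Sigma0 A) ->
      sigma0 *: Sigma00 = Sigma0].
Proof.
have rhoP : loss_function rho by split.
have c_gt0 k : (1 <= k <= p)%N -> 0 < c k by move=> /c_tuned[].
have pp : (1 <= p <= p)%N by rewrite p_gt0 leqnn.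
have cp0 := c_gt0 p pp.
have Hpos := elliptical_positive_near p_gt0 Sigma0_posdef f0_nonincr H0_density.
have [[/= pS00 detS00] min] : argmin
    [set th : 'rV[R]_p * 'M[R]_p | posdef th.2 /\ \det th.2 = 1]
    (fun th => pop_scale rho c H0 th.1 th.2) (mu0, Sigma00) by rewrite scale_argmin.
have uniq m S : posdef S -> \det S = 1 -> pop_scale rho c H0 m S <= sigma0 ->
    (m, S) = (mu0, Sigma00).
  move=> pS dS le.
  have : argmin [set th : 'rV[R]_p * 'M[R]_p | posdef th.2 /\ \det th.2 = 1]
    (fun th => pop_scale rho c H0 th.1 th.2) (m, S).
    split; first by split.
    move=> th Hth; apply: le_trans (min th Hth).
    by rewrite sigma0E in le; exact: le.
  by rewrite scale_argmin.
pose Q0 := homform mu0 (invmx Sigma00).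
have pV0 := posdef_inv pS00.
have pQ0 : psd Q0 by apply: homform_psd; exact: posdef_psd.
have Q00 : Q0 != 0 by exact: homform_neq0.
have [s00 sb] := pop_scale_sol rhoP H0_density cp0 pQ0 Q00.
have s_gt s := @scale_loss_gt _ _ rhoP _ _ _ H0_density _ cp0 _ pQ0 Q00 s.
rewrite -(pop_scaleE rhoP) -sigma0E in s00 sb s_gt.
have s_lt s : sigma0 < s -> scale_loss rho H0 c Q0 s < tuning_b R.
  move=> ss; rewrite -sb.
  apply: eloss_scale_strict => //.
    by rewrite invr_gt0 mulr_gt0// (lt_trans s00).
  by rewrite ltf_pV2 ?posrE ?mulr_gt0// ?ltr_pM2l// (lt_trans s00).
have min_uniq m V : posdef V -> \det V = 1 ->
    (forall s, sigma0 < s -> scale_loss rho H0 c (homform m V) s <= tuning_b R) ->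
    m = mu0 /\ V = invmx Sigma00.
  move=> pV dV hle.
  have [] : (m, invmx V) = (mu0, Sigma00).
    apply: uniq; first exact: posdef_inv.
      by rewrite det_inv dV invr1.
    apply/ler_addgt0Pr => e e0; rewrite (pop_scaleE rhoP) invmxK.
    have pQ : psd (homform m V) by apply: homform_psd; exact: posdef_psd.
    have QN0 : homform m V != 0 by exact: homform_neq0.
    apply: (pop_scale_le rhoP H0_density cp0 pQ QN0).
      by rewrite addr_gt0.
    by apply: hle; rewrite ltrDl.
  by move=> -> <-; rewrite invmxK.
have path : {ae P, forall w, mxcvg \oo (fun n => muGS n w) mu0 /\
    mxcvg \oo (fun n => SigmaGS n w) (sigma0 *: Sigma00)}.
  have typ := ae_typical rhoP X_iid.
  apply: filterS3 (filterI typ complete_cvg) Omega_posdef GS_def.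
  move=> w [tw cw] Ow Gw.
  exact: (GS_consistency rhoP p_gt0 c_gt0 H0_density pS00 detS00 s00 min_uniq
    s_gt s_lt tw cw Ow Gw).
split.
- by apply: filterS path => w [h _]; exact: mxcvgP.
- by apply: filterS path => w [_ h]; exact: mxcvgP.
move=> HN; rewrite sigma0E.
apply: (normal_scale_shape rhoP p_gt0 (c_tuned p pp) H0_density Hpos
  Sigma0_posdef HN pS00) => S pS dS scS.
have [] // : (mu0, S) = (mu0, Sigma00).
by apply: uniq; [exact: pS|rewrite dS|rewrite scS -sigma0E lexx].
Qed.
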